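(* Let $\theta_1 \in (0,\pi/2]$, $\theta_2 \in [0,\pi/2]$, $p \in\mathcal{C}^2([0,1])$ with $p > 0$, and $\tilde{q} \in\mathcal{C}^0([0,1])$. Let $k_\varphi > 0$, $\Delta k_\varphi \in (0,k_\varphi)$, and $M_\varphi > 0$. Let $q \in\mathcal{C}^0([0,1])$ and $q_c \in\mathbb{R}$ be such that $\tilde q(x) = q(x) - q_c$ and $q(x)>0$ for all $x\in[0,1]$. Let $\delta > 0$ and $N_0 \geq 1$ be such that $-\lambda_n + q_c < - \delta$ for all $n \geq N_0 + 1$. Let $K\in\mathbb{R}^{1 \times N_0}$ and $L\in\mathbb{R}^{N_0}$ be such that $A_0 + k_\varphi \mathfrak{B}_0 K$ and $A_0 - L C_0$ are Hurwitz with eigenvalues that have a real part strictly less than $-\delta<0$. For a given $N \geq N_0 +1$, assume that there exist a symmetric matrix $P\in\mathbb{R}^{2N\times2N}$ with $P \succ 0$, $\alpha>3/2$, and $\beta,\gamma,\tau > 0$ such that $$\Theta_1 \preceq 0 ,\qquad \Theta_2 \leq 0 \qquad(\ast)$$ where $$\Theta_1 = \begin{bmatrix} \Theta_{1,1} & P\mathcal{L} & P\mathcal{L}_\psi \\ \mathcal{L}^\top P & - \beta & 0 \\ \mathcal{L}_\psi^\top P & 0 & \alpha\gamma \Vert \mathcal{R}_N a \Vert_{L^2}^2 - \tau \end{bmatrix} + \alpha\gamma \Vert \mathcal{R}_N b \Vert_{L^2}^2 M_\varphi^2 E^\top E ,$$ $$\Theta_{1,1} = F^\top P + P F + 2 \delta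 P + \left\{ \alpha\gamma k_\varphi^2 \Vert \mathcal{R}_N a \Vert_{L^2}^2 + \tau \Delta k_\varphi^2 \right\} \tilde{K}^\top \tilde{K} ,$$ $$\Theta_2 = 2\gamma\left\{ - \left( 1 - \frac{3}{2\alpha} \right) \lambda_{N+1}+q_c + \delta \right\} + \beta M_\phi ,\qquad M_\phi = \sum_{n \geq N+1} \frac{\vert \phi_n(0) \vert^2}{\lambda_n} < +\infty .$$ Then there exists a constant $M > 0$ such that for any $\varphi \in\mathcal{C}^1(\mathbb{R})$ satisfying $$(k_\varphi - \Delta k_\varphi) \vert x \vert \leq \mathrm{sign}(x) \varphi(x) \leq (k_\varphi + \Delta k_\varphi) \vert x \vert \quad\text{for all } x\in\mathbb{R},$$ with $\varphi'$ locally Lipschitz continuous and $\Vert \varphi' \Vert_{L^\infty} \leq M_\varphi$, and for any initial conditions $z_0 \in H^2(0,1)$ and $\hat{z}_n(0)\in\mathbb{R}$ ($1\le n\le N$) such that $\cos(\theta_1) z_0(0) - \sin(\theta_1) z_0'(0) = 0$ and $\cos(\theta_2) z_0(1) + \sin(\theta_2) z_0'(1) = \varphi(K \hat{Z}^{N_0}(0))$, where $\hat Z^{N_0}=[\hat z_1,\ldots,\hat z_{N_0}]^\top$, the trajectories of the closed-loop system composed of the plant (P) and the controller (C) described in the context satisfy $$\Vert z(t,\cdot) \Vert_{H^1}^2 + \sum_{n = 1}^{N} \hat{z}_n(t)^2 \leq M e^{-2\delta t} \left( \Vert z_0 \Vert_{H^1}^2 + \sum_{n = 1}^{N} \hat{z}_n(0)^2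 \right)$$ for all $t \geq 0$. Moreover, for any given $k_\varphi,M_\varphi > 0$, there exists $\Delta k_\varphi \in (0,k_\varphi)$ such that the constraints $(\ast)$ are always feasible (i.e. such $P,\alpha,\beta,\gamma,\tau$ exist) when selecting $N$ to be large enough.
   Context: All functions are real valued. $\langle f,g\rangle=\int_0^1 fg\,dx$ is the inner product of $L^2(0,1)$. For symmetric matrices, $P\succ0$ (resp. $\succeq 0$, $\preceq 0$) means positive definite (resp. positive semi-definite, negative semi-definite). Sturm-Liouville operator: $\mathcal{A}f=-(pf')'+qf$ on $D(\mathcal{A})=\{f\in H^2(0,1): \cos(\theta_1)f(0)-\sin(\theta_1)f'(0)=0,\ \cos(\theta_2)f(1)+\sin(\theta_2)f'(1)=0\}$. Its eigenvalues $\lambda_1<\lambda_2<\cdots$ are simple, positive (as $q>0$) and tend to $+\infty$; $\phi_n$ are associated unit-norm eigenvectors, forming a Hilbert basis of $L^2(0,1)$. For $f\in L^2(0,1)$, $\mathcal{R}_Nf=\sum_{n\ge N+1}\langle f,\phi_n\rangle\phi_n$. Plant (P): for $t>0$, $x\in(0,1)$, $z_t=(p(x)z_x)_x-\tilde q(x)z$, $\ \cos(\theta_1)z(t,0)-\sin(\theta_1)z_x(t,0)=0$, $\ \cos(\theta_2)z(t,1)+\sin(\theta_2)z_x(t,1)=u_\varphi(t):=\varphi(u(t))$, $\ y(t)=z(t,0)$, $\ z(0,x)=z_0(x)$, with input $u$ and measurement $y$. Let $a(x)=\frac{2p(x)+2xp'(x)-x^2\tilde q(x)}{\cos(\theta_2)+2\sin(\theta_2)}$,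 $b(x)=-\frac{x^2}{\cos(\theta_2)+2\sin(\theta_2)}$, $a_n=\langle a,\phi_n\rangle$, $b_n=\langle b,\phi_n\rangle$, and $\beta_n=a_n+(-\lambda_n+q_c)b_n=p(1)\{-\cos(\theta_2)\phi_n'(1)+\sin(\theta_2)\phi_n(1)\}$. Controller (C), with $K=[k_1,\ldots,k_{N_0}]$ and $L=[l_1,\ldots,l_{N_0}]^\top$: $\hat w_n=\hat z_n+b_nu_\varphi$ for $1\le n\le N$; $\dot{\hat z}_n=(-\lambda_n+q_c)\hat z_n+\beta_nu_\varphi-l_n\{\sum_{k=1}^N\hat w_k\phi_k(0)-y\}$ for $1\le n\le N_0$; $\dot{\hat z}_n=(-\lambda_n+q_c)\hat z_n+\beta_nu_\varphi$ for $N_0+1\le n\le N$; $u=\sum_{k=1}^{N_0}k_k\hat z_k$. Trajectories are understood as classical solutions on a maximal interval $[0,T)$, $0<T\le+\infty$: with $w(t,x)=z(t,x)+b(x)u_\varphi(t)$ (so that $w_t=(pw_x)_x-\tilde qw+a\,u_\varphi+b\,\dot u_\varphi$ with homogeneous boundary conditions, $\dot u_\varphi=\varphi'(u)\dot u$, $y(t)=w(t,0)$, and $w(0,\cdot)\in D(\mathcal A)$) and $\hat z=(\hat z_1,\ldots,\hat z_N)$, one has $(w,\hat z)\in\mathcal{C}^0([0,T);L^2(0,1)\times\mathbb{R}^N)\cap\mathcal{C}^1((0,T);L^2(0,1)\times\mathbb{R}^N)$, $w(t,\cdot)\in D(\mathcal{A})$ for all $t\in(0,T)$, $\mathcal{A}w\in\mathcal{C}^0((0,T);L^2(0,1))$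 and $\mathcal{A}^{1/2}w\in\mathcal{C}^0([0,T);L^2(0,1))$. By standard semigroup theory such solutions exist for the initial conditions considered, and if $T<+\infty$ then $\Vert\mathcal{A}^{1/2}w(t,\cdot)\Vert_{L^2}^2+\Vert\hat z(t)\Vert^2=\sum_{n\ge1}\lambda_n\langle w(t,\cdot),\phi_n\rangle^2+\Vert\hat z(t)\Vert^2$ is unbounded on $[0,T)$. An estimate ''for all $t\ge0$'' includes the assertion $T=+\infty$. Matrices: $A_0=\mathrm{diag}(-\lambda_1+q_c,\ldots,-\lambda_{N_0}+q_c)$, $A_1=\mathrm{diag}(-\lambda_{N_0+1}+q_c,\ldots,-\lambda_N+q_c)$, $\mathfrak{B}_0=[\beta_1,\ldots,\beta_{N_0}]^\top$, $\tilde{\mathfrak{B}}_1=\left[\frac{\beta_{N_0+1}}{\lambda_{N_0+1}},\ldots,\frac{\beta_N}{\lambda_N}\right]^\top$, $C_0=[\phi_1(0),\ldots,\phi_{N_0}(0)]$, $\tilde C_1=\left[\frac{\phi_{N_0+1}(0)}{\sqrt{\lambda_{N_0+1}}},\ldots,\frac{\phi_N(0)}{\sqrt{\lambda_N}}\right]$, $$F=\begin{bmatrix}A_0+k_\varphi\mathfrak{B}_0K&LC_0&0&L\tilde C_1\\0&A_0-LC_0&0&-L\tilde C_1\\k_\varphi\tilde{\mathfrak{B}}_1K&0&A_1&0\\0&0&0&A_1\end{bmatrix},\quad\mathcal{L}=\begin{bmatrix}L\\-L\\0\\0\end{bmatrix},\quad\mathcal{L}_\psi=\begin{bmatrix}\mathfrak{B}_0\\0\\\tilde{\mathfrak{B}}_1\\0\end{bmatrix},$$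 $\tilde K=[K\ 0\ 0\ 0]\in\mathbb{R}^{1\times 2N}$, and $E=K\,[A_0+k_\varphi\mathfrak{B}_0K\ \ LC_0\ \ 0\ \ L\tilde C_1\ \ L\ \ \mathfrak{B}_0]\in\mathbb{R}^{1\times(2N+2)}$, with block sizes $N_0,N_0,N-N_0,N-N_0$ (and two last blocks of size $1$ for $E$). In the final ''Moreover'' assertion, $\theta_1,\theta_2,p,\tilde q,q,q_c,\delta,N_0,K,L$ are given and satisfy the hypotheses stated in the claim, and $\Delta k_\varphi$ does not depend on $N$. *)

(* Defs.v *)
From HB Require Import structures.
From mathcomp Require Export all_boot all_order all_algebra.
From mathcomp Require Export all_classical all_reals all_analysis.
From mathcomp.real_closed Require Export complex.

Set Implicit Arguments.
Unset Strict Implicit.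
Unset Printing Implicit Defensive.

Import Order.TTheory GRing.Theory Num.Theory.
Import numFieldTopology.Exports numFieldNormedType.Exports.

Local Open Scope classical_set_scope.
Local Open Scope ring_scope.

(* Conventions.
   - Sequences are indexed from 0: [lam n], [phi n], [zh n] are the mathematical
     $\lambda_{n+1}$, $\phi_{n+1}$, $\hat z_{n+1}$. Hence "n >= N + 1" becomes
     [(N <= n)%N].
   - A function on (0,1) is a total function [R -> R] of which only the values
     on [0,1] matter; an element of H^1(0,1) or H^2(0,1) is represented by its
     continuous representative, so that its boundary values make sense. *)

Section FunctionSpaces.
Context {R : realType}.
Local Notation mu := (@lebesgue_measure R).
Implicit Types (f g : R -> R) (x : R).

Definition I01 : set R := `[0, 1].

Definition L2 f : Prop := f \_ I01 \in Lfun mu 2%:E.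

Definition inner f g : R := \int[mu]_(x in I01) (f x * g x).

(* Meaningful on L2 only: [Rintegral] is 0 when the integral is infinite. *)
Definition sqnorm f : R := inner f f.

Definition L2_cvg {U : Type} (F : set_system U) (f : U -> R -> R) g : Prop :=
  [/\ \forall u \near F, L2 (f u), L2 g
    & sqnorm (fun x => f u x - g x) @[u --> F] --> (0 : R)].

Definition L2_continuous (S : set R) (f : R -> R -> R) : Prop :=
  forall t, S t -> L2_cvg (within S (nbhs t)) f (f t).

Definition L2_derivative (f : R -> R -> R) (t : R) g : Prop :=
  L2_cvg t^' (fun s x => (s - t)^-1 * (f s x - f t x)) g.

(* Difference quotients within [0,1]: the derivative is one-sided at 0 and 1. *)
Definition derivable01 f x : Prop :=
  cvg ((f y - f x) / (y - x) @[y --> within I01 x^']).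

Definition D01 f x : R := lim ((f y - f x) / (y - x) @[y --> within I01 x^']).

Definition C2_01 f : Prop :=
  [/\ forall x, I01 x -> derivable01 f x,
      forall x, I01 x -> derivable01 (D01 f) x
    & {within I01, continuous (D01 (D01 f))}].

(* [f] is (the continuous representative of) an element of H^1(0,1) with weak
   derivative [g]. *)
Definition is_wderiv f g : Prop :=
  L2 g /\ forall x, I01 x -> f x = f 0 + \int[mu]_(y in `[0, x]) g y.

Definition H1 f : Prop := exists g, is_wderiv f g.

(* A representative of the weak derivative, determined up to a null set. *)
Definition wD f : R -> R := xget (fun=> 0) [set g | is_wderiv f g].

Definition H2 f : Prop := (forall x, I01 x -> derivable01 f x) /\ H1 (D01 f).

Definition H1sqnorm f : R := sqnorm f + sqnorm (wD f).

(* A representative of the sum in L^2(0,1) of the series with general term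
   [c n] times [phi n], n >= N. *)
Definition L2_series (phi : nat -> R -> R) (N : nat) (c : nat -> R) : R -> R :=
  xget (fun=> 0)
    [set g | L2_cvg \oo (fun m x => \sum_(N <= n < m) c n * phi n x) g].

End FunctionSpaces.

Section SturmLiouville.
Context {R : realType}.
Local Notation mu := (@lebesgue_measure R).
Variables (th1 th2 : R) (p q : R -> R).

Definition domA (f : R -> R) : Prop :=
  [/\ H2 f, cos th1 * f 0 - sin th1 * D01 f 0 = 0
    & cos th2 * f 1 + sin th2 * D01 f 1 = 0].

Definition opA (f : R -> R) : R -> R :=
  fun x => - wD (fun y => p y * D01 f y) x + q x * f x.

(* By completeness of [phi], every eigenvalue is some [lam n], and it is simple
   since [lam] is strictly increasing. *)
Record eigenbasis (lam : nat -> R) (phi : nat -> R -> R) : Prop := Eigenbasis {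
  lam_increasing : forall m n, (m < n)%N -> lam m < lam n;
  lam_gt0 : forall n, 0 < lam n;
  lam_pinfty : lam @ \oo --> +oo;
  phi_domA : forall n, domA (phi n);
  phi_eigen : forall n,
    opA (phi n) = (fun x => lam n * phi n x) %[ae mu in I01];
  phi_orthonormal : forall m n, inner (phi m) (phi n) = (m == n)%:R;
  phi_complete : forall f, L2 f ->
    L2_cvg \oo (fun m x => \sum_(0 <= n < m) inner f (phi n) * phi n x) f
}.

Variables (lam : nat -> R) (phi : nat -> R -> R).

(* The operator A^{1/2}; the series converges for f in its domain, in particular
   on [domA]. *)
Definition Ahalf (f : R -> R) : R -> R :=
  L2_series phi 0 (fun n => Num.sqrt (lam n) * inner f (phi n)).

Definition remainder (N : nat) (f : R -> R) : R -> R :=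
  L2_series phi N (fun n => inner f (phi n)).

Definition M_phi (N : nat) : \bar R :=
  (\sum_(N <= n <oo) (`|phi n 0| ^+ 2 / lam n)%:E)%E.

End SturmLiouville.

Section MatrixPredicates.
Context {R : realType}.

Definition posdef {n} (A : 'M[R]_n) : Prop :=
  A^T = A /\ forall x : 'cV[R]_n, x != 0 -> 0 < (x^T *m A *m x) 0 0.

Definition negsemidef {n} (A : 'M[R]_n) : Prop :=
  A^T = A /\ forall x : 'cV[R]_n, (x^T *m A *m x) 0 0 <= 0.

Definition spectrum_lt {n} (A : 'M[R]_n) (r : R) : Prop :=
  forall s : R[i], eigenvalue (map_mx (real_complex R) A) s -> complex.Re s < r.

End MatrixPredicates.

Section ClosedLoop.
Context {R : realType}.
Variables (th1 th2 : R) (p qt q : R -> R) (qc : R).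
Variables (lam : nat -> R) (phi : nat -> R -> R).

Definition a_fun (x : R) : R :=
  (2 * p x + 2 * x * D01 p x - x ^+ 2 * qt x) / (cos th2 + 2 * sin th2).

Definition b_fun (x : R) : R := - (x ^+ 2 / (cos th2 + 2 * sin th2)).

Definition a_ (n : nat) : R := inner a_fun (phi n).
Definition b_ (n : nat) : R := inner b_fun (phi n).
Definition beta_ (n : nat) : R := a_ n + (- lam n + qc) * b_ n.

Variables (N0 : nat) (K : 'rV[R]_N0) (L : 'cV[R]_N0).

Definition A0 : 'M[R]_N0 := diag_mx (\row_(i < N0) (- lam i + qc)).
Definition B0 : 'cV[R]_N0 := \col_(i < N0) beta_ i.
Definition C0 : 'rV[R]_N0 := \row_(i < N0) phi i 0.

Section Matrices.
Variable N : nat.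
Local Notation m := (N - N0)%N.
(* For N0 <= N, the size [N0 + N0 + (m + m)] is 2N. *)

Definition A1 : 'M[R]_m := diag_mx (\row_(i < m) (- lam (N0 + i)%N + qc)).
Definition B1t : 'cV[R]_m :=
  \col_(i < m) (beta_ (N0 + i)%N / lam (N0 + i)%N).
Definition C1t : 'rV[R]_m :=
  \row_(i < m) (phi (N0 + i)%N 0 / Num.sqrt (lam (N0 + i)%N)).

Variables (delta kphi Dkphi Mphi : R).

Definition F_mx : 'M[R]_(N0 + N0 + (m + m)) :=
  block_mx
    (block_mx (A0 + kphi *: (B0 *m K)) (L *m C0)
              0                        (A0 - L *m C0))
    (block_mx 0 (L *m C1t)
              0 (- (L *m C1t)))
    (block_mx (kphi *: (B1t *m K)) 0
              0                    0)
    (block_mx A1 0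
              0  A1).

Definition L_mx : 'cV[R]_(N0 + N0 + (m + m)) :=
  col_mx (col_mx L (- L)) (col_mx 0 0).

Definition Lpsi_mx : 'cV[R]_(N0 + N0 + (m + m)) :=
  col_mx (col_mx B0 0) (col_mx B1t 0).

Definition Kt_mx : 'rV[R]_(N0 + N0 + (m + m)) :=
  row_mx (row_mx K 0) (row_mx 0 0).

Definition E_mx : 'rV[R]_(N0 + N0 + (m + m) + 1 + 1) :=
  K *m row_mx (row_mx (row_mx (row_mx (A0 + kphi *: (B0 *m K)) (L *m C0))
                              (row_mx 0 (L *m C1t)))
                      L)
              B0.

Variables (P : 'M[R]_(N0 + N0 + (m + m))) (alpha beta gamma tau : R).

Definition Theta11 : 'M[R]_(N0 + N0 + (m + m)) :=
  F_mx^T *m P + P *m F_mx + (2 * delta) *: P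
  + (alpha * gamma * kphi ^+ 2 * sqnorm (remainder phi N a_fun)
     + tau * Dkphi ^+ 2) *: (Kt_mx^T *m Kt_mx).

Definition Theta1 : 'M[R]_(N0 + N0 + (m + m) + 1 + 1) :=
  block_mx
    (block_mx Theta11        (P *m L_mx)
              (L_mx^T *m P)  (- beta)%:M)
    (col_mx (P *m Lpsi_mx)
            0)
    (row_mx (Lpsi_mx^T *m P) 0)
    (alpha * gamma * sqnorm (remainder phi N a_fun) - tau)%:M
  + (alpha * gamma * sqnorm (remainder phi N b_fun) * Mphi ^+ 2)
      *: (E_mx^T *m E_mx).

Definition Theta2 : R :=
  2 * gamma * (- (1 - 3 / (2 * alpha)) * lam N + qc + delta)
  + beta * fine (M_phi lam phi N).

End Matrices.

Definition feasible (delta kphi Dkphi Mphi : R) (N : nat) : Prop :=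
  exists (P : 'M[R]_(N0 + N0 + (N - N0 + (N - N0))))
         (alpha beta gamma tau : R),
    [/\ posdef P, 3 / 2 < alpha, [/\ 0 < beta, 0 < gamma & 0 < tau],
        negsemidef (Theta1 delta kphi Dkphi Mphi P alpha beta gamma tau)
      & Theta2 N delta alpha beta gamma <= 0].

Section Trajectories.
Variables (N : nat) (vphi : R -> R).

Definition control (zh : nat -> R -> R) (t : R) : R :=
  \sum_(k < N0) K 0 k * zh k t.

Definition homogenized (z : R -> R -> R) (zh : nat -> R -> R) : R -> R -> R :=
  fun t x => z t x + b_fun x * vphi (control zh t).

(* [0,T) and (0,T), where T may be +oo. *)
Definition upto (T : \bar R) : set R := [set t | 0 <= t /\ (t%:E < T)%E].
Definition inside (T : \bar R) : set R := [set t | 0 < t /\ (t%:E < T)%E].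

Record classical_solution (T : \bar R) (z : R -> R -> R)
    (zh : nat -> R -> R) : Prop := ClassicalSolution {
  sol_pde : forall t, inside T t ->
    L2_derivative z t
      (fun x => wD (fun y => p y * D01 (z t) y) x - qt x * z t x);
  sol_bc0 : forall t, inside T t ->
    cos th1 * z t 0 - sin th1 * D01 (z t) 0 = 0;
  sol_bc1 : forall t, inside T t ->
    cos th2 * z t 1 + sin th2 * D01 (z t) 1 = vphi (control zh t);
  sol_obs_lo : forall (n : 'I_N0) t, inside T t ->
    is_derive t (1 : R) (zh n)
      ((- lam n + qc) * zh n t + beta_ n * vphi (control zh t)
       - L n 0 * (\sum_(k < N)
                    (zh k t + b_ k * vphi (control zh t)) * phi k 0 - z t 0));
  sol_obs_hi : forall n t, (N0 <= n < N)%N -> inside T t ->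
    is_derive t (1 : R) (zh n)
      ((- lam n + qc) * zh n t + beta_ n * vphi (control zh t));
  sol_w_C0 : L2_continuous (upto T) (homogenized z zh);
  sol_w_C1 : exists wt : R -> R -> R,
    (forall t, inside T t -> L2_derivative (homogenized z zh) t (wt t)) /\
    L2_continuous (inside T) wt;
  sol_zh_C0 : forall n, (n < N)%N -> {within upto T, continuous (zh n)};
  sol_zh_C1 : forall n, (n < N)%N ->
    (forall t, inside T t -> derivable (zh n) t 1) /\
    {within inside T, continuous (derive1 (zh n))};
  sol_w_domA : forall t, upto T t -> domA th1 th2 (homogenized z zh t);
  sol_Aw_C0 : L2_continuous (inside T) (fun t => opA p q (homogenized z zh t));
  sol_Ahalf_C0 :
    L2_continuous (upto T) (fun t => Ahalf lam phi (homogenized z zh t))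
}.

(* [traj_blowup] is the blow-up alternative of semigroup theory; it is part of
   what is meant by a trajectory. *)
Record trajectory (z0 : R -> R) (zh0 : nat -> R) (T : \bar R)
    (z : R -> R -> R) (zh : nat -> R -> R) : Prop := Trajectory {
  traj_T_gt0 : (0 < T)%E;
  traj_init_z : forall x, I01 x -> z 0 x = z0 x;
  traj_init_zh : forall n, (n < N)%N -> zh n 0 = zh0 n;
  traj_solution : classical_solution T z zh;
  traj_maximal : forall (T' : \bar R) z' zh', (T < T')%E ->
    classical_solution T' z' zh' ->
    ~ ((forall t x, upto T t -> I01 x -> z' t x = z t x) /\
       (forall n t, (n < N)%N -> upto T t -> zh' n t = zh n t));
  traj_blowup : (T < +oo)%E ->
    ~ exists B : R, forall t, upto T t ->
        sqnorm (Ahalf lam phi (homogenized z zh t))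
        + \sum_(n < N) zh n t ^+ 2 <= B
}.

End Trajectories.

End ClosedLoop.

Section Nonlinearity.
Context {R : realType}.
Local Notation mu := (@lebesgue_measure R).

Record admissible (kphi Dkphi Mphi : R) (vphi : R -> R) : Prop := Admissible {
  adm_derivable : forall x, derivable vphi x 1;
  adm_continuous : continuous (derive1 vphi);
  adm_sector : forall x,
    (kphi - Dkphi) * `|x| <= Num.sg x * vphi x <= (kphi + Dkphi) * `|x|;
  adm_lipschitz : forall x : R, exists2 U : set R,
    nbhs x U & [lipschitz (derive1 vphi) y | y in U];
  adm_bound : ('N[mu]_+oo [EFin \o derive1 vphi] <= Mphi%:E)%E
}.

End Nonlinearity.

(* Main.v *)
Require Import Defs.
From mathcomp Require Import measurable_realfun ess_sup_inf spectral ring lra.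
Import Order.TTheory GRing.Theory Num.Theory.
Import numFieldTopology.Exports numFieldNormedType.Exports.
Set Implicit Arguments.
Unset Strict Implicit.
Unset Printing Implicit Defensive.
Local Open Scope classical_set_scope.
Local Open Scope ring_scope.

(* Write w = z + b u_phi, so that w(t) lies in D(A), let w_n be its Fourier
   coefficients and e_n = w_n - b_n u_phi - zhat_n the observer errors. The
   functional is V = X^T P X + gamma sum_{n > N} lambda_n w_n^2, where X collects
   the first N pairs (zhat_n, e_n), rescaled as in the matrix F. Instead of
   differentiating the infinite sum one uses <A w, w>, whose derivative is
   2 <A w, w_t> because A is symmetric; the tail is this form minus N terms.
   Young's inequality on the modes n > N and the trace estimate
   (sum_{n > N} w_n phi_n(0))^2 <= M_phi sum_{n > N} lambda_n w_n^2 turn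
   V' + 2 delta V into the quadratic form of Theta_1 plus Theta_2 times the tail.
   Since <A w, w> is equivalent to the squared H^1 norm, V is equivalent to the
   norm in the claim, uniformly in phi, which also excludes blow-up. For the
   feasibility, a block diagonal P built from two Lyapunov matrices and two
   scalars gives a margin independent of N, and the norms of R_N a and R_N b
   tend to 0. *)

(** Time 0 is the delicate instant: A w is continuous only for t > 0, so V is differentiated on the
    open interval and carried to t = 0 by the continuity of A^{1/2} w, since |A^{1/2} w|^2 = <A w,
    w>. Passing from z to w puts b u_phi' into the equation. As u' = K zhat' is linear in X, in the
    trace zeta of the modes n > N and in psi = u_phi - kphi u, this term is the row E, and the slope
    bound [Mphi] turns it into E^T E. Otherwise the nonlinearity is seen only through psi^2 <=
    Dkphi^2 u^2. Both zeta and psi are treated as free inputs, paid for with the multipliers beta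
    and tau. The quotient 3/(2 alpha) comes from three Young inequalities, for the inputs kphi u a,
    psi a and u_phi' b. The scaling of the modes N0 < n <= N keeps the blocks [B1t] and [C1t]
    bounded in N, so that one pair of Lyapunov matrices serves all N. Weak derivatives are encoded
    as integrals from 0; the product rule behind Green's formula is then obtained from partitions of
    [0,1]. *)

Lemma discriminant_le (R : realFieldType) (a b c : R) : 0 <= c ->
  (forall t, 0 <= a - 2 * (t * b) + t ^+ 2 * c) -> b ^+ 2 <= a * c.
Proof.
(* For [c = 0], as happens with null functions of L^2, the expression is affine in [t]; if [b != 0]
   it equals -1 at the [t] chosen below. For [c > 0] the minimizer [b / c] is used. *)
rewrite le_eqVlt => /predU1P[<-|c0] H.
  have [->|b0] := eqVneq b 0; first by rewrite expr0n mulr0.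
  have a0 : 0 <= a by have := H 0; rewrite expr0n /= !mul0r mulr0 subr0 addr0.
  have := H ((a + 1) / 2 / b).
  by rewrite mulr0 addr0 -mulrA mulVf// mulr1; lra.
have := H (b / c); rewrite (_ : _ + _ = a - b ^+ 2 / c).
  by rewrite subr_ge0 ler_pdivrMr.
by field; rewrite gt_eqF.
Qed.

(** * The space L^2(0,1) and its inner product *)

Section L2Space.
Context {R : realType}.
Local Notation mu := (@lebesgue_measure R).
Implicit Types (f g h : R -> R) (x : R).

Lemma I01E x : I01 x = (0 <= x <= 1).
Proof. by rewrite /I01 /= in_itv. Qed.

Lemma ler_norm_sqr (x y : R) : 0 <= y -> x ^+ 2 <= y ^+ 2 -> `|x| <= y.
Proof.
move=> y0 xy; rewrite -(ger0_norm y0) -(sqrtr_sqr x) -(sqrtr_sqr y).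
exact: ler_wsqrtr.
Qed.

Lemma measurable_I01 : measurable (@I01 R).
Proof. exact: measurable_itv. Qed.
Hint Resolve measurable_I01 : core.

Lemma lebesgue_measure_I01 : mu (@I01 R) = 1%:E.
Proof. by rewrite /I01 lebesgue_measure_itv /= lte_fin ltr01 -EFinB subr0. Qed.

Lemma L2_ext f g : (forall x, I01 x -> f x = g x) -> L2 f -> L2 g.
Proof.
move=> fg; rewrite /L2; suff -> : f \_ I01 = g \_ I01 by [].
by apply/funext => x; rewrite !patchE; case: ifPn => // /set_mem; exact: fg.
Qed.

Lemma inner_ext f1 f2 g1 g2 : (forall x, I01 x -> f1 x = f2 x) ->
  (forall x, I01 x -> g1 x = g2 x) -> inner f1 g1 = inner f2 g2.
Proof.
move=> f12 g12; apply: eq_Rintegral => x /set_mem Ix.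
by rewrite f12// g12.
Qed.

Lemma innerC f g : inner f g = inner g f.
Proof. by apply: eq_Rintegral => x _; rewrite mulrC. Qed.

Lemma L2D f g : L2 f -> L2 g -> L2 (fun x => f x + g x).
Proof.
move=> Lf Lg; rewrite /L2.
rewrite (_ : _ \_ _ = f \_ I01 + g \_ I01); first exact: (Lfun_addr_closed _ (lee1n 2)).2.
by apply/funext => x; rewrite /= !fctE !patchE; case: ifPn => //; rewrite addr0.
Qed.

Lemma L2Z c f : L2 f -> L2 (fun x => c * f x).
Proof.
move=> Lf; rewrite /L2.
rewrite (_ : _ \_ _ = c \o* (f \_ I01)); first by apply: Lfun_scale => //; rewrite ler1n.
apply/funext => x; rewrite /= !patchE; case: ifPn => //; first by rewrite mulrC.
by rewrite mul0r.
Qed.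

Lemma L2N f : L2 f -> L2 (fun x => - f x).
Proof. by move=> /(@L2Z (-1)); apply: L2_ext => x _; rewrite mulN1r. Qed.

Lemma L2B f g : L2 f -> L2 g -> L2 (fun x => f x - g x).
Proof. by move=> Lf /L2N; exact: L2D. Qed.

Lemma L20 : L2 (fun=> 0 : R).
Proof.
rewrite /L2 (_ : _ \_ _ = 0); first exact: (Lfun_addr_closed _ (lee1n 2)).1.
by apply/funext => x; rewrite patchE; case: ifP.
Qed.

Lemma L2_sum (I : Type) (r : seq I) (P : pred I) (F : I -> R -> R) :
  (forall i, P i -> L2 (F i)) -> L2 (fun x => \sum_(i <- r | P i) F i x).
Proof.
move=> LF; elim: r => [|i r IH].
  by apply: L2_ext L20 => x _; rewrite big_nil.
case Pi: (P i).
  by apply: L2_ext (L2D (LF i Pi) IH) => x _; rewrite big_cons Pi.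
by apply: L2_ext IH => x _; rewrite big_cons Pi.
Qed.

Lemma inner_integrable f g : L2 f -> L2 g ->
  mu.-integrable I01 (EFin \o (fun x => f x * g x)).
Proof.
move=> Lf Lg.
have /Lfun1_integrable H := Lfun2_mul_Lfun1 Lf Lg.
apply/integrable_mkcond => //; apply: eq_integrable H => // x _ /=.
by rewrite !patchE; case: ifPn => //=; rewrite mul0r.
Qed.

Lemma L2_dominated f g : measurable_fun I01 f ->
  (forall x, I01 x -> `|f x| <= `|g x|) -> L2 g -> L2 f.
Proof.
move=> mf fg Lg; have /andP[] := Lg; rewrite !inE /= => mg nMg.
rewrite /L2 inE; apply/andP; split; rewrite inE /=.
  by apply/(measurable_restrictT _ measurable_I01).
move: nMg; rewrite /finite_norm; apply: le_lt_trans.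
rewrite unlock /Lnorm; apply: gt0_ler_poweR => //.
- by rewrite in_itv/= leey integral_ge0// => x _; rewrite lee_fin powR_ge0.
- by rewrite in_itv/= leey integral_ge0// => x _; rewrite lee_fin powR_ge0.
- apply: ge0_le_integral => //.
  + by move=> x _; rewrite lee_fin powR_ge0.
  + apply/measurable_EFinP.
    apply: (@measurableT_comp _ _ _ _ _ _ (fun x : R => x `^ 2)%R) => //.
    apply: measurableT_comp => //.
    by apply/(measurable_restrictT _ measurable_I01).
  + apply/measurable_EFinP.
    apply: (@measurableT_comp _ _ _ _ _ _ (fun x : R => x `^ 2)%R) => //.
    exact: measurableT_comp.
  + move=> x _; rewrite lee_fin; apply: ge0_ler_powR => //=; rewrite ?nnegrE//.
    by rewrite !patchE; case: ifPn => // /set_mem; exact: fg.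
Qed.

Lemma L2_cst c : L2 (fun=> c : R).
Proof.
suff L1 : L2 (fun=> 1 : R) by apply: L2_ext (L2Z c L1) => x _; rewrite mulr1.
rewrite /L2 (_ : _ \_ _ = \1_(@I01 R) :> (R -> R)); last first.
  by apply/funext => x; rewrite patchE indicE; case: ifP => // ->.
rewrite inE; apply/andP; split; rewrite inE /=.
  exact: measurable_indic.
rewrite /finite_norm unlock /Lnorm.
rewrite poweR_lty//.
rewrite [ltLHS](_ : _ = \int[mu]_x (\1_(@I01 R) x)%:E)%E.
  by rewrite integral_indic// setIT -[X in (X < _)%E]/(mu I01) lebesgue_measure_I01 ltry.
apply: eq_integral => x _ /=; rewrite indicE; case: (x \in _) => /=.
  by rewrite normr1 powR1.
by rewrite normr0 powR0.
Qed.

Lemma L2_integrable f : L2 f -> mu.-integrable I01 (EFin \o f).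
Proof.
move=> Lf; have := inner_integrable Lf (L2_cst 1).
by apply: eq_integrable => // x _ /=; rewrite mulr1.
Qed.

Lemma L2_measurable f : L2 f -> measurable_fun I01 f.
Proof. by move=> /L2_integrable /measurable_int /measurable_EFinP. Qed.

Lemma L2_bounded f (M : R) : measurable_fun I01 f ->
  (forall x, I01 x -> `|f x| <= M) -> L2 f.
Proof.
move=> mf fM; apply: L2_dominated mf _ (L2_cst M) => x Ix.
by rewrite (le_trans (fM x Ix))// ler_norm.
Qed.

Lemma within_I01_measurable f : {within I01, continuous f} -> measurable_fun I01 f.
Proof. exact: subspace_continuous_measurable_fun. Qed.

Lemma within_I01_bounded f : {within I01, continuous f} ->
  exists2 M, 0 < M & forall x, I01 x -> `|f x| <= M.
Proof.
move=> cf; have /compact_bounded := continuous_compact cf (segment_compact (a := 0) (b := 1)).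
move=> [M [_ MB]]; exists (`|M| + 1); first by rewrite ltr_pwDr.
move=> x Ix; apply: (MB (`|M| + 1)); last by exists x.
by rewrite (le_lt_trans (ler_norm M))// ltrDl.
Qed.

Lemma within_I01_L2 f : {within I01, continuous f} -> L2 f.
Proof.
move=> cf; have [M _ fM] := within_I01_bounded cf.
exact: L2_bounded (within_I01_measurable cf) fM.
Qed.

Lemma L2_boundedM f g (M : R) : measurable_fun I01 f ->
  (forall x, I01 x -> `|f x| <= M) -> L2 g -> L2 (fun x => f x * g x).
Proof.
move=> mf fM Lg; apply: L2_dominated (L2Z M Lg).
  by apply: measurable_funM => //; exact: L2_measurable.
by move=> x Ix; rewrite !normrM ler_wpM2r// (le_trans (fM x Ix))// ler_norm.
Qed.

Lemma L2_continuousM f g : {within I01, continuous f} -> L2 g -> L2 (fun x => f x * g x).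
Proof.
move=> cf; have [M _ fM] := within_I01_bounded cf.
exact: L2_boundedM (within_I01_measurable cf) fM.
Qed.

Lemma innerDl f g h : L2 f -> L2 g -> L2 h ->
  inner (fun x => f x + g x) h = inner f h + inner g h.
Proof.
move=> Lf Lg Lh; rewrite /inner -RintegralD//; try exact: inner_integrable.
by apply: eq_Rintegral => x _; rewrite mulrDl.
Qed.

Lemma innerZl c f h : L2 f -> L2 h -> inner (fun x => c * f x) h = c * inner f h.
Proof.
move=> Lf Lh; rewrite /inner -RintegralZl//; last exact: inner_integrable.
by apply: eq_Rintegral => x _; rewrite mulrA.
Qed.

Lemma innerNl f h : L2 f -> L2 h -> inner (fun x => - f x) h = - inner f h.
Proof.
move=> Lf Lh; rewrite -mulN1r -innerZl//.
by apply: inner_ext => // x _; rewrite mulN1r.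
Qed.

Lemma innerBl f g h : L2 f -> L2 g -> L2 h ->
  inner (fun x => f x - g x) h = inner f h - inner g h.
Proof. by move=> Lf Lg Lh; rewrite innerDl ?innerNl//; exact: L2N. Qed.

Lemma innerDr f g h : L2 f -> L2 g -> L2 h ->
  inner h (fun x => f x + g x) = inner h f + inner h g.
Proof. by move=> *; rewrite innerC innerDl// !(innerC h). Qed.

Lemma innerZr c f h : L2 f -> L2 h -> inner h (fun x => c * f x) = c * inner h f.
Proof. by move=> *; rewrite innerC innerZl// !(innerC h). Qed.

Lemma innerBr f g h : L2 f -> L2 g -> L2 h ->
  inner h (fun x => f x - g x) = inner h f - inner h g.
Proof. by move=> *; rewrite innerC innerBl// !(innerC h). Qed.

Lemma inner_suml (I : Type) (r : seq I) (P : pred I) (F : I -> R -> R) h :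
  (forall i, P i -> L2 (F i)) -> L2 h ->
  inner (fun x => \sum_(i <- r | P i) F i x) h = \sum_(i <- r | P i) inner (F i) h.
Proof.
move=> LF Lh; elim: r => [|i r IH].
  rewrite big_nil /inner; under eq_Rintegral do rewrite big_nil mul0r.
  by rewrite Rintegral_cst// mul0r.
rewrite big_cons; case: ifPn => Pi.
  rewrite -IH -innerDl//; [|exact: LF|exact: L2_sum].
  by apply: inner_ext => // x _; rewrite big_cons Pi.
by rewrite -IH; apply: inner_ext => // x _; rewrite big_cons (negbTE Pi).
Qed.

Lemma inner_cst (c d : R) : inner (fun=> c) (fun=> d) = c * d.
Proof.
rewrite /inner Rintegral_cst//.
by rewrite -[X in fine X]/(mu I01) lebesgue_measure_I01 mulr1.
Qed.

Lemma sqnorm_ge0 f : 0 <= sqnorm f.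
Proof. by apply: Rintegral_ge0 => x _; rewrite -expr2 sqr_ge0. Qed.

Lemma sqnorm_ext f g : (forall x, I01 x -> f x = g x) -> sqnorm f = sqnorm g.
Proof. by move=> fg; apply: inner_ext. Qed.

Lemma sqnormZ c f : L2 f -> sqnorm (fun x => c * f x) = c ^+ 2 * sqnorm f.
Proof.
move=> Lf; rewrite /sqnorm innerZl ?innerZr// ?mulrA ?expr2//; exact: L2Z.
Qed.

Lemma sqnormD f g : L2 f -> L2 g ->
  sqnorm (fun x => f x + g x) = sqnorm f + 2 * inner f g + sqnorm g.
Proof.
move=> Lf Lg; have LD := L2D Lf Lg.
rewrite /sqnorm innerDl// !innerDr// (innerC g f); ring.
Qed.

Lemma sqnormB f g : L2 f -> L2 g ->
  sqnorm (fun x => f x - g x) = sqnorm f - 2 * inner f g + sqnorm g.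
Proof.
move=> Lf Lg; have LD := L2B Lf Lg.
rewrite /sqnorm innerBl// !innerBr// (innerC g f); ring.
Qed.

Lemma cauchy_schwarz f g : L2 f -> L2 g -> inner f g ^+ 2 <= sqnorm f * sqnorm g.
Proof.
move=> Lf Lg; apply: discriminant_le; first exact: sqnorm_ge0.
move=> t; rewrite -(sqnormZ t Lg) -innerZr// -sqnormB//; first exact: sqnorm_ge0.
exact: L2Z.
Qed.

Lemma sqnormD_le f g : L2 f -> L2 g ->
  sqnorm (fun x => f x + g x) <= 2 * sqnorm f + 2 * sqnorm g.
Proof.
move=> Lf Lg; have := sqnorm_ge0 (fun x => f x - g x).
by rewrite sqnormB// sqnormD//; lra.
Qed.

End L2Space.
#[global] Hint Extern 0 (measurable I01) => exact: measurable_I01 : core.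

(** * Weak derivatives on [0,1] *)

Section WeakDerivative.
Context {R : realType}.
Local Notation mu := (@lebesgue_measure R).
Implicit Types (f g h k : R -> R) (x : R).

(** Multiplication by an indicator makes an integral over a subinterval an inner product over [0,1],
    to which [cauchy_schwarz] applies; half-open intervals match differences of integrals from 0. *)
Definition cut (a b : R) g : R -> R := fun x => \1_(`]a, b]%classic) x * g x.

Lemma L2_cut a b g : L2 g -> L2 (cut a b g).
Proof.
apply: (@L2_boundedM _ _ _ 1).
  by apply: (@measurable_funTS _ _ _ _ _ (\1_(`]a, b]%classic) : R -> R)); exact: measurable_indic.
by move=> x _; rewrite indicE; case: (_ \in _) => /=; rewrite ?normr1 ?normr0.
Qed.

Lemma subitv_I01 (a b : R) : 0 <= a -> b <= 1 -> `]a, b] `<=` @I01 R.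
Proof.
move=> a0 b1 x /=; rewrite in_itv I01E /= => /andP[ax xb].
by rewrite (le_trans a0 (ltW ax)) (le_trans xb b1).
Qed.

Lemma prefix_I01 x : x <= 1 -> `[0, x] `<=` @I01 R.
Proof. by move=> x1 y /=; rewrite in_itv /= I01E => /andP[-> /le_trans ->]. Qed.

Lemma integrable_prefix g x : L2 g -> I01 x -> mu.-integrable `[0, x] (EFin \o g).
Proof.
move=> Lg; rewrite I01E => /andP[x0 x1].
apply: integrableS (L2_integrable Lg) => //.
exact: prefix_I01.
Qed.

Lemma integral_prefixB g a b : L2 g -> 0 <= a -> a <= b -> b <= 1 ->
  \int[mu]_(y in `[0, b]) g y - \int[mu]_(y in `[0, a]) g y
  = inner (fun=> 1) (cut a b g).
Proof.
move=> Lg a0 ab b1.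
rewrite Rintegral_itvB ?bnd_simp//; last first.
  by apply: integrable_prefix => //; rewrite I01E (le_trans a0 ab).
rewrite /inner -{1}(setIidr (subitv_I01 a0 b1)) Rintegral_mkcondr.
apply: eq_Rintegral => x _; rewrite patchE mul1r /cut indicE.
by case: (_ \in _); rewrite ?mul1r ?mul0r.
Qed.

Lemma inner_cut a b f g : inner (cut a b f) (cut a b g) = inner f (cut a b g).
Proof.
apply: eq_Rintegral => x _; rewrite /cut indicE.
by case: (_ \in _); rewrite /= ?mul1r ?mul0r ?mulr0.
Qed.

Lemma L2_sqr_integrable g : L2 g -> mu.-integrable I01 (EFin \o (fun x => g x * g x)).
Proof. by move=> Lg; exact: inner_integrable. Qed.

(* [energy g x] is the additive set function of the partition argument in
   [is_wderivM]. *)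
Definition energy g x : R := \int[mu]_(y in `[0, x]) (g y * g y).

Lemma energyB g a b : L2 g -> 0 <= a -> a <= b -> b <= 1 ->
  energy g b - energy g a = sqnorm (cut a b g).
Proof.
move=> Lg a0 ab b1; rewrite /energy Rintegral_itvB ?bnd_simp//; last first.
  apply: integrableS (L2_sqr_integrable Lg) => //.
  exact: prefix_I01.
rewrite /sqnorm /inner -{1}(setIidr (subitv_I01 a0 b1)) Rintegral_mkcondr.
apply: eq_Rintegral => x _; rewrite patchE /cut indicE.
by case: (_ \in _); rewrite ?mul1r ?mul0r.
Qed.

Lemma sqnorm_cut1 (a b : R) : 0 <= a -> a <= b -> b <= 1 ->
  sqnorm (cut a b (fun=> 1)) = b - a.
Proof.
move=> a0 ab b1; have e x : 0 <= x -> energy (fun=> 1) x = x.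
  move=> x0; rewrite /energy mulr1 Rintegral_cst// mul1r.
  rewrite -[X in fine X]/(mu (`[0, x]%classic)) lebesgue_measure_itv /= lte_fin.
  by case: ltP => [_|x0'] /=; [rewrite subr0|apply/eqP; rewrite eq_le x0 x0'].
by rewrite -energyB ?e//; [exact: le_trans ab|exact: L2_cst].
Qed.

Lemma sqnorm_cut_le a b g : L2 g -> sqnorm (cut a b g) <= sqnorm g.
Proof.
move=> Lg; rewrite /sqnorm /inner; apply: le_Rintegral => //.
- by apply: (inner_integrable (f := cut a b g)); exact: L2_cut.
- exact: (inner_integrable (f := g)).
- move=> x _; rewrite /cut indicE; case: (_ \in _); rewrite ?mul1r ?mul0r//.
  by rewrite -expr2 sqr_ge0.
Qed.

Lemma wderivB f g a b : is_wderiv f g -> 0 <= a -> a <= b -> b <= 1 ->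
  f b - f a = inner (fun=> 1) (cut a b g).
Proof.
move=> [Lg fE] a0 ab b1; rewrite -integral_prefixB// fE; last first.
  by rewrite I01E (le_trans a0 ab).
by rewrite [f a]fE ?I01E ?a0 ?(le_trans ab b1)//; lra.
Qed.

(** Cauchy-Schwarz against the indicator of ]a, b], whose squared norm is b - a. *)
Lemma wderiv_sqr_le f g a b : is_wderiv f g -> 0 <= a -> a <= b -> b <= 1 ->
  (f b - f a) ^+ 2 <= (b - a) * sqnorm (cut a b g).
Proof.
move=> fg a0 ab b1; rewrite (wderivB fg)// -inner_cut -[b - a]sqnorm_cut1//.
by apply: cauchy_schwarz; apply: L2_cut; [exact: L2_cst|case: fg].
Qed.

Lemma wderiv_continuous f g : is_wderiv f g -> {within I01, continuous f}.
Proof.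
move=> [Lg fE].
have c := parameterized_integral_continuous (@ler01 R) (L2_integrable Lg).
have : {within I01, continuous (fun x => f 0 + \int[mu]_(y in `[0, x]) g y)}.
  by move=> x; apply: cvgD; [exact: cvg_cst|exact: c].
by apply: subspace_eq_continuous => x /set_mem Ix; rewrite [RHS]fE.
Qed.

Lemma wderiv_L2 f g : is_wderiv f g -> L2 f.
Proof. by move=> /wderiv_continuous; exact: within_I01_L2. Qed.

Lemma is_wderivD f g h k : is_wderiv f g -> is_wderiv h k ->
  is_wderiv (fun x => f x + h x) (fun x => g x + k x).
Proof.
move=> [Lg fE] [Lk hE]; split=> [|x Ix]; first exact: L2D.
rewrite RintegralD//; [|exact: integrable_prefix..].
by rewrite fE// hE//; ring.
Qed.

Lemma is_wderivZ c f g : is_wderiv f g -> is_wderiv (fun x => c * f x) (fun x => c * g x).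
Proof.
move=> [Lg fE]; split=> [|x Ix]; first exact: L2Z.
by rewrite RintegralZl//; [rewrite fE//; ring|exact: integrable_prefix].
Qed.

Lemma is_wderiv_ext f1 f2 g1 g2 : (forall x, I01 x -> f1 x = f2 x) ->
  (forall x, I01 x -> g1 x = g2 x) -> is_wderiv f1 g1 -> is_wderiv f2 g2.
Proof.
move=> f12 g12 [Lg fE]; split=> [|x Ix]; first exact: L2_ext Lg.
rewrite -!f12 ?I01E ?lexx ?ler01// fE//; congr (_ + _).
apply: eq_Rintegral => y /set_mem /=; rewrite in_itv /= => /andP[y0 yx].
by apply: g12; move: Ix; rewrite !I01E => /andP[_] /(le_trans yx) ->; rewrite y0.
Qed.

(** Over a partition of [0, x] into n + 1 equal pieces the increments of [G] telescope, so |H(x) -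
    H(0)| is at most x / (n + 1) times G(x) - G(0), for every n. *)
Lemma constant_of_quadratic_variation (H G : R -> R) :
  (forall a b : R, 0 <= a -> a <= b -> b <= 1 -> `|H b - H a| <= (b - a) * (G b - G a)) ->
  forall x, I01 x -> H x = H 0.
Proof.
move=> HG x; rewrite I01E => /andP[x0 x1].
have step (n i : nat) : (i <= n.+1)%N ->
    `|H (x * (i%:R / n.+1%:R)) - H 0|
    <= (x / n.+1%:R) * (G (x * (i%:R / n.+1%:R)) - G 0).
  elim: i => [_|i IH Si]; first by rewrite mul0r mulr0 !subrr normr0 mulr0.
  have n0 : 0 < n.+1%:R :> R by rewrite ltr0n.
  have e : x * (i.+1%:R / n.+1%:R) - x * (i%:R / n.+1%:R) = x / n.+1%:R.
    by rewrite -natr1; field; rewrite gt_eqF.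
  have le1 : x * (i.+1%:R / n.+1%:R) <= 1.
    by rewrite mulr_ile1// ?divr_ge0// ler_pdivrMr// mul1r ler_nat.
  have := HG (x * (i%:R / n.+1%:R)) (x * (i.+1%:R / n.+1%:R)).
  rewrite e => /(_ (mulr_ge0 x0 (divr_ge0 (ler0n _ _) (ler0n _ _)))).
  have le2 : x * (i%:R / n.+1%:R) <= x * (i.+1%:R / n.+1%:R).
    by rewrite -subr_ge0 e divr_ge0.
  move=> /(_ le2 le1) h1.
  have h2 := IH (ltnW Si).
  rewrite -(subrKA (H (x * (i%:R / n.+1%:R))) (H _)).
  by rewrite (le_trans (ler_normD _ _))// (le_trans (lerD h1 h2))// -mulrDr subrKA.
apply/eqP; rewrite -subr_eq0 -normr_le0; apply/ler_addgt0Pr => e e0; rewrite add0r.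
(* If [G x <= G 0], a single piece already gives a nonpositive bound; otherwise the number of pieces
   is taken from the Archimedean property. *)
have [G0|G0] := leP (G x - G 0) 0.
  have := step 0 1 isT; rewrite divr1 mulr1 => /le_trans; apply.
  by rewrite (le_trans _ (ltW e0))// mulr_ge0_le0// divr_ge0.
pose n := Num.Def.archi_bound (x * (G x - G 0) / e).
have := step n n.+1 (leqnn _); rewrite divff ?pnatr_eq0// mulr1 => /le_trans; apply.
have : x * (G x - G 0) / e < n%:R.
  by apply: archi_boundP; rewrite divr_ge0// ?mulr_ge0// ltW.
rewrite ltr_pdivrMr// => le_n.
rewrite mulrAC ler_pdivrMr// (le_trans (ltW le_n))// mulrC ler_wpM2l ?(ltW e0)//.
by rewrite ler_nat.
Qed.

(* Integrating by parts over [a, b], the defect is the integral over ]a, b] of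
   [g (h b - h) + k (f a - f)], of order [(b - a)] times the energies of [g]
   and [k] on ]a, b]. *)
Lemma is_wderivM f g h k : is_wderiv f g -> is_wderiv h k ->
  is_wderiv (fun x => f x * h x) (fun x => h x * g x + f x * k x).
Proof.
move=> fg hk; have [[Lg fE] [Lk hE]] := (fg, hk).
have Lf := wderiv_L2 fg; have Lh := wderiv_L2 hk.
have Lhg : L2 (fun x => h x * g x) by apply: L2_continuousM Lg; exact: wderiv_continuous hk.
have Lfk : L2 (fun x => f x * k x) by apply: L2_continuousM Lk; exact: wderiv_continuous fg.
have LD := L2D Lhg Lfk.
split=> //.
pose H x := f x * h x - \int[mu]_(y in `[0, x]) (h y * g y + f y * k y).
suff HE x : I01 x -> H x = H 0.
  move=> x Ix; have := HE x Ix; rewrite /H set_itv1 Rintegral_set1; lra.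
move: x; apply: (@constant_of_quadratic_variation _ (fun x => energy g x + energy k x)).
move=> a b a0 ab b1.
have a1 := le_trans ab b1.
(* By [wderiv_sqr_le], [M] bounds |u(c) - u(x)|^2 for all x in ]a, b]; integrating this constant
   over a length b - a produces the second factor. *)
have bound u v c : is_wderiv u v -> (c = a \/ c = b) ->
    sqnorm (cut a b (fun x => u c - u x)) <= (b - a) * ((b - a) * sqnorm (cut a b v)).
  move=> uv cab; have Luv : L2 (fun x => u c - u x).
    by apply: L2B; [exact: L2_cst|exact: wderiv_L2 uv].
  set M := (b - a) * sqnorm _.
  have M0 : 0 <= M by rewrite mulr_ge0 ?subr_ge0// sqnorm_ge0.
  have -> : (b - a) * M = sqnorm (cut a b (fun=> Num.sqrt M)).
    rewrite (_ : cut _ _ _ = fun x => Num.sqrt M * cut a b (fun=> 1) x).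
      rewrite sqnormZ; last by apply: L2_cut; exact: L2_cst.
      by rewrite sqr_sqrtr// sqnorm_cut1// mulrC.
    by apply/funext => x; rewrite /cut mulr1 mulrC.
  rewrite /sqnorm /inner; apply: le_Rintegral => //.
  - by apply: (inner_integrable (f := cut a b _)); exact: L2_cut.
  - by apply: (inner_integrable (f := cut a b _)); apply: L2_cut; exact: L2_cst.
  move=> x _; rewrite /cut indicE; have [/set_mem|] := boolP (x \in `]a, b]%classic); last by rewrite !mul0r.
  rewrite /= !mul1r in_itv /= => /andP[ax xb].
  rewrite -!expr2 sqr_sqrtr//.
  have uvx s t : a <= s -> s <= t -> t <= b -> (u t - u s) ^+ 2 <= M.
    move=> as_ st tb; rewrite (le_trans (wderiv_sqr_le uv _ st _))//.
    - exact: le_trans as_.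
    - exact: le_trans b1.
    have c0 : 0 <= t - s by lra.
    rewrite (@le_trans _ _ ((t - s) * sqnorm (cut a b v)))//.
      apply: ler_wpM2l => //.
      rewrite -!energyB//; try lra; try by case: uv.
      have e1 : 0 <= energy v s - energy v a.
        by rewrite energyB ?sqnorm_ge0//; [case: uv|lra].
      have e2 : 0 <= energy v b - energy v t.
        by rewrite energyB ?sqnorm_ge0//; [case: uv|lra].
      by lra.
    by rewrite ler_wpM2r ?sqnorm_ge0//; lra.
  case: cab => ->; last by apply: uvx => //; exact: ltW.
  by rewrite -opprB sqrrN; apply: uvx => //; exact: ltW.
have HBA : H b - H a = inner (cut a b g) (cut a b (fun x => h b - h x))
    + inner (cut a b k) (cut a b (fun x => f a - f x)).
  have -> : H b - H a = f b * h b - f a * h a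
      - (\int[mu]_(y in `[0, b]) (h y * g y + f y * k y)
         - \int[mu]_(y in `[0, a]) (h y * g y + f y * k y)) by rewrite /H; ring.
  rewrite (integral_prefixB LD)//.
  rewrite (_ : f b * h b - f a * h a = h b * (f b - f a) + f a * (h b - h a)); last by ring.
  rewrite (wderivB fg)// (wderivB hk)//.
  have L1 := @L2_cst R 1.
  have Lc u : L2 u -> L2 (cut a b u) by exact: L2_cut.
  have cutB u v (c : R) : L2 u -> L2 (fun x => v x * u x) ->
      inner (cut a b u) (cut a b (fun x => c - v x))
      = c * inner (fun=> 1) (cut a b u) - inner (fun=> 1) (cut a b (fun x => v x * u x)).
    move=> Lu Lvu; rewrite -(innerZr c (Lc _ Lu) L1).
    rewrite -(innerBr (L2Z c (Lc _ Lu)) (Lc _ Lvu) L1).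
    apply: eq_Rintegral => x _; rewrite /cut indicE; case: (_ \in _) => /=; ring.
  rewrite !cutB// (_ : inner _ (cut a b (fun x => h x * g x + f x * k x)) =
    inner (fun=> 1) (cut a b (fun x => h x * g x)) + inner (fun=> 1) (cut a b (fun x => f x * k x))).
    by ring.
  rewrite -(innerDr (Lc _ Lhg) (Lc _ Lfk) L1); apply: inner_ext => // x _.
  by rewrite /cut mulrDr.
have cs u v c w : is_wderiv u v -> (c = a \/ c = b) -> L2 w ->
    `|inner (cut a b w) (cut a b (fun x => u c - u x))|
    <= (b - a) * ((sqnorm (cut a b w) + sqnorm (cut a b v)) / 2).
  move=> uv cab Lw; have Luv : L2 (fun x => u c - u x).
    by apply: L2B; [exact: L2_cst|exact: wderiv_L2 uv].
  have := cauchy_schwarz (L2_cut a b Lw) (L2_cut a b Luv).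
  have := bound u v c uv cab.
  have := sqnorm_ge0 (cut a b w); have := sqnorm_ge0 (cut a b v).
  have ba0 : 0 <= b - a by rewrite subr_ge0.
  move: (sqnorm (cut a b w)) (sqnorm (cut a b v)) (sqnorm (cut a b (fun x => u c - u x))) (inner _ _) (b - a) ba0.
  move=> W V S X l l0 V0 W0 Sle XWS.
  have y0 : 0 <= l * ((W + V) / 2) by rewrite mulr_ge0// divr_ge0// addr_ge0.
  apply: ler_norm_sqr => //.
  rewrite (le_trans XWS)// (le_trans (ler_wpM2l W0 Sle))// -subr_ge0.
  (* The geometric mean of [W] and [V] is replaced by their arithmetic mean, which is additive over
     subintervals as the telescoping requires. *)
  rewrite (_ : _ - _ = l ^+ 2 * ((W - V) / 2) ^+ 2); last by field.
  exact: mulr_ge0 (sqr_ge0 _) (sqr_ge0 _).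
rewrite HBA (le_trans (ler_normD _ _))//.
have b1' := cs h k b g hk (or_intror erefl) Lg.
have b2' := cs f g a k fg (or_introl erefl) Lk.
rewrite (le_trans (lerD b1' b2'))// -mulrDr -!energyB//.
by apply: ler_wpM2l; [rewrite subr_ge0|lra].
Qed.

Lemma int_by_parts f g h k : is_wderiv f g -> is_wderiv h k ->
  inner g h = f 1 * h 1 - f 0 * h 0 - inner f k.
Proof.
move=> fg hk; have [_ /(_ 1)] := is_wderivM fg hk.
rewrite I01E ler01 lexx => /(_ isT) ->.
rewrite RintegralD//; first by rewrite -/(inner h g) -/(inner f k) (innerC h g); ring.
- by apply: inner_integrable; [exact: wderiv_L2 hk|case: fg].
- by apply: inner_integrable; [exact: wderiv_L2 fg|case: hk].
Qed.

(** The constant function f(x) is split as f(y) + (f(x) - f(y)); on an interval of length 1 the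
    second part is bounded by the norm of [g]. *)
Lemma wderiv_sup f g x : is_wderiv f g -> I01 x -> f x ^+ 2 <= 2 * sqnorm f + 2 * sqnorm g.
Proof.
move=> fg Ix; have Lf := wderiv_L2 fg; have Lg : L2 g by case: fg.
have [x0 x1] : 0 <= x /\ x <= 1 by move: Ix; rewrite I01E => /andP[].
have dle y : I01 y -> (f x - f y) ^+ 2 <= sqnorm g.
  rewrite I01E => /andP[y0 y1].
  wlog xy : x y {Ix} x0 x1 y0 y1 / x <= y.
    move=> wl; have [/wl|/ltW /wl] := leP x y; first exact.
    by rewrite -sqrrN opprB; exact.
  rewrite -sqrrN opprB (le_trans (wderiv_sqr_le fg _ xy _))//.
  rewrite (le_trans _ (sqnorm_cut_le x y Lg))// ler_piMl ?sqnorm_ge0//; lra.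
have -> : f x ^+ 2 = inner (fun=> f x) (fun=> f x).
  by rewrite inner_cst expr2.
have Lx := L2_cst (f x).
have LD : L2 (fun y => f x - f y) by exact: L2B.
have sD : sqnorm (fun y => f x - f y) <= sqnorm g.
  have -> : sqnorm g = inner (fun=> Num.sqrt (sqnorm g)) (fun=> Num.sqrt (sqnorm g)).
    by rewrite inner_cst -expr2 sqr_sqrtr// sqnorm_ge0.
  apply: le_Rintegral => //.
  - exact: (inner_integrable (f := fun y => f x - f y)).
  - by apply: (inner_integrable (f := fun=> _)); exact: L2_cst.
  - by move=> y Iy; rewrite -!expr2 sqr_sqrtr ?sqnorm_ge0//; exact: dle.
have -> : inner (fun=> f x) (fun=> f x) = sqnorm (fun y => f y + (f x - f y)).
  by apply: inner_ext => y _; rewrite addrC subrK.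
by rewrite (le_trans (sqnormD_le Lf LD))// lerD2l ler_wpM2l.
Qed.

(** The difference, extended by 0, has a vanishing indefinite integral, and by Lebesgue
    differentiation it is almost everywhere the derivative of that integral. *)
Lemma wderiv_unique f g1 g2 : is_wderiv f g1 -> is_wderiv f g2 ->
  {ae mu, forall x, I01 x -> g1 x = g2 x}.
Proof.
move=> [Lg1 f1] [Lg2 f2].
pose h := (fun x => g1 x - g2 x) \_ (@I01 R) : R -> R.
have Lg := L2B Lg1 Lg2.
have ig := L2_integrable Lg.
have ih : mu.-integrable setT (EFin \o h).
  move/integrable_mkcond: (ig) => /(_ measurable_I01).
  by apply: eq_integrable => // x _ /=; rewrite /h !patchE; case: ifP.
have F0 y : \int[mu]_(t in `]-oo, y]) h t = 0.
  rewrite -Rintegral_mkcondr.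
  have -> : `]-oo, y] `&` @I01 R = `[0, Num.min y 1]%classic.
    apply/seteqP; split=> t /=; rewrite !in_itv /= le_min I01E.
      by move=> [-> /andP[-> ->]].
    by move=> /and3P[-> -> ->].
  have [y0|y0] := ltP y 0.
    rewrite set_itv_ge ?Rintegral_set0// bnd_simp -ltNge.
    by rewrite gt_min y0.
  have Im : I01 (Num.min y 1) by rewrite I01E le_min y0 ler01 ge_min lexx orbT.
  rewrite RintegralB//; [|exact: integrable_prefix..].
  by have := f1 _ Im; rewrite {1}f2//; lra.
have loc := @integrable_locally R (fun x => g1 x - g2 x) _ measurable_I01 ig.
have ihy y : mu.-integrable `]-oo, y] (EFin \o h).
  by apply: integrableS ih => //; exact: measurableT.
have := FTC1Ny ihy loc.
apply: filterS; first exact: (ae_filter_ringOfSetsType mu).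
move=> x /= [_].
rewrite (_ : (fun _ => _) = cst 0); last by apply/funext => y; exact: F0.
rewrite derive1_cst /h patchE => + Ix; rewrite mem_set//.
by move=> /esym /eqP; rewrite subr_eq0 => /eqP.
Qed.

Definition quot01 f x l := (f y - f x) / (y - x) @[y --> within I01 x^'] --> (l : R).

Lemma near_I01 x (P : set R) :
  (\forall y \near within I01 x^', P y) <->
  (\forall y \near x, y != x -> I01 y -> P y).
Proof.
by rewrite near_withinE near_withinE.
Qed.

(** This gives uniqueness of the limit in [D01], endpoints included: nearby points of [0,1] lie to
    the right of [x] if [x <= 1 / 2], and to the left otherwise. *)
Lemma within_I01_proper x : I01 x -> ProperFilter (within I01 x^').
Proof.
rewrite I01E => /andP[x0 x1]; apply: Build_ProperFilter_ex => P.
move=> /near_I01 /nbhs_ballP[e /= e0 eP].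
pose d := Num.min e (1 / 2) / 2.
have d0 : 0 < d by rewrite divr_gt0// lt_min e0 divr_gt0.
have de : d < e.
  have : Num.min e (1 / 2) <= e by rewrite ge_min lexx.
  by rewrite /d; move: (Num.min _ _) => m; lra.
have d2 : d <= 1 / 2.
  have : Num.min e (1 / 2) <= 1 / 2 by rewrite ge_min lexx orbT.
  by rewrite /d; move: (Num.min _ _) => m; lra.
have [x2|x2] := leP x (1 / 2).
  exists (x + d); apply: eP.
  - by rewrite /ball /= opprD addrA subrr sub0r normrN gtr0_norm.
  - by rewrite gt_eqF// ltrDl.
  - by rewrite I01E; lra.
exists (x - d); apply: eP.
- by rewrite /ball /= opprB addrC subrK gtr0_norm.
- by rewrite lt_eqF// gtrBl.
- by rewrite I01E; lra.
Qed.

Lemma quot01_D01 f x l : I01 x -> quot01 f x l -> derivable01 f x /\ D01 f x = l.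
Proof.
move=> Ix fl; have pf := within_I01_proper Ix; split; first by apply/cvg_ex; exists l.
exact: cvg_lim fl.
Qed.

Lemma derivable01_quot f x : derivable01 f x -> quot01 f x (D01 f x).
Proof. by []. Qed.

Lemma quot01D f g x (m l : R) : quot01 f x m -> quot01 g x l ->
  quot01 (fun y => f y + g y) x (m + l).
Proof.
rewrite /quot01 => fm gl; apply: cvg_trans (cvgD fm gl); apply: near_eq_cvg.
by near=> y; rewrite -mulrDl opprD addrACA.
Unshelve. all: by end_near. Qed.

Lemma quot01Z f x (c m : R) : quot01 f x m -> quot01 (fun y => c * f y) x (c * m).
Proof.
rewrite /quot01 => fm; apply: cvg_trans (cvgMl_tmp (a := c) fm); apply: near_eq_cvg.
by near=> y; rewrite -mulrBr mulrA.
Unshelve. all: by end_near. Qed.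

Lemma quot01_near f x l (e : R) : quot01 f x l -> 0 < e ->
  \forall y \near x, y != x -> I01 y -> `|l - (f y - f x) / (y - x)| < e.
Proof. by move=> /cvgrPdist_lt /(_ e) /[apply] /near_I01. Qed.

Lemma quot01_is_derive f x l : 0 < x < 1 -> quot01 f x l -> is_derive x (1 : R) f l.
Proof.
move=> /andP[x0 x1] fl.
have : h^-1 *: (f (h *: (1 : R) + x) - f x) @[h --> (0:R)^'] --> l.
  apply/cvgrPdist_lt => e e0.
  have := quot01_near fl e0; rewrite (near_shift 0) subr0 => near_e.
  have I1 : \forall h \near (0 : R), 0 < h + x < 1.
    have : \forall y \near x, 0 < y < 1 by apply: near_in_itvoo; rewrite in_itv /= x0.
    by rewrite (near_shift 0) subr0.
  rewrite near_withinE; near=> h => h0.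
  have : 0 < h + x < 1 by near: h.
  have : h + x != x -> I01 (h + x) -> `|l - (f (h + x) - f x) / (h + x - x)| < e by near: h.
  rewrite addrK I01E => + /andP[a b]; rewrite (ltW a) (ltW b) => /(_ _ isT).
  rewrite -subr_eq0 addrK => /(_ h0).
  by rewrite /GRing.scale /= mulr1 [h^-1 * _]mulrC.
move=> cl; apply: DeriveDef; first by apply/cvg_ex; exists l.
exact: cvg_lim cl.
Unshelve. all: by end_near. Qed.

Lemma derivable01_continuous f : (forall x, I01 x -> derivable01 f x) ->
  {within I01, continuous f}.
Proof.
move=> df; apply/subspace_continuousP => x Ix.
apply/cvgrPdist_lt => e e0; rewrite near_withinE.
have := quot01_near (derivable01_quot (df x Ix)) ltr01.
set l := D01 f x => near1.
have l0 : 0 < `|l| + 1 by rewrite ltr_wpDl.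
have near2 : \forall y \near x, `|y - x| < e / (`|l| + 1).
  apply/nbhs_ballP; exists (e / (`|l| + 1)); first exact: divr_gt0.
  by move=> y; rewrite /ball /= distrC.
near=> y => Iy.
have [->|yx] := eqVneq y x; first by rewrite subrr normr0.
have : y != x -> I01 y -> `|l - (f y - f x) / (y - x)| < 1 by near: y.
move=> /(_ yx Iy) h1.
have h2 : `|y - x| < e / (`|l| + 1) by near: y.
have h3 : `|(f y - f x) / (y - x)| < `|l| + 1.
  have := ler_normB l (l - (f y - f x) / (y - x)).
  by rewrite subKr; lra.
have d0 : 0 < `|y - x| by rewrite normr_gt0 subr_eq0.
move: h3; rewrite normrM normfV ltr_pdivrMr// distrC => /lt_trans; apply.
by move: h2; rewrite ltr_pdivlMr// mulrC.
Unshelve. all: by end_near. Qed.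

Lemma C1_wderiv f : (forall x, I01 x -> derivable01 f x) ->
  {within I01, continuous (D01 f)} -> is_wderiv f (D01 f).
Proof.
move=> df cD; split=> [|x Ix]; first exact: within_I01_L2.
have [x0 x1] : 0 <= x /\ x <= 1 by move: Ix; rewrite I01E => /andP[].
have [->|nx] := eqVneq x 0; first by rewrite set_itv1 Rintegral_set1 addr0.
have {}x0 : 0 < x by rewrite lt_neqAle eq_sym nx.
have sub : `[0, x] `<=` @I01 R by exact: prefix_I01.
have cf := continuous_subspaceW sub (derivable01_continuous df).
have der y : y \in `]0, x[ -> is_derive y (1 : R) f (D01 f y).
  rewrite in_itv /= => /andP[y0 yx]; apply: quot01_is_derive.
    by rewrite y0 (lt_le_trans yx).
  by apply/derivable01_quot/df; rewrite I01E !ltW// (lt_le_trans yx).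
have := @continuous_FTC2 R (D01 f) f 0 x x0 (continuous_subspaceW sub cD).
rewrite /Rintegral => ->.
- by rewrite -EFinB /= addrC subrK.
- have [_ cl cr] := (continuous_within_itvP f x0).1 cf.
  by split=> // y /der H; exact: ex_derive.
- by move=> y /der H; rewrite derive1E; exact: derive_val.
Qed.

End WeakDerivative.

(** * The Sturm-Liouville operator and its form *)

Section SobolevFunctions.
Context {R : realType}.
Local Notation mu := (@lebesgue_measure R).
Implicit Types (f g h k : R -> R) (x : R).

Lemma I010 : @I01 R 0. Proof. by rewrite I01E lexx ler01. Qed.
Lemma I011 : @I01 R 1. Proof. by rewrite I01E lexx ler01. Qed.

Lemma inner_ae f g1 g2 : L2 f -> L2 g1 -> L2 g2 ->
  {ae mu, forall x, I01 x -> g1 x = g2 x} -> inner f g1 = inner f g2.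
Proof.
move=> Lf L1 L2' g12; congr fine; apply: ae_eq_integral => //.
- exact: measurable_int (inner_integrable Lf L1).
- exact: measurable_int (inner_integrable Lf L2').
- move: g12; apply: filterS; first exact: (ae_filter_ringOfSetsType mu).
  by move=> x h Ix; rewrite h.
Qed.

Lemma wD_wderiv f : H1 f -> is_wderiv f (wD f).
Proof. by move=> [g fg]; exact: (xgetPex (fun=> 0) (ex_intro _ g fg)). Qed.

(** [wD] is an arbitrary choice; uniqueness up to null sets lets any weak derivative at hand replace
    it. *)
Lemma H1sqnorm_wderiv f g : is_wderiv f g -> H1sqnorm f = sqnorm f + sqnorm g.
Proof.
move=> fg; congr (_ + _); have fD := wD_wderiv (ex_intro _ g fg).
have [Lg _] := fg; have [LD _] := fD; have e := wderiv_unique fD fg.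
by rewrite /sqnorm (inner_ae LD LD Lg e) innerC (inner_ae Lg LD Lg e).
Qed.

Lemma H2_wderiv f : H2 f -> is_wderiv f (D01 f).
Proof. by move=> [df [g fg]]; apply: C1_wderiv => //; exact: wderiv_continuous fg. Qed.

Lemma H2D f g : H2 f -> H2 g -> H2 (fun x => f x + g x) /\
  forall x, I01 x -> D01 (fun x => f x + g x) x = D01 f x + D01 g x.
Proof.
move=> [df [f' ff']] [dg [g' gg']].
have q x : I01 x -> derivable01 (fun x => f x + g x) x /\
    D01 (fun x => f x + g x) x = D01 f x + D01 g x.
  by move=> Ix; apply: quot01_D01 => //; apply: quot01D; apply: derivable01_quot; auto.
split; last by move=> x /q[].
split; first by move=> x /q[].
exists (fun x => f' x + g' x); apply: is_wderiv_ext (is_wderivD ff' gg') => // x /q[_ ->//].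
Qed.

Lemma H2Z c f : H2 f -> H2 (fun x => c * f x) /\
  forall x, I01 x -> D01 (fun x => c * f x) x = c * D01 f x.
Proof.
move=> [df [f' ff']].
have q x : I01 x -> derivable01 (fun x => c * f x) x /\ D01 (fun x => c * f x) x = c * D01 f x.
  by move=> Ix; apply: quot01_D01 => //; apply: quot01Z; apply: derivable01_quot; auto.
split; last by move=> x /q[].
split; first by move=> x /q[].
exists (fun x => c * f' x); apply: is_wderiv_ext (is_wderivZ c ff') => // x /q[_ ->//].
Qed.

Lemma H20 : H2 (fun=> 0 : R) /\ forall x, I01 x -> D01 (fun=> 0 : R) x = 0.
Proof.
have q x : I01 x -> derivable01 (fun=> 0 : R) x /\ D01 (fun=> 0 : R) x = 0.
  move=> Ix; apply: quot01_D01 => //; rewrite /quot01.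
  by under eq_fun do rewrite subrr mul0r; exact: cvg_cst.
split; last by move=> x /q[].
split; first by move=> x /q[].
exists (fun=> 0); split; first exact: L20.
move=> x /q[_ ->]; have [_ ->] := q _ I010.
by rewrite Rintegral_cst// mul0r addr0.
Qed.

Lemma C2_wderiv (p : R -> R) : C2_01 p ->
  is_wderiv p (D01 p) /\ {within I01, continuous (D01 p)}.
Proof.
move=> [dp ddp _]; have c := derivable01_continuous ddp.
by split=> //; exact: C1_wderiv.
Qed.

Section Operator.
Variables (th1 th2 : R) (p q : R -> R).
Hypotheses (pC2 : C2_01 p) (qC : {within I01, continuous q}).

Lemma flux_H1 f : H2 f -> H1 (fun x => p x * D01 f x).
Proof.
move=> [_ [g fg]]; have [pp _] := C2_wderiv pC2.
eexists; exact: is_wderivM pp fg.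
Qed.

Lemma flux_wderiv f : H2 f ->
  is_wderiv (fun x => p x * D01 f x) (wD (fun x => p x * D01 f x)).
Proof. by move=> /flux_H1 /wD_wderiv. Qed.

Lemma opA_L2 f : H2 f -> L2 (opA p q f).
Proof.
move=> Hf; apply: L2D; first by apply: L2N; case: (flux_wderiv Hf).
by apply: L2_continuousM => //; exact: wderiv_L2 (H2_wderiv Hf).
Qed.

Lemma green f g g' : H2 f -> is_wderiv g g' ->
  inner (opA p q f) g = p 0 * D01 f 0 * g 0 - p 1 * D01 f 1 * g 1
    + inner (fun x => p x * D01 f x) g' + inner (fun x => q x * f x) g.
Proof.
move=> Hf gg; have ff := flux_wderiv Hf; have Lg := wderiv_L2 gg.
have Lq : L2 (fun x => q x * f x).
  by apply: L2_continuousM => //; exact: wderiv_L2 (H2_wderiv Hf).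
have Lw : L2 (wD (fun x => p x * D01 f x)) by case: ff.
rewrite /opA innerDl//; last exact: L2N.
by rewrite innerNl// (int_by_parts ff gg); ring.
Qed.

(** Robin coefficients: the boundary conditions become f'(0) = cot1 f(0) and, when sin th2 is
    nonzero, f'(1) = - cot2 f(1). Their signs make the boundary terms of the form nonnegative. *)
Definition cot1 : R := cos th1 / sin th1.
Definition cot2 : R := cos th2 / sin th2.

Hypothesis sin1 : sin th1 != 0.

Lemma bc0 f : cos th1 * f 0 - sin th1 * D01 f 0 = 0 -> D01 f 0 = cot1 * f 0.
Proof.
move=> h; apply: (mulfI sin1); rewrite /cot1 mulrA [sin th1 * (_ / _)]mulrC divfK//.
by apply/eqP; rewrite eq_sym -subr_eq0 h.
Qed.

Hypothesis cos2_sin2 : sin th2 = 0 -> cos th2 != 0.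

(* With x / 0 = 0, [cot2 = 0] for a Dirichlet condition at 1. *)
Lemma bc1 f g : domA th1 th2 f -> domA th1 th2 g ->
  D01 f 1 * g 1 = - cot2 * (f 1 * g 1).
Proof.
move=> [_ _ f1] [_ _ g1]; rewrite /cot2.
have [s0|s0] := eqVneq (sin th2) 0.
  move: g1; rewrite s0 mul0r addr0 invr0 mulr0 oppr0 mul0r => /eqP.
  by rewrite mulf_eq0 (negbTE (cos2_sin2 s0)) => /eqP ->; rewrite mulr0.
apply: (mulfI s0); move: f1 => /eqP; rewrite addrC addr_eq0 => /eqP f1.
by rewrite mulrA f1; field.
Qed.

(** The right-hand side is visibly symmetric; symmetry, coercivity and boundedness of the operator
    are all read off it. *)
Lemma form_domA f g : domA th1 th2 f -> domA th1 th2 g ->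
  inner (opA p q f) g = inner (fun x => p x * D01 f x) (D01 g) + inner (fun x => q x * f x) g
   + p 0 * cot1 * (f 0 * g 0) + p 1 * cot2 * (f 1 * g 1).
Proof.
move=> Df Dg; have [Hf f0 _] := Df; have [Hg _ _] := Dg.
rewrite (green Hf (H2_wderiv Hg)) (bc0 f0).
have -> : p 1 * D01 f 1 * g 1 = p 1 * (D01 f 1 * g 1) by ring.
by rewrite (bc1 Df Dg); ring.
Qed.

Lemma inner_swapM w f g : inner (fun x => w x * f x) g = inner (fun x => w x * g x) f.
Proof. by apply: eq_Rintegral => x _; ring. Qed.

Lemma opA_sym f g : domA th1 th2 f -> domA th1 th2 g ->
  inner (opA p q f) g = inner (opA p q g) f.
Proof.
move=> Df Dg; rewrite (form_domA Df Dg) (form_domA Dg Df).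
by rewrite (inner_swapM p) (inner_swapM q) [f 0 * _]mulrC [f 1 * _]mulrC.
Qed.

Lemma domAD f g : domA th1 th2 f -> domA th1 th2 g -> domA th1 th2 (fun x => f x + g x).
Proof.
move=> [Hf f0 f1] [Hg g0 g1]; have [H dE] := H2D Hf Hg.
split=> //; rewrite dE ?I01E ?lexx ?ler01//; first by lra.
by rewrite -[RHS](addr0 0) -{1}f1 -g1; ring.
Qed.

Lemma domAZ c f : domA th1 th2 f -> domA th1 th2 (fun x => c * f x).
Proof.
move=> [Hf f0 f1]; have [H dE] := H2Z c Hf.
split=> //; rewrite dE ?I01E ?lexx ?ler01//.
  by rewrite mulrCA [sin th1 * _]mulrCA -mulrBr f0 mulr0.
by rewrite mulrCA [sin th2 * _]mulrCA -mulrDr f1 mulr0.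
Qed.

Lemma domA0 : domA th1 th2 (fun=> 0).
Proof. have [H dE] := H20; split=> //; rewrite dE ?I01E ?lexx ?ler01//; ring. Qed.

Lemma domA_sum (I : Type) (r : seq I) (F : I -> R -> R) :
  (forall i, domA th1 th2 (F i)) -> domA th1 th2 (fun x => \sum_(i <- r) F i x).
Proof.
move=> DF; elim: r => [|i r IH].
  by rewrite (_ : (fun x => _) = fun=> 0)//; [exact: domA0|apply/funext => x; rewrite big_nil].
rewrite (_ : (fun x => _) = fun x => F i x + \sum_(i <- r) F i x); first exact: domAD.
by apply/funext => x; rewrite big_cons.
Qed.

Lemma domA_L2 f : domA th1 th2 f -> L2 f.
Proof. by move=> [/H2_wderiv /wderiv_L2]. Qed.

Lemma domAB f g : domA th1 th2 f -> domA th1 th2 g -> domA th1 th2 (fun x => f x - g x).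
Proof.
move=> Df /(domAZ (-1)) Dg; have := domAD Df Dg.
by congr domA; apply/funext => x; rewrite mulN1r.
Qed.

Hypotheses (p0 : forall x, I01 x -> 0 < p x) (q0 : forall x, I01 x -> 0 < q x).
Hypotheses (cot1_ge0 : 0 <= cot1) (cot2_ge0 : 0 <= cot2).

Lemma continuous_pos_lb f : {within I01, continuous f} -> (forall x, I01 x -> 0 < f x) ->
  exists2 c, 0 < c & forall x, I01 x -> c <= f x.
Proof.
move=> cf f0; have [c Ic cP] := EVT_min (@ler01 R) cf.
exists (f c); first exact: f0.
exact: cP.
Qed.

Lemma weighted_le w (c : R) f : {within I01, continuous w} -> L2 f -> (forall x, I01 x -> w x <= c) ->
  inner (fun x => w x * f x) f <= c * sqnorm f.
Proof.
move=> cw Lf wc; rewrite /sqnorm -(innerZl c Lf Lf).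
apply: le_Rintegral => //.
- by apply: (inner_integrable (f := fun x => w x * f x)) => //; exact: L2_continuousM.
- by apply: (inner_integrable (f := fun x => c * f x)) => //; exact: L2Z.
- by move=> x Ix; rewrite -!mulrA ler_wpM2r ?wc// -expr2 sqr_ge0.
Qed.

Lemma weighted_ge w (c : R) f : {within I01, continuous w} -> L2 f -> (forall x, I01 x -> c <= w x) ->
  c * sqnorm f <= inner (fun x => w x * f x) f.
Proof.
move=> cw Lf wc; rewrite /sqnorm -(innerZl c Lf Lf).
apply: le_Rintegral => //.
- by apply: (inner_integrable (f := fun x => c * f x)) => //; exact: L2Z.
- by apply: (inner_integrable (f := fun x => w x * f x)) => //; exact: L2_continuousM.
- by move=> x Ix; rewrite -!mulrA ler_wpM2r ?wc// -expr2 sqr_ge0.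
Qed.

Lemma H1sqnorm_domA f : domA th1 th2 f -> H1sqnorm f = sqnorm f + sqnorm (D01 f).
Proof. by move=> [/H2_wderiv /H1sqnorm_wderiv]. Qed.

(** The boundary terms are nonnegative and dropped; minima of p and q over [0,1] control the
    derivative and the function. *)
Lemma form_coercive : exists2 c, 0 < c &
  forall f, domA th1 th2 f -> c * H1sqnorm f <= inner (opA p q f) f.
Proof.
have [pp _] := C2_wderiv pC2; have cp := wderiv_continuous pp.
have [c1 c1_gt0 c1P] := continuous_pos_lb cp p0.
have [c2 c2_gt0 c2P] := continuous_pos_lb qC q0.
exists (Num.min c1 c2); first by rewrite lt_min c1_gt0.
move=> f Df; have [Hf _ _] := Df; rewrite (H1sqnorm_domA Df) (form_domA Df Df).
have ff := H2_wderiv Hf; have Lf := wderiv_L2 ff; have LD : L2 (D01 f) by case: ff.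
have h1 := weighted_ge cp LD c1P; have h2 := weighted_ge qC Lf c2P.
have m1 : Num.min c1 c2 * sqnorm (D01 f) <= c1 * sqnorm (D01 f).
  by rewrite ler_wpM2r ?sqnorm_ge0// ge_min lexx.
have m2 : Num.min c1 c2 * sqnorm f <= c2 * sqnorm f.
  by rewrite ler_wpM2r ?sqnorm_ge0// ge_min lexx orbT.
have b0 : 0 <= p 0 * cot1 * (f 0 * f 0).
  apply: mulr_ge0; last by rewrite -expr2 sqr_ge0.
  by apply: mulr_ge0 => //; exact/ltW/p0/I010.
have b1 : 0 <= p 1 * cot2 * (f 1 * f 1).
  apply: mulr_ge0; last by rewrite -expr2 sqr_ge0.
  by apply: mulr_ge0 => //; exact/ltW/p0/I011.
by rewrite mulrDr; lra.
Qed.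

Lemma form_bounded : exists2 C, 0 < C &
  forall f, domA th1 th2 f -> inner (opA p q f) f <= C * H1sqnorm f.
Proof.
have [pp _] := C2_wderiv pC2; have cp := wderiv_continuous pp.
have [c1 c1_gt0 c1P] := within_I01_bounded cp.
have [c2 c2_gt0 c2P] := within_I01_bounded qC.
pose B := p 0 * cot1 + p 1 * cot2.
have a0 : 0 <= p 0 * cot1 by rewrite mulr_ge0// ltW// p0//; exact: I010.
have a1 : 0 <= p 1 * cot2 by rewrite mulr_ge0// ltW// p0//; exact: I011.
exists (c1 + c2 + 2 * B); first by rewrite /B; lra.
move=> f Df; have [Hf _ _] := Df; rewrite (H1sqnorm_domA Df) (form_domA Df Df).
have ff := H2_wderiv Hf; have Lf := wderiv_L2 ff; have LD : L2 (D01 f) by case: ff.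
have h1 := weighted_le cp LD (fun x Ix => le_trans (ler_norm _) (c1P x Ix)).
have h2 := weighted_le qC Lf (fun x Ix => le_trans (ler_norm _) (c2P x Ix)).
have t0 := wderiv_sup ff I010; have t1 := wderiv_sup ff I011.
rewrite -!expr2.
have s0 := sqnorm_ge0 f; have s1 := sqnorm_ge0 (D01 f).
have e0 : p 0 * cot1 * f 0 ^+ 2 <= p 0 * cot1 * (2 * sqnorm f + 2 * sqnorm (D01 f)).
  exact: ler_wpM2l.
have e1 : p 1 * cot2 * f 1 ^+ 2 <= p 1 * cot2 * (2 * sqnorm f + 2 * sqnorm (D01 f)).
  exact: ler_wpM2l.
have k1 : 0 <= c1 * sqnorm f by rewrite mulr_ge0// ltW.
have k2 : 0 <= c2 * sqnorm (D01 f) by rewrite mulr_ge0// ltW.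
rewrite /B; nra.
Qed.

(** Point evaluation is bounded in the form norm. The pointwise convergence of expansions, the bound
    on the series [M_phi] and the convergence of the series of A^{1/2} f all rest on this. *)
Lemma form_trace : exists2 C, 0 < C &
  forall f x, domA th1 th2 f -> I01 x -> f x ^+ 2 <= C * inner (opA p q f) f.
Proof.
have [c c0 cP] := form_coercive; exists (2 / c); first by rewrite divr_gt0.
move=> f x Df Ix; have [Hf _ _] := Df.
have := wderiv_sup (H2_wderiv Hf) Ix; rewrite -mulrDr -(H1sqnorm_domA Df) => /le_trans; apply.
by rewrite -mulrA ler_wpM2l// ler_pdivlMl// cP.
Qed.

End Operator.
End SobolevFunctions.

(** * Eigenfunction expansions *)

Section L2Convergence.
Context {R : realType}.
Local Notation mu := (@lebesgue_measure R).
Implicit Types (f g h : R -> R).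

Lemma cvg0_sqr (U : Type) (F : set_system U) {FF : Filter F} (a s : U -> R) (c : R) :
  (\forall u \near F, a u ^+ 2 <= s u * c) -> s u @[u --> F] --> 0 -> a u @[u --> F] --> 0.
Proof.
move=> asc s0; apply/cvgr0Pnorm_lt => e e0.
have d0 : 0 < e ^+ 2 / (`|c| + 1) by rewrite divr_gt0 ?exprn_gt0// ltr_wpDl.
move/cvgr0Pnorm_lt : s0 => /(_ _ d0) near_s.
near=> u.
have h1 : a u ^+ 2 <= s u * c by near: u.
have h2 : `|s u| < e ^+ 2 / (`|c| + 1) by near: u.
have h3 : a u ^+ 2 < e ^+ 2.
  rewrite (le_lt_trans h1)// (le_lt_trans (ler_norm _))// normrM.
  rewrite (@le_lt_trans _ _ (`|s u| * (`|c| + 1)))//; first by rewrite ler_wpM2l// lerDl.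
  by rewrite -ltr_pdivlMr// ltr_wpDl.
rewrite ltNge; apply/negP => ea.
have : e ^+ 2 <= `|a u| ^+ 2 by rewrite ler_sqr ?nnegrE// ltW.
by rewrite real_normK ?num_real// leNgt h3.
Unshelve. all: by end_near. Qed.

Lemma L2_cvg_inner (U : Type) (F : set_system U) {FF : Filter F} (f : U -> R -> R) g h :
  L2_cvg F f g -> L2 h -> inner (f u) h @[u --> F] --> inner g h.
Proof.
move=> [Lf Lg fg] Lh.
suff : (inner (f u) h - inner g h) @[u --> F] --> (0 : R).
  by move=> H; apply/subr_cvg0.
apply: (cvg0_sqr (s := fun u => sqnorm (fun x => f u x - g x)) (c := sqnorm h)) => //.
near=> u; have Lu : L2 (f u) by near: u.
by rewrite -innerBl//; apply: cauchy_schwarz => //; exact: L2B.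
Unshelve. all: by end_near. Qed.

Lemma L2_cvg_sqnorm (U : Type) (F : set_system U) {FF : Filter F} (f : U -> R -> R) g :
  L2_cvg F f g -> sqnorm (f u) @[u --> F] --> sqnorm g.
Proof.
move=> fg; have [Lf Lg sfg] := fg.
have H : sqnorm (fun x => f u x - g x) + 2 * inner (f u) g - sqnorm g @[u --> F]
    --> 0 + 2 * inner g g - sqnorm g.
  apply: cvgB; last exact: cvg_cst.
  by apply: cvgD => //; apply: cvgMl_tmp; exact: L2_cvg_inner.
rewrite (_ : 0 + _ - _ = sqnorm g) in H; last by rewrite /sqnorm; ring.
apply: cvg_trans H; apply: near_eq_cvg.
near=> u; have Lu : L2 (f u) by near: u.
by rewrite sqnormB//; ring.
Unshelve. all: by end_near. Qed.

(** The product is expanded around the limits: the product of the two increments tends to 0 by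
    Cauchy-Schwarz, and the other terms keep one factor fixed. *)
Lemma L2_cvg_innerM (U : Type) (F : set_system U) {FF : Filter F} (f h : U -> R -> R) g k :
  L2_cvg F f g -> L2_cvg F h k -> inner (f u) (h u) @[u --> F] --> inner g k.
Proof.
move=> fg hk; have [Lf Lg sfg] := fg; have [Lh Lk shk] := hk.
have H1 := @L2_cvg_inner _ _ FF _ _ _ fg Lk; have H2 := @L2_cvg_inner _ _ FF _ _ _ hk Lg.
have H3 : inner (fun x => f u x - g x) (fun x => h u x - k x) @[u --> F] --> (0 : R).
  apply: (cvg0_sqr (s := fun u => sqnorm (fun x => f u x - g x) * sqnorm (fun x => h u x - k x)) (c := 1)).
    near=> u; have Lu : L2 (f u) by near: u. have Lv : L2 (h u) by near: u.
    by rewrite mulr1; apply: cauchy_schwarz => //; exact: L2B.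
  by rewrite -(mul0r (0 : R)); exact: cvgM.
have e : inner g k = 0 + inner g k + inner k g - inner g k.
  by rewrite add0r (innerC k) addrK.
rewrite e.
apply: cvg_trans (cvgB (cvgD (cvgD H3 H1) H2) (cvg_cst (inner g k))); apply: near_eq_cvg.
near=> u; have Lu : L2 (f u) by near: u. have Lv : L2 (h u) by near: u.
rewrite -[LHS]/(inner (fun x => f u x - g x) (fun x => h u x - k x)
  + inner (f u) k + inner (h u) g - inner g k).
rewrite innerBl ?innerBr//; last exact: L2B.
by rewrite ![inner (h u) _]innerC; ring.
Unshelve. all: by end_near. Qed.

Lemma L2_seriesP (phi : nat -> R -> R) N c g :
  L2_cvg \oo (fun m x => \sum_(N <= n < m) c n * phi n x) g ->
  L2_cvg \oo (fun m x => \sum_(N <= n < m) c n * phi n x) (L2_series phi N c).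
Proof. by move=> H; exact: (xgetPex (fun=> 0) (ex_intro _ g H)). Qed.

Lemma sqnorm_le_sup f (M : R) : L2 f -> (forall x, I01 x -> f x ^+ 2 <= M) -> sqnorm f <= M.
Proof.
move=> Lf fM; rewrite -[M]mulr1 -inner_cst; apply: le_Rintegral => //.
- exact: (inner_integrable (f := f)).
- by apply: (inner_integrable (f := fun=> M)); exact: L2_cst.
- by move=> x Ix; rewrite mulr1 -expr2 fM.
Qed.

Lemma ler_sum_prefix (u : nat -> R) N m k : (forall n, 0 <= u n) -> (m <= k)%N ->
  \sum_(N <= n < m) u n <= \sum_(N <= n < k) u n.
Proof.
move=> u0 mk; have [Nm|mN] := leqP N m.
  by rewrite (big_cat_nat (n := m) (p := k))//= lerDl sumr_ge0.
by rewrite big_geq ?(ltnW mN)// sumr_ge0.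
Qed.

Lemma limn_ge_bound (u : nat -> R) (l b : R) : u n @[n --> \oo] --> l ->
  (\forall n \near \oo, b <= u n) -> b <= l.
Proof. exact: cvgr_to_ge. Qed.

Lemma limn_le_bound (u : nat -> R) (l b : R) : u n @[n --> \oo] --> l ->
  (\forall n \near \oo, u n <= b) -> l <= b.
Proof. exact: cvgr_to_le. Qed.

Lemma limn_unique (u : nat -> R) (l1 l2 : R) :
  u n @[n --> \oo] --> l1 -> u n @[n --> \oo] --> l2 -> l1 = l2.
Proof. by move=> h1 h2; apply: cvg_unique h1 h2; exact: Rhausdorff. Qed.

Lemma sumB_prefix (u : nat -> R) N m : (N <= m)%N ->
  \sum_(0 <= n < m) u n - \sum_(0 <= n < N) u n = \sum_(N <= n < m) u n.
Proof. by move=> Nm; rewrite (big_cat_nat (n := N) (p := m))//= addrAC subrr add0r. Qed.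

Lemma eventually_nat_ge (P : nat -> Prop) N : (forall n, (N <= n)%N -> P n) ->
  \forall n \near \oo, P n.
Proof. by move=> NP; exists N. Qed.

End L2Convergence.

Section Spectral.
Context {R : realType}.
Local Notation mu := (@lebesgue_measure R).
Implicit Types (f g h : R -> R) (x : R).
Variables (th1 th2 : R) (p q : R -> R) (lam : nat -> R) (phi : nat -> R -> R).
Hypotheses (pC2 : C2_01 p) (qC : {within I01, continuous q}).
Hypotheses (sin1 : sin th1 != 0) (cos2_sin2 : sin th2 = 0 -> cos th2 != 0).
Hypotheses (p0 : forall x, I01 x -> 0 < p x) (q0 : forall x, I01 x -> 0 < q x).
Hypotheses (cot1_ge0 : 0 <= cot1 th1) (cot2_ge0 : 0 <= cot2 th2).
Hypothesis eb : eigenbasis th1 th2 p q lam phi.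
Local Notation domA := (domA th1 th2).
Local Notation opA := (opA p q).

Definition fc f n : R := inner f (phi n).
Definition form f : R := inner (opA f) f.

Let lam0 n : 0 < lam n := lam_gt0 eb n.
Let Dphi n : domA (phi n) := phi_domA eb n.
Let Lphi n : L2 (phi n) := domA_L2 (Dphi n).

Lemma domA_opA_L2 f : domA f -> L2 (opA f).
Proof. by move=> [Hf _ _]; exact: opA_L2. Qed.
Hint Resolve domA_opA_L2 : core.

(** Symmetry moves the operator onto the eigenfunction, whose equation holds only almost
    everywhere. *)
Lemma fc_opA f n : domA f -> fc (opA f) n = lam n * fc f n.
Proof.
move=> Df; have Lf := domA_L2 Df.
rewrite /fc (opA_sym pC2 qC sin1 cos2_sin2 Df (Dphi n)) innerC.
rewrite (inner_ae Lf _ (L2Z (lam n) (Lphi n)) (phi_eigen eb n)) ?innerZr//.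
exact: domA_opA_L2.
Qed.

Definition psum (c : nat -> R) (m k : nat) : R -> R :=
  fun x => \sum_(m <= n < k) c n * phi n x.

Lemma psum_domA c m k : domA (psum c m k).
Proof. by apply: domA_sum => n; exact: domAZ. Qed.

Lemma inner_psum c m k f : L2 f -> inner (psum c m k) f = \sum_(m <= n < k) c n * fc f n.
Proof.
move=> Lf; rewrite /psum inner_suml//; last by move=> n _; exact: L2Z.
by apply: eq_bigr => n _; rewrite innerZl// innerC.
Qed.

Lemma fc_phi n j : fc (phi j) n = (j == n)%:R.
Proof. exact: phi_orthonormal eb _ _. Qed.

Lemma fc_psum c m k n : fc (psum c m k) n = if (m <= n < k)%N then c n else 0.
Proof.
rewrite /fc inner_psum//.
under eq_bigr => j _ do rewrite fc_phi eq_sym.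
case: ifPn => [/andP[mn nk]|].
  rewrite (bigD1_seq n) /= ?iota_uniq ?mem_index_iota ?mn//.
  rewrite eqxx mulr1 big1 ?addr0// => j jn.
  by rewrite (negbTE jn) mulr0.
move=> nmk; rewrite big_nat big1// => j /andP[mj jk].
case: eqP => [e|_]; last by rewrite mulr0.
by move: nmk; rewrite -e mj jk.
Qed.

Lemma sqnorm_psum c m k : sqnorm (psum c m k) = \sum_(m <= n < k) c n ^+ 2.
Proof.
rewrite /sqnorm inner_psum; last exact: domA_L2 (psum_domA _ _ _).
by apply: eq_big_nat => n mnk; rewrite fc_psum mnk expr2.
Qed.

Lemma form_psum c m k : form (psum c m k) = \sum_(m <= n < k) lam n * c n ^+ 2.
Proof.
rewrite /form innerC inner_psum; last exact: domA_opA_L2 (psum_domA _ _ _).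
apply: eq_big_nat => n mnk; rewrite fc_opA; last exact: psum_domA.
by rewrite fc_psum mnk; ring.
Qed.

Lemma parseval f g : L2 f -> L2 g ->
  \sum_(0 <= n < m) fc f n * fc g n @[m --> \oo] --> inner f g.
Proof.
move=> Lf Lg; apply: cvg_trans (L2_cvg_inner (phi_complete eb Lf) Lg); apply: near_eq_cvg; near=> m.
exact: inner_psum.
Unshelve. all: by end_near. Qed.

Lemma parseval_form f : domA f ->
  \sum_(0 <= n < m) lam n * fc f n ^+ 2 @[m --> \oo] --> form f.
Proof.
move=> Df; apply: cvg_trans (parseval (domA_opA_L2 Df) (domA_L2 Df)).
apply: near_eq_cvg; near=> m.
by apply: eq_bigr => n _; rewrite fc_opA// expr2 mulrA.
Unshelve. all: by end_near. Qed.

Definition htail N f : R := form f - \sum_(0 <= n < N) lam n * fc f n ^+ 2.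

Lemma htail_cvg N f : domA f ->
  \sum_(N <= n < m) lam n * fc f n ^+ 2 @[m --> \oo] --> htail N f.
Proof.
move=> Df; 
apply: cvg_trans (cvgB (parseval_form Df) (cvg_cst (\sum_(0 <= n < N) lam n * fc f n ^+ 2))).
apply: near_eq_cvg; apply: (@eventually_nat_ge _ N) => m Nm.
exact: sumB_prefix.
Qed.

Lemma sum_le_htail N m f : domA f -> \sum_(N <= n < m) lam n * fc f n ^+ 2 <= htail N f.
Proof.
move=> Df; have h := @htail_cvg N _ Df; apply: (limn_ge_bound h).
apply: (@eventually_nat_ge _ m) => k mk; apply: ler_sum_prefix => // n.
by rewrite mulr_ge0 ?sqr_ge0// ltW.
Qed.

Lemma htail_ge0 N f : domA f -> 0 <= htail N f.
Proof. by move=> Df; have := sum_le_htail N 0 Df; rewrite big_geq. Qed.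

Lemma htail_cvg0 f : domA f -> htail N f @[N --> \oo] --> (0 : R).
Proof.
move=> Df; rewrite -(subrr (form f)).
exact: cvgB (cvg_cst (form f)) (parseval_form Df).
Qed.

(** The truncation is orthogonal for the form as well: A of the partial sum only sees the first N
    modes, where the remainder has zero coefficients. *)
Lemma form_remainder N f : domA f ->
  form (fun x => f x - psum (fc f) 0 N x) = htail N f.
Proof.
move=> Df; have DS := psum_domA (fc f) 0 N; have Lf := domA_L2 Df; have LS := domA_L2 DS.
have Dr := domAB Df DS.
rewrite /form innerBr//; last exact: domA_opA_L2.
rewrite (opA_sym pC2 qC sin1 cos2_sin2 Dr Df) innerBr//; last exact: domA_opA_L2.
rewrite -/(form f) innerC [inner (opA (fun _ => _)) _]innerC !inner_psum; try exact: domA_opA_L2.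
rewrite [X in _ - X]big_nat [X in _ - X]big1 ?subr0.
  by rewrite /htail; congr (_ - _); apply: eq_bigr => n _; rewrite fc_opA//; ring.
move=> n nN; rewrite fc_opA// /fc innerBl// -/(fc f n) -/(fc _ n) fc_psum nN subrr.
by rewrite mulr0 mulr0.
Qed.

(** The trace inequality is applied to the remainder of [f], whose form is the tail of a convergent
    series. *)
Lemma psum_cvg f x : domA f -> I01 x -> psum (fc f) 0 m x @[m --> \oo] --> f x.
Proof.
move=> Df Ix; have [C _ CP] := form_trace pC2 qC sin1 cos2_sin2 p0 q0 cot1_ge0 cot2_ge0.
have : (f x - psum (fc f) 0 m x) @[m --> \oo] --> (0 : R).
  apply: (cvg0_sqr (s := fun m => htail m f) (c := C)); last exact: htail_cvg0.
  near=> m; rewrite -form_remainder// mulrC; apply: (CP (fun x => f x - psum (fc f) 0 m x)) => //.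
  by apply: domAB => //; exact: psum_domA.
move=> /(cvgB (cvg_cst (f x))); rewrite subr0; apply: cvg_trans; apply: near_eq_cvg.
by near=> m; rewrite /= subKr.
Unshelve. all: by end_near. Qed.

(** The numbers are taken as coordinates in the orthonormal family [phi], which reduces the claim to
    [cauchy_schwarz] in L^2. *)
Lemma sum_cauchy_schwarz (a b : nat -> R) N m :
  (\sum_(N <= n < m) a n * b n) ^+ 2 <=
  (\sum_(N <= n < m) a n ^+ 2) * (\sum_(N <= n < m) b n ^+ 2).
Proof.
have La := domA_L2 (psum_domA a N m); have Lb := domA_L2 (psum_domA b N m).
rewrite -!sqnorm_psum (le_trans _ (cauchy_schwarz La Lb))//.
rewrite inner_psum// (_ : \sum_(N <= n < m) a n * fc _ n = \sum_(N <= n < m) a n * b n)//.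
by apply: eq_big_nat => n nm; rewrite fc_psum nm.
Qed.

(* The trace inequality at f = sum_n (phi_n(0) / lambda_n) phi_n, for which
   both f(0) and <A f, f> equal the partial sum S: S^2 <= C S. *)
Lemma trace_series_bounded : exists C : R, forall N m,
  \sum_(N <= n < m) `|phi n 0| ^+ 2 / lam n <= C.
Proof.
have [C C0 CP] := form_trace pC2 qC sin1 cos2_sin2 p0 q0 cot1_ge0 cot2_ge0.
exists C => N m; set S := \sum_(_ <= _ < _) _.
have S0 : 0 <= S by rewrite sumr_ge0// => n _; rewrite divr_ge0 ?sqr_ge0// ltW.
have := CP (psum (fun n => phi n 0 / lam n) N m) 0 (psum_domA _ _ _) I010.
rewrite -/(form _) form_psum.
have -> : psum (fun n => phi n 0 / lam n) N m 0 = S.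
  by apply: eq_bigr => n _; rewrite real_normK ?num_real// mulrAC -expr2.
have -> : \sum_(N <= n < m) lam n * (phi n 0 / lam n) ^+ 2 = S.
  apply: eq_bigr => n _; rewrite real_normK ?num_real//.
  by field; rewrite gt_eqF.
rewrite expr2; have [->//|Sn0] := eqVneq S 0; first by move=> _; exact: ltW.
by rewrite ler_pM2r// lt_neqAle eq_sym Sn0.
Qed.

Lemma M_phi_le N (C : R) : (forall m, \sum_(N <= n < m) `|phi n 0| ^+ 2 / lam n <= C) ->
  (M_phi lam phi N <= C%:E)%E.
Proof.
move=> SC; rewrite /M_phi; apply: lime_le.
  by apply: is_cvg_nneseries => n _ _; rewrite lee_fin divr_ge0 ?sqr_ge0// ltW.
by near=> m; rewrite sumEFin lee_fin.
Unshelve. all: by end_near. Qed.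

Lemma M_phi_lty N : (M_phi lam phi N < +oo)%E.
Proof.
have [C CP] := trace_series_bounded.
by rewrite (le_lt_trans (M_phi_le (CP N)))// ltry.
Qed.

Lemma M_phi_ge0 N : (0 <= M_phi lam phi N)%E.
Proof. by apply: nneseries_ge0 => n _ _; rewrite lee_fin divr_ge0 ?sqr_ge0// ltW. Qed.

Lemma M_phi_fine N : ((fine (M_phi lam phi N))%:E = M_phi lam phi N)%E.
Proof. by rewrite fineK// ge0_fin_numE ?M_phi_ge0// M_phi_lty. Qed.

Lemma sum_le_M_phi N m : \sum_(N <= n < m) `|phi n 0| ^+ 2 / lam n <= fine (M_phi lam phi N).
Proof.
rewrite -lee_fin M_phi_fine -sumEFin; apply: nneseries_lim_ge => n _ _.
by rewrite lee_fin divr_ge0 ?sqr_ge0// ltW.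
Qed.

Lemma fine_M_phi_bounded : exists C : R, forall N, fine (M_phi lam phi N) <= C.
Proof.
have [C CP] := trace_series_bounded; exists C => N.
by rewrite -lee_fin M_phi_fine; exact: M_phi_le.
Qed.

Lemma trace_tail N f : domA f ->
  (f 0 - \sum_(0 <= n < N) fc f n * phi n 0) ^+ 2 <= fine (M_phi lam phi N) * htail N f.
Proof.
move=> Df; have h := psum_cvg Df I010.
have h2 : \sum_(N <= n < m) fc f n * phi n 0 @[m --> \oo] -->
    f 0 - \sum_(0 <= n < N) fc f n * phi n 0.
  apply: cvg_trans (cvgB h (cvg_cst (\sum_(0 <= n < N) fc f n * phi n 0))).
  apply: near_eq_cvg; apply: (@eventually_nat_ge _ N) => m Nm.
  exact: sumB_prefix.
apply: (limn_le_bound (cvgM h2 h2)); near=> m; rewrite -[X in X <= _]/((\sum_(N <= n < m) fc f n * phi n 0) ^+ 2).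
(* With this splitting, Cauchy-Schwarz separates a partial sum of [M_phi] from one of the tail of
   the form. *)
pose a n := phi n 0 / Num.sqrt (lam n); pose b n := Num.sqrt (lam n) * fc f n.
have s0 n : Num.sqrt (lam n) != 0 by rewrite gt_eqF// sqrtr_gt0.
rewrite (_ : \sum_(N <= n < m) _ = \sum_(N <= n < m) a n * b n); last first.
  by apply: eq_bigr => n _; rewrite /a /b; field.
rewrite (le_trans (sum_cauchy_schwarz _ _ _ _))//; apply: ler_pM.
- by rewrite sumr_ge0// => n _; rewrite sqr_ge0.
- by rewrite sumr_ge0// => n _; rewrite sqr_ge0.
- rewrite (le_trans _ (sum_le_M_phi N m))// ler_sum// => n _.
  by rewrite /a expr_div_n sqr_sqrtr ?(ltW (lam0 n))// real_normK ?num_real.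
- rewrite (le_trans _ (sum_le_htail N m Df))// ler_sum// => n _.
  by rewrite /b exprMn sqr_sqrtr// ltW.
Unshelve. all: by end_near. Qed.

Lemma remainder_cvg N f : L2 f ->
  L2_cvg \oo (psum (fc f) N) (remainder phi N f).
Proof.
move=> Lf; have [_ _ h] := phi_complete eb Lf.
apply: (@L2_seriesP _ _ _ _ (fun x => f x - psum (fc f) 0 N x)); split.
- by near=> m; exact: domA_L2 (psum_domA _ _ _).
- by apply: L2B => //; exact: domA_L2 (psum_domA _ _ _).
- apply: cvg_trans h; apply: near_eq_cvg; apply: (@eventually_nat_ge _ N) => m Nm.
  apply: sqnorm_ext => x _; rewrite /psum (big_cat_nat (n := N) (p := m))//=; ring.
Unshelve. all: by end_near. Qed.

Lemma remainder_sum N f : L2 f ->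
  \sum_(N <= n < m) fc f n ^+ 2 @[m --> \oo] --> sqnorm (remainder phi N f).
Proof.
move=> Lf; apply: cvg_trans (L2_cvg_sqnorm (remainder_cvg N Lf)); apply: near_eq_cvg.
by near=> m; rewrite sqnorm_psum.
Unshelve. all: by end_near. Qed.

Lemma sqnorm_remainder N f : L2 f ->
  sqnorm (remainder phi N f) = sqnorm f - \sum_(0 <= n < N) fc f n ^+ 2.
Proof.
move=> Lf; have h := @remainder_sum N _ Lf; apply: (limn_unique h).
apply: cvg_trans (cvgB (parseval Lf Lf) (cvg_cst (\sum_(0 <= n < N) fc f n ^+ 2))).
apply: near_eq_cvg; apply: (@eventually_nat_ge _ N) => m Nm.
exact: sumB_prefix.
Qed.

Lemma sqnorm_remainder_cvg0 f : L2 f -> sqnorm (remainder phi N f) @[N --> \oo] --> (0 : R).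
Proof.
move=> Lf; rewrite -(subrr (sqnorm f)).
apply: cvg_trans (cvgB (cvg_cst (sqnorm f)) (parseval Lf Lf)).
apply: near_eq_cvg; near=> N; by rewrite sqnorm_remainder.
Unshelve. all: by end_near. Qed.

Lemma bessel f m : L2 f -> \sum_(0 <= n < m) fc f n ^+ 2 <= sqnorm f.
Proof. by move=> Lf; rewrite -subr_ge0 -sqnorm_remainder// sqnorm_ge0. Qed.

(* The series of A^{1/2} f converges uniformly on [0,1]: by the trace inequality
   its squared Cauchy increments are at most C times those of |A f|^2. *)
Lemma Ahalf_cvg f : domA f ->
  L2_cvg \oo (psum (fun n => Num.sqrt (lam n) * fc f n) 0) (Ahalf lam phi f).
Proof.
move=> Df; have LA := domA_opA_L2 Df.
have [C C0 CP] := form_trace pC2 qC sin1 cos2_sin2 p0 q0 cot1_ge0 cot2_ge0.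
set c := fun n => _; pose T m := sqnorm (remainder phi m (opA f)).
have T0 : T m @[m --> \oo] --> (0 : R) by exact: sqnorm_remainder_cvg0.
have diff m k x : I01 x -> (m <= k)%N -> (psum c 0 k x - psum c 0 m x) ^+ 2 <= C * T m.
  move=> Ix mk; have -> : psum c 0 k x - psum c 0 m x = psum c m k x.
    exact: sumB_prefix.
  rewrite (le_trans (CP _ x (psum_domA c m k) Ix))// ler_wpM2l ?(ltW C0)//.
  rewrite -/(form _) form_psum (_ : \sum_(m <= n < k) _ = \sum_(m <= n < k) fc (opA f) n ^+ 2).
    have h := @remainder_sum m _ LA; apply: (limn_ge_bound h); apply: (@eventually_nat_ge _ k) => j kj.
    by apply: ler_sum_prefix => // n; rewrite sqr_ge0.
  apply: eq_bigr => n _; rewrite fc_opA// /c exprMn sqr_sqrtr ?ltW//; ring.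
have cv x : I01 x -> cvgn (fun m => psum c 0 m x).
  move=> Ix; apply: cauchy_cvg; apply: cauchy_exP => e e0.
  have d0 : 0 < e ^+ 2 / C by rewrite divr_gt0// exprn_gt0.
  move/cvgr0Pnorm_lt : T0 => /(_ _ d0) [M _ MP].
  exists (psum c 0 M x); apply: (@eventually_nat_ge _ M) => k Mk.
  rewrite /ball /= distrC; have := diff M k x Ix Mk.
  have := MP M (leqnn M) => /(le_lt_trans (ler_norm _)); rewrite ltr_pdivlMr// mulrC => h1 h2.
  rewrite ltNge; apply/negP => ek.
  have : e ^+ 2 <= `|psum c 0 k x - psum c 0 M x| ^+ 2 by rewrite ler_sqr ?nnegrE// ltW.
  by rewrite real_normK ?num_real// leNgt (le_lt_trans h2 h1).
pose g x := limn (fun m => psum c 0 m x).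
have dg m x : I01 x -> (psum c 0 m x - g x) ^+ 2 <= C * T m.
  move=> Ix; have h : (psum c 0 k x - psum c 0 m x) @[k --> \oo] --> g x - psum c 0 m x.
    by apply: cvgB; [exact: cv|exact: cvg_cst].
  rewrite -sqrrN opprB; apply: (limn_le_bound (cvgM h h)).
  by apply: (@eventually_nat_ge _ m) => k mk; exact: diff.
have Lp m : L2 (psum c 0 m) by exact: domA_L2 (psum_domA _ _ _).
have Lg : L2 g.
  apply: (@L2_bounded _ _ (Num.sqrt (C * T 0%N))).
    apply: (@measurable_fun_cvg _ _ _ _ (fun m => psum c 0 m)).
      by move=> m; exact: L2_measurable.
    by move=> x Ix; exact: cv.
  move=> x Ix; have CT : 0 <= C * T 0%N by rewrite mulr_ge0 ?(ltW C0) ?sqnorm_ge0.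
  apply: ler_norm_sqr; first exact: sqrtr_ge0.
  (* At [m = 0] the partial sum is empty, so [dg] bounds [g] itself. *)
  by have := dg 0%N x Ix; rewrite /psum big_geq// sub0r sqrrN sqr_sqrtr.
apply: (@L2_seriesP _ _ _ _ g); split => //; first by near=> m; exact: Lp.
apply: (@squeeze_cvgr _ _ _ _ (cst 0) (fun m => C * T m)).
- near=> m; rewrite sqnorm_ge0 /=; apply: sqnorm_le_sup; first exact: (L2B (Lp m) Lg).
  by move=> x Ix; exact: dg.
- exact: cvg_cst.
- by rewrite -(mulr0 C); exact: cvgMl_tmp.
Unshelve. all: by end_near. Qed.

(** This translates the continuity of A^{1/2} w up to t = 0, and the blow-up alternative, into
    statements on the form. *)
Lemma sqnorm_Ahalf f : domA f -> sqnorm (Ahalf lam phi f) = form f.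
Proof.
move=> Df; have h : sqnorm (psum (fun n => Num.sqrt (lam n) * fc f n) 0 m) @[m --> \oo]
  --> sqnorm (Ahalf lam phi f) by exact: L2_cvg_sqnorm (Ahalf_cvg Df).
apply: (limn_unique h).
apply: cvg_trans (parseval_form Df); apply: near_eq_cvg; near=> m.
by rewrite sqnorm_psum; apply: eq_bigr => n _; rewrite exprMn sqr_sqrtr// ltW.
Unshelve. all: by end_near. Qed.

End Spectral.

(** * Quadratic forms and Lyapunov matrices *)

Section QuadraticForms.
Context {R : realType}.

Definition dot {n} (x y : 'cV[R]_n) : R := (x^T *m y) 0 0.
Definition qf {n} (P : 'M[R]_n) (x : 'cV[R]_n) : R := (x^T *m P *m x) 0 0.

Lemma dotE n (x y : 'cV[R]_n) : dot x y = \sum_i x i 0 * y i 0.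
Proof. by rewrite /dot mxE; apply: eq_bigr => i _; rewrite mxE. Qed.

Lemma dotC n (x y : 'cV[R]_n) : dot x y = dot y x.
Proof. by rewrite !dotE; apply: eq_bigr => i _; rewrite mulrC. Qed.

Lemma dotDl n (x y z : 'cV[R]_n) : dot (x + y) z = dot x z + dot y z.
Proof. by rewrite /dot linearD mulmxDl mxE. Qed.

Lemma dotDr n (x y z : 'cV[R]_n) : dot z (x + y) = dot z x + dot z y.
Proof. by rewrite /dot mulmxDr mxE. Qed.

Lemma dotZl n c (x y : 'cV[R]_n) : dot (c *: x) y = c * dot x y.
Proof. by rewrite /dot linearZ /= -scalemxAl mxE. Qed.

Lemma dotZr n c (x y : 'cV[R]_n) : dot x (c *: y) = c * dot x y.
Proof. by rewrite /dot -scalemxAr mxE. Qed.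

Lemma dotNl n (x y : 'cV[R]_n) : dot (- x) y = - dot x y.
Proof. by rewrite -scaleN1r dotZl mulN1r. Qed.

Lemma dotNr n (x y : 'cV[R]_n) : dot x (- y) = - dot x y.
Proof. by rewrite -scaleN1r dotZr mulN1r. Qed.

Lemma dot_ge0 n (x : 'cV[R]_n) : 0 <= dot x x.
Proof. by rewrite dotE sumr_ge0// => i _; rewrite -expr2 sqr_ge0. Qed.

Lemma dot_eq0 n (x : 'cV[R]_n) : dot x x = 0 -> x = 0.
Proof.
rewrite dotE => /eqP; rewrite psumr_eq0; last by move=> i _; rewrite -expr2 sqr_ge0.
move=> /allP h; apply/matrixP => i j; rewrite ord1 mxE.
by have := h i (mem_index_enum _); rewrite mulf_eq0 orbb => /eqP.
Qed.

Lemma dot_mulmxl m n (A : 'M[R]_(m, n)) x y : dot (A *m x) y = dot x (A^T *m y).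
Proof. by rewrite /dot trmx_mul mulmxA. Qed.

Lemma qf_dot n (P : 'M[R]_n) x : qf P x = dot x (P *m x).
Proof. by rewrite /qf /dot mulmxA. Qed.

Lemma qfD n (P Q : 'M[R]_n) x : qf (P + Q) x = qf P x + qf Q x.
Proof. by rewrite !qf_dot mulmxDl dotDr. Qed.

Lemma qfZ n c (P : 'M[R]_n) x : qf (c *: P) x = c * qf P x.
Proof. by rewrite !qf_dot -scalemxAl dotZr. Qed.

Lemma dot_young n (x y : 'cV[R]_n) (e : R) : 0 < e ->
  2 * dot x y <= e * dot x x + e^-1 * dot y y.
Proof.
move=> e0; have := dot_ge0 (e *: x - y).
rewrite dotDl !dotDr !dotNl !dotNr !dotZl !dotZr (dotC y x) => h.
have : 0 <= e^-1 * (e * (e * dot x x) + - (e * dot x y) + (- (e * dot x y) - - dot y y)).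
  by rewrite mulr_ge0 ?invr_ge0 ?(ltW e0).
rewrite (_ : e^-1 * _ = e * dot x x - 2 * dot x y + e^-1 * dot y y); last first.
  by field; rewrite gt_eqF.
by lra.
Qed.

Lemma dot_cs n (x y : 'cV[R]_n) : dot x y ^+ 2 <= dot x x * dot y y.
Proof.
apply: discriminant_le; first exact: dot_ge0.
move=> t; have := dot_ge0 (x - t *: y).
rewrite dotDl !dotDr !dotNl !dotNr !dotZl !dotZr (dotC y x).
by rewrite (_ : _ + _ + _ = dot x x - 2 * (t * dot x y) + t ^+ 2 * dot y y)//; ring.
Qed.

Definition frob {m n} (A : 'M[R]_(m, n)) : R := \sum_i \sum_j A i j ^+ 2.

Lemma frob_ge0 m n (A : 'M[R]_(m, n)) : 0 <= frob A.
Proof. by apply: sumr_ge0 => i _; apply: sumr_ge0 => j _; exact: sqr_ge0. Qed.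

Lemma dot_mulmx_le m n (A : 'M[R]_(m, n)) x :
  dot (A *m x) (A *m x) <= frob A * dot x x.
Proof.
rewrite [leLHS]dotE /frob mulr_suml ler_sum// => i _; rewrite -expr2.
have -> : (A *m x) i 0 = dot (row i A)^T x.
  by rewrite dotE mxE; apply: eq_bigr => j _; rewrite !mxE.
rewrite (le_trans (dot_cs _ _))// ler_wpM2r ?dot_ge0//.
by rewrite dotE ler_sum// => j _; rewrite !mxE -expr2.
Qed.

Lemma dot_col m n (a c : 'cV[R]_m) (b d : 'cV[R]_n) :
  dot (col_mx a b) (col_mx c d) = dot a c + dot b d.
Proof. by rewrite /dot tr_col_mx mul_row_col mxE. Qed.

Lemma posdef_unit n (P : 'M[R]_n) : posdef P -> P \in unitmx.
Proof.
move=> [PT P0]; rewrite -row_free_unit -kermx_eq0; apply/rowV0P => v /sub_kermxP vP.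
apply/eqP; rewrite -trmx_eq0; apply/eqP; apply: contrapT => /eqP v0.
have := P0 _ v0; rewrite trmxK vP mul0mx mxE ltxx. by [].
Qed.

(* x_i = <P^-1 e_i, x> for the scalar product defined by P. *)
Lemma posdef_lower n (P : 'M[R]_n) : posdef P ->
  exists2 c, 0 < c & forall x, c * dot x x <= qf P x.
Proof.
move=> Pd; have [PT P0] := Pd; have Pu := posdef_unit Pd.
have q0 x : 0 <= qf P x.
  have [->|/P0/ltW//] := eqVneq x 0; by rewrite /qf mulmx0 mxE.
have cs x y : dot x (P *m y) ^+ 2 <= qf P x * qf P y.
  apply: discriminant_le => // t.
  have := q0 (x - t *: y); rewrite !qf_dot mulmxBr -scalemxAr.
  rewrite dotDl !dotDr !dotNl !dotNr !dotZl !dotZr.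
  have -> : dot y (P *m x) = dot x (P *m y) by rewrite dotC dot_mulmxl PT.
  by rewrite (_ : _ + _ + _ = dot x (P *m x) - 2 * (t * dot x (P *m y)) + t ^+ 2 * dot y (P *m y))//; ring.
pose f i := invmx P *m delta_mx i (0 : 'I_1).
pose S := \sum_i qf P (f i).
have S0 : 0 <= S by rewrite sumr_ge0.
exists (S + 1)^-1 => [|x]; first by rewrite invr_gt0 ltr_wpDl.
rewrite ler_pdivrMl ?ltr_wpDl// (@le_trans _ _ (S * qf P x))//; last first.
  by rewrite ler_wpM2r// lerDl.
rewrite dotE /S mulr_suml ler_sum// => i _; rewrite -expr2.
rewrite (_ : x i 0 = dot (f i) (P *m x))// dotC dot_mulmxl PT /f mulKVmx// dotE.
rewrite (bigD1 i)//= mxE !eqxx mulr1 big1 ?addr0// => j ji.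
by rewrite mxE (negbTE ji) mulr0.
Qed.

Lemma finite_lower n (f : 'I_n -> R) : (forall i, 0 < f i) ->
  exists2 c, 0 < c & forall i, c <= f i.
Proof.
elim: n f => [|n IH] f f0; first by exists 1 => // -[].
have [c c0 cP] := IH (fun i => f (lift ord0 i)) (fun i => f0 _).
exists (Num.min c (f ord0)); first by rewrite lt_min c0 f0.
move=> i; case: (unliftP ord0 i) => [j ->|->].
  by rewrite ge_min cP.
by rewrite ge_min lexx orbT.
Qed.

End QuadraticForms.

(** * Lyapunov matrices from the Schur form *)

Section Lyapunov.
Context {R : realType}.
Local Notation C := R[i].
Local Notation toC := (real_complex R).

Let ReD : {morph (@complex.Re R) : x y / x + y}. Proof. by move=> [a b] [c d]. Qed.
Let ImD : {morph (@complex.Im R) : x y / x + y}. Proof. by move=> [a b] [c d]. Qed.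

Lemma map_Re_mulmx m n p (S : 'M[C]_(m, n)) (T : 'M[C]_(n, p)) :
  map_mx (@complex.Re R) (S *m T)
  = map_mx (@complex.Re R) S *m map_mx (@complex.Re R) T
    - map_mx (@complex.Im R) S *m map_mx (@complex.Im R) T.
Proof.
apply/matrixP => i j; rewrite !mxE (big_morph _ ReD (erefl _)) -sumrB.
apply: eq_bigr => k _; rewrite !mxE; by case: (S i k) => a b; case: (T k j).
Qed.

Lemma map_Im_mulmx m n p (S : 'M[C]_(m, n)) (T : 'M[C]_(n, p)) :
  map_mx (@complex.Im R) (S *m T)
  = map_mx (@complex.Re R) S *m map_mx (@complex.Im R) T
    + map_mx (@complex.Im R) S *m map_mx (@complex.Re R) T.
Proof.
apply/matrixP => i j; rewrite !mxE (big_morph _ ImD (erefl _)) -big_split.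
apply: eq_bigr => k _; rewrite !mxE; by case: (S i k) => a b; case: (T k j).
Qed.

Lemma map_Re_toC m n (A : 'M[R]_(m, n)) : map_mx (@complex.Re R) (map_mx toC A) = A.
Proof. by apply/matrixP => i j; rewrite !mxE. Qed.

Lemma map_Im_toC m n (A : 'M[R]_(m, n)) : map_mx (@complex.Im R) (map_mx toC A) = 0.
Proof. by apply/matrixP => i j; rewrite !mxE. Qed.

(** The diagonal entries of the triangular form are roots of its characteristic polynomial, hence
    eigenvalues of [A] by similarity. *)
Lemma schur_spectrum n (A : 'M[R]_n) (r : R) : (0 < n)%N -> spectrum_lt A r ->
  exists U T : 'M[C]_n, [/\ U \in unitmx, U *m map_mx toC A = T *m U,
    (forall i j : 'I_n, (i < j)%N -> T i j = 0) &
    forall i, complex.Re (T i i) < r].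
Proof.
move=> n0 sA; have [U Uu Ut] := Schur (map_mx toC A) n0.
have Uu' := unitarymx_unit Uu.
exists U, (U *m map_mx toC A *m invmx U); split=> //.
- by rewrite mulmxKV.
- by move: Ut; rewrite /similar_to conjumx// => /is_trig_mxP.
- move=> i; apply: sA; apply: (eigenvalue_conjmx (V := U)).
  + exact: stablemx_unit.
  + by rewrite row_free_unit.
  rewrite conjumx//; move: Ut; rewrite /similar_to conjumx// => Ut.
  rewrite -topredE /= eigenvalue_root_char char_poly_trig// /root horner_prod.
  apply/eqP; rewrite (bigD1 i)//= !hornerE subrr mul0r//.
Qed.

(* Conjugating the Schur form by diag(1, e, e^2, ...) makes its off-diagonal
   entries O(e). *)
Lemma scaled_schur n (A : 'M[R]_n) (r : R) : (0 < n)%N -> spectrum_lt A r ->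
  exists2 rho, rho < r & forall eta, 0 < eta ->
  exists S T : 'M[C]_n, [/\ (forall x : 'cV[C]_n, S *m x = 0 -> x = 0),
    S *m map_mx toC A = T *m S,
    (forall i j : 'I_n, i != j -> `|complex.Re (T i j)| <= eta /\ `|complex.Im (T i j)| <= eta) &
    forall i, complex.Re (T i i) <= rho].
Proof.
move=> n0 sA; have [U [T [Uu UA trT dT]]] := schur_spectrum n0 sA.
(* The gap below [r] is fixed before [eta], which is possible because the diagonal scaling leaves
   the diagonal of [T] unchanged. *)
have [c c0 cP] := @finite_lower R n (fun i => r - complex.Re (T i i))
  (fun i => eq_ind_r is_true (dT i) (subr_gt0 _ _)).
exists (r - c) => [|eta eta0]; first by rewrite ltrBlDr ltrDl.
pose B := \sum_i \sum_j (`|complex.Re (T i j)| + `|complex.Im (T i j)|).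
have B0 : 0 <= B by do 2 apply: sumr_ge0 => ? _; rewrite addr_ge0.
have TB i j : `|complex.Re (T i j)| + `|complex.Im (T i j)| <= B.
  rewrite /B (bigD1 i)//= (bigD1 j)//= -addrA lerDl addr_ge0//.
    by apply: sumr_ge0 => ? _; rewrite addr_ge0.
  by do 2 apply: sumr_ge0 => ? _; rewrite addr_ge0.
(* [B] bounds every entry of [T], so [e * B <= eta]; and [e <= 1] gives e^(i-j) <= e below the
   diagonal, the only place where off-diagonal entries survive. *)
pose e : R := Num.min 1 (eta / (B + 1)).
have e0 : 0 < e by rewrite lt_min ltr01 divr_gt0// ltr_wpDl.
have e1 : e <= 1 by rewrite ge_min lexx.
have eB : e * B <= eta.
  have h : e <= eta / (B + 1) by rewrite ge_min lexx orbT.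
  rewrite (@le_trans _ _ (eta / (B + 1) * B))//; first by rewrite ler_wpM2r.
  rewrite -mulrA ler_piMr ?(ltW eta0)// mulrC ler_pdivrMr ?ltr_wpDl//.
  by rewrite mul1r lerDl.
pose w (i : 'I_n) : C := toC (e ^+ i).
have w0 i : w i != 0.
  by rewrite /w -(rmorph0 toC) (inj_eq (@complexI R)) gt_eqF// exprn_gt0.
exists (\matrix_(i, j) (w i * U i j)), (\matrix_(i, j) (w i * T i j / w j)).
split.
- move=> x Sx; rewrite -[x](mulKmx Uu); suff -> : U *m x = 0 by rewrite mulmx0.
  apply/matrixP => i j; rewrite ord1 [RHS]mxE.
  have := congr1 (fun M : 'cV[_]_n => M i 0) Sx; rewrite [RHS]mxE mxE.
  under eq_bigr => k _ do rewrite mxE -mulrA.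
  rewrite -mulr_sumr => /eqP; rewrite mulf_eq0 (negbTE (w0 i)) /= => /eqP h.
  by rewrite mxE.
- apply/matrixP => i j; rewrite !mxE.
  have := congr1 (fun M : 'M[C]_n => M i j) UA; rewrite !mxE => UAij.
  under eq_bigr => k _ do rewrite mxE -mulrA.
  rewrite -mulr_sumr UAij mulr_sumr; apply: eq_bigr => k _; rewrite !mxE.
  by field; exact: w0.
- move=> i j ij; rewrite !mxE.
  have [lt_ij|lt_ji|/ord_inj e_ij] := ltngtP i j; last by rewrite e_ij eqxx in ij.
    by rewrite trT// mulr0 mul0r /= normr0; split; exact: ltW.
  have -> : w i * T i j / w j = toC (e ^+ (i - j)) * T i j.
    rewrite (_ : w i = toC (e ^+ (i - j)) * w j); last first.
      by rewrite /w -rmorphM /= -exprD subnK// ltnW.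
    by field; exact: w0.
  have eij : e ^+ (i - j) <= e.
    rewrite -[X in _ <= X]expr1; apply: ler_wiXn2l => //; first exact: ltW.
    by rewrite subn_gt0.
  have eij0 : 0 <= e ^+ (i - j) by rewrite exprn_ge0// ltW.
  have := TB i j; case: (T i j) => t1 t2 /= tB.
  have t1B : `|t1| <= B by rewrite (le_trans _ tB)// lerDl.
  have t2B : `|t2| <= B by rewrite (le_trans _ tB)// lerDr.
  split; rewrite ?mul0r ?subr0 ?addr0 normrM (ger0_norm eij0) (le_trans _ eB)//.
    exact: ler_pM.
  exact: ler_pM.
- move=> i; rewrite !mxE mulrAC divff// mul1r.
  by have := cP i; lra.
Qed.

(** The form is x -> |S x|^2 on real vectors, with S from [scaled_schur]; thus P is the real part of
    S^* S. By S A = T S, the product 2 <P x, A x> is 2 Re <S x, T S x>, where T is nearly diagonal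
    with diagonal real parts at most [rho]. Everything is written with real and imaginary parts. *)
Lemma lyapunov n (A : 'M[R]_n) (r : R) : (0 < n)%N -> spectrum_lt A r ->
  exists P : 'M[R]_n, posdef P /\ exists2 c, 0 < c &
    forall x, 2 * dot (P *m x) (A *m x) - 2 * r * qf P x <= - c * dot x x.
Proof.
move=> n0 sA; have [rho rho_r H] := scaled_schur n0 sA.
(* The off-diagonal entries raise the rate [rho] by at most 2 n eta = (r - rho) / 2; after doubling,
   the total r + rho stays below 2 r. *)
pose eta := (r - rho) / (4 * n%:R).
have n0' : 0 < n%:R :> R by rewrite ltr0n.
have eta0 : 0 < eta by rewrite divr_gt0 ?subr_gt0// mulr_gt0.
have [S [T [Sinj SA offT diagT]]] := H _ eta0.
pose S1 := map_mx (@complex.Re R) S; pose S2 := map_mx (@complex.Im R) S.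
pose T1 := map_mx (@complex.Re R) T; pose T2 := map_mx (@complex.Im R) T.
have SA1 : S1 *m A = T1 *m S1 - T2 *m S2.
  by rewrite -map_Re_mulmx -SA map_Re_mulmx map_Re_toC map_Im_toC mulmx0 subr0.
have SA2 : S2 *m A = T1 *m S2 + T2 *m S1.
  by rewrite -map_Im_mulmx -SA map_Im_mulmx map_Re_toC map_Im_toC mulmx0 add0r.
pose P := S1^T *m S1 + S2^T *m S2.
have dotP x y : dot (P *m x) y = dot (S1 *m x) (S1 *m y) + dot (S2 *m x) (S2 *m y).
  by rewrite /P mulmxDl dotDl -!mulmxA !dot_mulmxl !trmxK.
have PT : P^T = P by rewrite /P linearD /= !trmx_mul !trmxK.
have qfP x : qf P x = dot (S1 *m x) (S1 *m x) + dot (S2 *m x) (S2 *m x).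
  by rewrite qf_dot dotC dotP.
have Pd : posdef P.
  split=> // x x0; rewrite -/(qf P x) qfP lt_neqAle addr_ge0 ?dot_ge0// andbT eq_sym.
  apply/negP; rewrite paddr_eq0 ?dot_ge0// => /andP[/eqP /dot_eq0 h1 /eqP /dot_eq0 h2].
  (* A real vector killed by both [S1] and [S2] is killed by the complex matrix [S], which is
     injective. *)
  move/eqP : x0; apply; suff h : map_mx toC x = 0.
    by rewrite -[x]map_Re_toC h; apply/matrixP => i j; rewrite !mxE.
  apply: Sinj; apply/matrixP => i j.
  have e1 := congr1 (fun M : 'cV[_]_n => M i j) (map_Re_mulmx S (map_mx toC x)).
  have e2 := congr1 (fun M : 'cV[_]_n => M i j) (map_Im_mulmx S (map_mx toC x)).
  move: e1 e2; rewrite !map_Re_toC !map_Im_toC !mulmx0 subr0 add0r -/S1 -/S2 h1 h2.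
  rewrite [in LHS]mxE [in RHS]mxE => e1; rewrite [in LHS]mxE [in RHS]mxE => e2.
  by rewrite [RHS]mxE; move: e1 e2; case: ((S *m map_mx toC x) i j) => a b /= -> ->.
exists P; split=> //; have [c c0 cP] := posdef_lower Pd.
exists ((r - rho) * c) => [|x]; first by rewrite mulr_gt0// subr_gt0.
suff h : 2 * dot (P *m x) (A *m x) <= (r + rho) * qf P x.
  have := cP x; have rr : 0 < r - rho by rewrite subr_gt0.
  move=> /(ler_wpM2l (ltW rr)); lra.
rewrite qfP dotP !mulmxA SA1 SA2 !mulmxBl !mulmxDl -!mulmxA.
set u := S1 *m x; set v := S2 *m x; clearbody u v.
have mulE (M : 'M[R]_n) (y z : 'cV_n) : dot y (M *m z) = \sum_i \sum_j y i 0 * M i j * z j 0.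
  rewrite dotE; apply: eq_bigr => i _; rewrite mxE mulr_sumr.
  by apply: eq_bigr => j _; rewrite mulrA.
pose E (i : 'I_n) := u i 0 ^+ 2 + v i 0 ^+ 2.
have E0 i : 0 <= E i by rewrite addr_ge0// sqr_ge0.
have SE : dot u u + dot v v = \sum_i E i.
  by rewrite !dotE -big_split; apply: eq_bigr => i _; rewrite /E !expr2.
rewrite SE !dotDr dotNr !mulE addrA -sumrB -!big_split /=.
have key : \sum_i \sum_j (u i 0 * T1 i j * u j 0 - u i 0 * T2 i j * v j 0
    + v i 0 * T1 i j * v j 0 + v i 0 * T2 i j * u j 0)
  <= \sum_i (rho * E i + \sum_j eta * (E i + E j)).
  apply: ler_sum => i _; rewrite (bigD1 i)//= [X in _ <= _ + X](bigD1 i)//= addrA.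
  apply: lerD.
    (* On the diagonal the two terms with [T2 i i] cancel, so only real parts of eigenvalues
       matter. *)
    have di : T1 i i <= rho by rewrite mxE.
    have := ler_wpM2r (E0 i) di; have := mulr_ge0 (ltW eta0) (E0 i).
    rewrite /E; move: (T1 i i) (T2 i i) (u i 0) (v i 0) => t1 t2 a b; lra.
  apply: ler_sum => j ji; have [] := offT i j; first by rewrite eq_sym.
  rewrite (_ : complex.Re (T i j) = T1 i j) ?mxE// (_ : complex.Im (T i j) = T2 i j) ?mxE//.
  rewrite /E; move: (complex.Re (T i j)) (complex.Im (T i j)) (u i 0) (v i 0) (u j 0) (v j 0).
  move=> t1 t2 a b c' d t1e t2e.
  have bound (t y z : R) : `|t| <= eta -> y * t * z <= eta / 2 * (y ^+ 2 + z ^+ 2).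
    move=> te; rewrite (@le_trans _ _ (`|t| * (`|y| * `|z|)))//.
      by rewrite (le_trans (ler_norm _))// !normrM mulrAC mulrC.
    rewrite (@le_trans _ _ (eta * (`|y| * `|z|)))//; first by rewrite ler_wpM2r// mulr_ge0.
    rewrite -mulrA ler_wpM2l ?(ltW eta0)// -(real_normK (num_real y)) -(real_normK (num_real z)).
    by have := sqr_ge0 (`|y| - `|z|); lra.
  have b1 := bound _ a c' t1e; have b2 := bound (- t2) a d.
  have b3 := bound _ b d t1e; have b4 := bound _ b c' t2e.
  rewrite normrN in b2; have {}b2 := b2 t2e.
  by rewrite mulrN mulNr in b2; lra.
rewrite (le_trans (_ : _ <= 2 * \sum_i (rho * E i + \sum_j eta * (E i + E j))))//.
  rewrite ler_wpM2l// (le_trans _ key)// le_eqVlt; apply/orP; left; apply/eqP.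
  apply: eq_bigr => i _; rewrite -sumrB -!big_split /=; apply: eq_bigr => j _; ring.
rewrite big_split /= -mulr_sumr.
have -> : \sum_i \sum_j eta * (E i + E j) = 2 * (n%:R * eta) * \sum_i E i.
  under eq_bigr => i _ do rewrite -mulr_sumr big_split /= sumr_const card_ord.
  rewrite -mulr_sumr big_split /= sumr_const card_ord -sumrMnl -[_ *+ n]mulr_natr.
  under eq_bigr => i _ do rewrite -mulr_natr.
  by rewrite -mulr_suml; ring.
rewrite (_ : n%:R * eta = (r - rho) / 4); last by rewrite /eta; field; rewrite gt_eqF.
have : 0 <= \sum_i E i by exact: sumr_ge0.
move: (\sum_i E i) => s s0; lra.
Qed.

End Lyapunov.

(** * The matrix inequalities and their feasibility *)

Section BlockForms.
Context {R : realType}.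

Lemma qf_block m n (A : 'M[R]_m) (B : 'M[R]_(m, n)) (C : 'M[R]_(n, m)) (D : 'M[R]_n) x y :
  qf (block_mx A B C D) (col_mx x y) = qf A x + dot x (B *m y) + dot y (C *m x) + qf D y.
Proof.
rewrite !qf_dot mul_block_col dot_col !dotDr; ring.
Qed.

Lemma qf_gram n (E : 'rV[R]_n) x : qf (E^T *m E) x = (E *m x) 0 0 ^+ 2.
Proof. by rewrite qf_dot dotC -mulmxA dot_mulmxl trmxK dotE big_ord1 expr2. Qed.

Lemma mulmx_scalar11 n (B : 'cV[R]_n) (c : R) : B *m (c%:M : 'cV[R]_1) = c *: B.
Proof. by rewrite mul_mx_scalar. Qed.

Lemma dot_scalar11 (c d : R) : dot (c%:M : 'cV[R]_1) d%:M = c * d.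
Proof. by rewrite dotE big_ord1 !mxE !mulr1n. Qed.

Lemma qf_scalar11 (c d : R) : qf (c%:M : 'M[R]_1) d%:M = c * d ^+ 2.
Proof. by rewrite qf_dot mulmx_scalar11 dotZr dot_scalar11; ring. Qed.

Lemma col_mx11 n (x : 'cV[R]_(n + 1)) : x = col_mx (usubmx x) (dsubmx x 0 0)%:M.
Proof. by rewrite -{1}(vsubmxK x) {1}[dsubmx x]mx11_scalar. Qed.

End BlockForms.

Section ClosedLoopMatrices.
Context {R : realType}.
Variables (th2 : R) (p qt : R -> R) (qc : R).
Variables (lam : nat -> R) (phi : nat -> R -> R).
Variables (N0 : nat) (K : 'rV[R]_N0) (L : 'cV[R]_N0) (N : nat).
Variables (delta kphi Dkphi Mphi : R).
Local Notation m := (N - N0)%N.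
Local Notation A0 := (A0 qc lam N0).
Local Notation B0 := (B0 th2 p qt qc lam phi N0).
Local Notation C0 := (C0 phi N0).
Local Notation A1 := (A1 qc lam N0 N).
Local Notation B1t := (B1t th2 p qt qc lam phi N0 N).
Local Notation C1t := (C1t lam phi N0 N).
Local Notation F := (F_mx th2 p qt qc lam phi K L N kphi).
Local Notation Lm := (L_mx L N).
Local Notation Lp := (Lpsi_mx th2 p qt qc lam phi N0 N).

Definition state (a b : 'cV[R]_N0) (z e : 'cV[R]_m) : 'cV[R]_(N0 + N0 + (m + m)) :=
  col_mx (col_mx a b) (col_mx z e).

(** In [adot], [bdot], [zdot] and [edot], the block components of the truncated dynamics, [zeta]
    stands for the output of the modes beyond N, and [psi] for the deviation of the saturated input
    from [kphi] times the control. *)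
Definition adot (a b : 'cV[R]_N0) (e : 'cV[R]_m) (zeta psi : R) : 'cV[R]_N0 :=
  (A0 + kphi *: (B0 *m K)) *m a + L *m (C0 *m b) + L *m (C1t *m e)
  + zeta *: L + psi *: B0.

Definition bdot (b : 'cV[R]_N0) (e : 'cV[R]_m) (zeta : R) : 'cV[R]_N0 :=
  (A0 - L *m C0) *m b - L *m (C1t *m e) - zeta *: L.

Definition zdot (a : 'cV[R]_N0) (z : 'cV[R]_m) (psi : R) : 'cV[R]_m :=
  kphi *: (B1t *m (K *m a)) + A1 *m z + psi *: B1t.

Definition edot (e : 'cV[R]_m) : 'cV[R]_m := A1 *m e.

Lemma F_state a b z e zeta psi :
  F *m state a b z e + zeta *: Lm + psi *: Lp =
  state (adot a b e zeta psi) (bdot b e zeta) (zdot a z psi) (edot e).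
Proof.
rewrite /F_mx /L_mx /Lpsi_mx /state !mul_block_col !scale_col_mx !add_col_mx.
rewrite !scaler0 !mul0mx !addr0 !add0r.
congr (col_mx (col_mx _ _) (col_mx _ _)).
- by rewrite /adot -!mulmxA.
- by rewrite /bdot scalerN mulNmx -mulmxA.
- by rewrite /zdot -scalemxAl -mulmxA.
Qed.

Lemma E_state a b z e zeta psi :
  (E_mx th2 p qt qc lam phi K L N kphi *m
     col_mx (col_mx (state a b z e) zeta%:M) psi%:M) 0 0
  = (K *m adot a b e zeta psi) 0 0.
Proof.
rewrite /E_mx /state -mulmxA !mul_row_col mul0mx add0r !mulmx_scalar11 /adot.
by rewrite -!mulmxA.
Qed.

Lemma Kt_state a b z e : Kt_mx K N *m state a b z e = K *m a.
Proof. by rewrite /Kt_mx /state !mul_row_col !mul0mx !addr0. Qed.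

Variables (P : 'M[R]_(N0 + N0 + (m + m))) (alpha beta gamma tau : R).
Hypothesis PT : P^T = P.
Local Notation ra := (sqnorm (remainder phi N (a_fun th2 p qt))).
Local Notation rb := (sqnorm (remainder phi N (b_fun th2))).
Local Notation Th1 := (Theta1 th2 p qt qc lam phi K L delta kphi Dkphi Mphi P alpha beta gamma tau).

(** The first term is the derivative of X^T P X along the truncated dynamics. The matrix inequality
    is used through this identity in both directions: to deduce decay and to prove feasibility. *)
Lemma Theta1_qf a b z e zeta psi :
  qf Th1 (col_mx (col_mx (state a b z e) zeta%:M) psi%:M) =
  2 * dot (P *m state a b z e)
        (state (adot a b e zeta psi) (bdot b e zeta) (zdot a z psi) (edot e))
  + 2 * delta * qf P (state a b z e)
  + (alpha * gamma * kphi ^+ 2 * ra + tau * Dkphi ^+ 2) * (K *m a) 0 0 ^+ 2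
  - beta * zeta ^+ 2 + (alpha * gamma * ra - tau) * psi ^+ 2
  + alpha * gamma * rb * Mphi ^+ 2 * (K *m adot a b e zeta psi) 0 0 ^+ 2.
Proof.
rewrite -F_state /Theta1 qfD qfZ qf_gram E_state; set X := state a b z e.
rewrite !qf_block !qf_scalar11 mul_row_col mul_col_mx dot_col !mul0mx addr0.
have -> : dot (zeta%:M : 'cV[R]_1) (0 : 'cV_1) = 0.
  by rewrite dotE big1// => i _; rewrite [X in _ * X]mxE mulr0.
rewrite /Theta11 !qfD !qfZ qf_gram Kt_state !mulmx_scalar11 !dotZr.
have dotPX y : dot (P *m X) y = dot X (P *m y) by rewrite dot_mulmxl PT.
have scal (M : 'cV[R]_(N0 + N0 + (m + m))) c : dot (c%:M : 'cV_1) (M^T *m P *m X) = c * dot X (P *m M).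
  rewrite dotE big_ord1 mxE mulr1n; congr (_ * _).
  by rewrite -dotPX dotC /dot mulmxA.
rewrite !scal !dotDr !dotZr !dotPX.
have -> : qf (F^T *m P) X = dot X (P *m (F *m X)).
  by rewrite qf_dot -mulmxA -dot_mulmxl dotC dotPX.
have -> : qf (P *m F) X = dot X (P *m (F *m X)) by rewrite qf_dot mulmxA.
have alg (d1 d2 d3 q1 k1 k2 r1 r2 : R) :
    d1 + d1 + 2 * delta * q1 + (alpha * gamma * kphi ^+ 2 * r1 + tau * Dkphi ^+ 2) * k1 ^+ 2
    + zeta * d2 + zeta * d2 + - beta * zeta ^+ 2 + (psi * d3 + 0) + psi * d3
    + (alpha * gamma * r1 - tau) * psi ^+ 2 + alpha * gamma * r2 * Mphi ^+ 2 * k2 ^+ 2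
    = 2 * (d1 + zeta * d2 + psi * d3) + 2 * delta * q1
    + (alpha * gamma * kphi ^+ 2 * r1 + tau * Dkphi ^+ 2) * k1 ^+ 2 - beta * zeta ^+ 2
    + (alpha * gamma * r1 - tau) * psi ^+ 2 + alpha * gamma * r2 * Mphi ^+ 2 * k2 ^+ 2.
  by ring.
exact: alg.
Qed.

Lemma Theta1_sym : Th1^T = Th1.
Proof.
have T11 : (Theta11 th2 p qt qc lam phi K L delta kphi Dkphi P alpha gamma tau)^T
    = Theta11 th2 p qt qc lam phi K L delta kphi Dkphi P alpha gamma tau.
  rewrite /Theta11 !linearD /= !linearZ /= !trmx_mul !trmxK PT.
  by rewrite [P *m _ + _]addrC.
rewrite /Theta1 linearD /= linearZ /= trmx_mul trmxK !tr_block_mx tr_col_mx tr_row_mx.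
by rewrite !trmx_mul !tr_scalar_mx !trmx0 PT !trmxK T11.
Qed.

End ClosedLoopMatrices.

Section Margins.
Context {R : realType}.
Implicit Types c t f D k ra rb : R.

Lemma gain_margin c t f D :
  (t * f + 1) * D <= c / 4 -> t * f * D ^+ 2 <= t * f * D -> 0 < D -> t * D ^+ 2 * f <= c / 4.
Proof. lra. Qed.

Lemma gain_ge0 k ra t D : 0 <= t -> 0 <= ra -> 0 <= 2 * k ^+ 2 * ra + t * D ^+ 2.
Proof.
move=> t0 ra0; have k0 := mulr_ge0 (sqr_ge0 k) ra0.
by have := mulr_ge0 t0 (sqr_ge0 D); lra.
Qed.

Lemma sector_margin c t f D k ra : t * D ^+ 2 * f <= c / 4 -> 0 <= ra ->
  (k ^+ 2 * f + 1) * ra <= c / 8 -> (2 * k ^+ 2 * ra + t * D ^+ 2) * f <= c / 2.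
Proof. lra. Qed.

Lemma remainder_margin c f ra : 0 <= f -> 0 <= ra -> (f + 1) * ra <= c / 8 -> 2 * ra <= c / 4.
Proof. by move=> f0 r0; have := mulr_ge0 f0 r0; lra. Qed.

Lemma slope_margin c f k rb : 0 <= rb -> (k ^+ 2 * f + 1) * rb <= c / 8 ->
  2 * rb * k ^+ 2 * f <= c / 4.
Proof. lra. Qed.

(** With alpha = 2 and gamma = 1 the coefficient of [l] is - 2 (1 - 3/4) = - 1/2, whence the
    threshold. *)
Lemma theta2_margin (l qc delta bet C M : R) : bet * M <= bet * C ->
  4 * (qc + delta) + 2 * (bet * C) <= l ->
  2 * 1 * (- (1 - 3 / (2 * 2)) * l + qc + delta) + bet * M <= 0.
Proof. lra. Qed.

(** Bookkeeping of [lyapunov_design]: [v1] to [v4] are the weighted derivatives of the four blocks,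
    [A], [B], [E] squared norms, [z2] and [p2] the squares of zeta and psi, [fB] and [ME] the
    couplings through b and e, and [m0] to [m3] the terms left by Young's inequality. *)
Lemma cascade_sum (c ca A B E z2 p2 v1 v2 v3 v4 j3 fB ME Wz m0 m1 m2 m3 bz tp : R) :
  v1 <= - ca * A + 3 * (ca / 8 * A) + fB + m0 + m2 ->
  v2 <= - 2 * fB - 2 * B + m1 -> v3 <= j3 -> j3 <= ca / 8 * A + m3 ->
  v4 <= - 4 * ME - 2 * E -> m0 + m1 <= 2 * ME + 2 * Wz ->
  bz = 2 * Wz + z2 -> tp = m2 + m3 + p2 ->
  c * A <= ca / 2 * A -> c * B <= 1 * B -> c * E <= 1 * E -> c * z2 <= 1 * z2 ->
  c * p2 <= 1 * p2 -> 0 <= A -> 0 <= fB -> 0 <= ME -> 0 <= B -> 0 <= E ->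
  v1 + v2 + v3 + v4 - bz - tp <= - c * (A + B + E + z2 + p2).
Proof. lra. Qed.

(** The design margin [c] is shared out: one half on |a|^2 for the sector width and the remainder of
    a, one quarter of everything for the slope term, one quarter on psi^2 for the remainder of a. *)
Lemma quadratic_sum_le0 (c k t D m delta eta eps mu bet da db de z2 p2 ra rb ka kd
    v1 v2 v3 v4 v5 v6 v7 : R) :
  2 * v1 + 2 * delta * v2 + eta * (2 * v3 + 2 * delta * v4)
    + eps * (2 * v5 + 2 * delta * v6) + mu * (2 * v7 + 2 * delta * de)
    - bet * z2 - t * p2 <= - c * (da + db + de + z2 + p2) ->
  (2 * k ^+ 2 * ra + t * D ^+ 2) * ka <= c / 2 * da ->
  2 * rb * m ^+ 2 * kd <= c / 4 * (da + db + de + z2 + p2) ->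
  2 * ra * p2 <= c / 4 * p2 ->
  0 <= c * db -> 0 <= c * de -> 0 <= c * z2 -> 0 <= c * p2 -> 0 <= c * da ->
  2 * (v1 + eta * v3 + eps * v5 + mu * v7)
  + 2 * delta * (v2 + eta * v4 + eps * v6 + mu * de)
  + (2 * k ^+ 2 * ra + t * D ^+ 2) * ka - bet * z2 + (2 * ra - t) * p2
  + 2 * rb * m ^+ 2 * kd <= 0.
Proof. lra. Qed.

End Margins.

(** * Feasibility for large N *)

Section Feasibility.
Context {R : realType}.
Variables (th1 th2 : R) (p q qt : R -> R) (qc : R) (lam : nat -> R) (phi : nat -> R -> R).
Hypotheses (pC2 : C2_01 p) (qC : {within I01, continuous q}) (qtC : {within I01, continuous qt}).
Hypotheses (sin1 : sin th1 != 0) (cos2_sin2 : sin th2 = 0 -> cos th2 != 0).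
Hypotheses (p0 : forall x, I01 x -> 0 < p x) (q0 : forall x, I01 x -> 0 < q x).
Hypotheses (cot1_ge0 : 0 <= cot1 th1) (cot2_ge0 : 0 <= cot2 th2).
Hypothesis eb : eigenbasis th1 th2 p q lam phi.
Let lam0 n : 0 < lam n := lam_gt0 eb n.
Local Notation a_fun := (a_fun th2 p qt).
Local Notation b_fun := (b_fun th2).

Lemma id_I01_continuous : {within @I01 R, continuous (fun x => x)}.
Proof. by apply: continuous_subspaceT => x; exact: cvg_id. Qed.

Lemma sqr_I01_continuous : {within @I01 R, continuous (fun x => x ^+ 2)}.
Proof. by apply: continuous_subspaceT => x; exact: exprn_continuous. Qed.

Lemma b_fun_L2 : L2 b_fun.
Proof.
have := L2Z (- (cos th2 + 2 * sin th2)^-1) (within_I01_L2 sqr_I01_continuous).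
by apply: L2_ext => x _; rewrite /Defs.b_fun; ring.
Qed.

Lemma a_fun_L2 : L2 a_fun.
Proof.
have [pp cDp] := C2_wderiv pC2.
have L1 := L2Z 2 (wderiv_L2 pp).
have L2' := L2Z 2 (L2_continuousM id_I01_continuous (within_I01_L2 cDp)).
have L3 := L2_continuousM sqr_I01_continuous (within_I01_L2 qtC).
have := L2Z (cos th2 + 2 * sin th2)^-1 (L2B (L2D L1 L2') L3).
by apply: L2_ext => x _; rewrite /Defs.a_fun; ring.
Qed.

Variables (N0 : nat) (K : 'rV[R]_N0) (L : 'cV[R]_N0).
Local Notation A0 := (A0 qc lam N0).
Local Notation B0 := (B0 th2 p qt qc lam phi N0).
Local Notation C0 := (C0 phi N0).

Lemma lam_ge0th n : lam 0 <= lam n.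
Proof. by case: n => // n; exact/ltW/(lam_increasing eb). Qed.

(** The quotient beta_n / lambda_n equals a_n / lambda_n + (-1 + qc / lambda_n) b_n, with bounded
    coefficients, so Bessel's inequality for a and b bounds the sum of squares uniformly in N. *)
Lemma B1t_bounded : exists2 M, 0 <= M & forall N, (N0 <= N)%N ->
  dot (B1t th2 p qt qc lam phi N0 N) (B1t th2 p qt qc lam phi N0 N) <= M.
Proof.
pose l := lam 0; have l0 : 0 < l := lam0 0.
pose k := (1 + `|qc| / l) ^+ 2.
exists (2 * (l^-1 ^+ 2 * sqnorm a_fun) + 2 * (k * sqnorm b_fun)).
  by rewrite addr_ge0// mulr_ge0// mulr_ge0 ?sqr_ge0 ?sqnorm_ge0.
move=> N NN; rewrite dotE.
rewrite (eq_bigr (fun i : 'I_(N - N0) => (beta_ th2 p qt qc lam phi (i + N0)%N / lam (i + N0)%N) ^+ 2)); last first.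
  by move=> i _; rewrite mxE addnC expr2.
rewrite -(big_mkord xpredT (fun i => (beta_ th2 p qt qc lam phi (i + N0)%N / lam (i + N0)%N) ^+ 2)).
rewrite -(@big_addn _ _ _ 0 N N0 xpredT (fun n => (beta_ th2 p qt qc lam phi n / lam n) ^+ 2)) add0n.
rewrite (@le_trans _ _ (\sum_(N0 <= n < N) (2 * (l^-1 ^+ 2 * fc phi a_fun n ^+ 2) + 2 * (k * fc phi b_fun n ^+ 2))))//.
  apply: ler_sum => n _; rewrite /beta_ /a_ /b_ -!/(fc phi _ _).
  have ln0 := lam0 n; have lln : l <= lam n := lam_ge0th n.
  have il : (lam n)^-1 <= l^-1 by rewrite lef_pV2.
  rewrite (_ : _ / lam n = (lam n)^-1 * fc phi a_fun n + (-1 + qc / lam n) * fc phi b_fun n); last first.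
    by field; rewrite gt_eqF.
  set u := _ * _; set v := _ * fc phi b_fun n.
  rewrite (@le_trans _ _ (2 * u ^+ 2 + 2 * v ^+ 2))//.
    by have := sqr_ge0 (u - v); lra.
  apply: lerD; rewrite ler_wpM2l//.
    rewrite /u exprMn ler_wpM2r ?sqr_ge0//.
    by rewrite ler_sqr ?nnegrE ?invr_ge0 ?(ltW ln0) ?(ltW l0).
  rewrite /v exprMn ler_wpM2r ?sqr_ge0// /k.
  have q1 : `|-1 + qc / lam n| <= 1 + `|qc| / l.
    rewrite (le_trans (ler_normD _ _))// normrN1 lerD2l normrM ler_wpM2l//.
    by rewrite gtr0_norm ?invr_gt0.
  rewrite -(real_normK (num_real (-1 + qc / lam n))).
  by rewrite ler_sqr ?nnegrE// (le_trans _ q1).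
rewrite big_split /= -!mulr_sumr; apply: lerD; rewrite ler_wpM2l// ler_wpM2l ?sqr_ge0//.
  apply: le_trans (bessel eb N a_fun_L2).
  by rewrite [leRHS](big_cat_nat (n := N0) (p := N))//= lerDr sumr_ge0// => n _; exact: sqr_ge0.
apply: le_trans (bessel eb N b_fun_L2).
by rewrite [leRHS](big_cat_nat (n := N0) (p := N))//= lerDr sumr_ge0// => n _; exact: sqr_ge0.
Qed.

(** The squared entries of [C1t] are terms of the convergent trace series; hence a bound independent
    of N. *)
Lemma C1t_bounded : exists2 M, 0 <= M & forall N (e : 'cV[R]_(N - N0)), (N0 <= N)%N ->
  (C1t lam phi N0 N *m e) 0 0 ^+ 2 <= M * dot e e.
Proof.
have [C CP] := trace_series_bounded pC2 qC sin1 cos2_sin2 p0 q0 cot1_ge0 cot2_ge0 eb.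
exists C; first by have := CP 0%N 0%N; rewrite big_geq.
move=> N e NN; rewrite (_ : (_ *m e) 0 0 = dot (C1t lam phi N0 N)^T e); last first.
  by rewrite /dot trmxK.
rewrite (le_trans (dot_cs _ _))// ler_wpM2r ?dot_ge0//.
apply: le_trans (CP N0 N); rewrite dotE.
rewrite (eq_bigr (fun i : 'I_(N - N0) => `|phi (i + N0)%N 0| ^+ 2 / lam (i + N0)%N)).
  rewrite -(big_mkord xpredT (fun i => `|phi (i + N0)%N 0| ^+ 2 / lam (i + N0)%N)).
  by rewrite -(@big_addn _ _ _ 0 N N0 xpredT (fun n => `|phi n 0| ^+ 2 / lam n)) add0n.
move=> i _; rewrite !mxE addnC -expr2 expr_div_n sqr_sqrtr ?(ltW (lam0 _))//.
by rewrite real_normK ?num_real.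
Qed.

Lemma A1_dissipative (delta kap : R) N (x : 'cV[R]_(N - N0)) :
  (forall n, (N0 <= n)%N -> - lam n + qc <= - (delta + kap)) ->
  2 * dot x (A1 qc lam N0 N *m x) + 2 * delta * dot x x <= - (2 * kap) * dot x x.
Proof.
move=> H; suff : dot x (A1 qc lam N0 N *m x) <= - (delta + kap) * dot x x by lra.
rewrite !dotE mulr_sumr ler_sum// => i _; rewrite mul_diag_mx !mxE.
have := ler_wpM2r (sqr_ge0 (x i 0)) (H (N0 + i)%N (leq_addr _ _)).
by rewrite expr2; lra.
Qed.

Variables (delta kphi Mphi : R).
Hypotheses (N0_gt0 : (0 < N0)%N).
Hypothesis lam_gap : forall n, (N0 <= n)%N -> - lam n + qc < - delta.
Hypothesis specA : spectrum_lt (A0 + kphi *: (B0 *m K)) (- delta).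
Hypothesis specC : spectrum_lt (A0 - L *m C0) (- delta).
Local Notation adt := (adot th2 p qt qc lam phi K L kphi).
Local Notation bdt := (bdot qc lam phi L).
Local Notation zdt := (zdot th2 p qt qc lam phi K kphi).
Local Notation edt := (edot qc lam).
Local Notation Acl := (A0 + kphi *: (B0 *m K)).

Lemma adotE N a b (e : 'cV[R]_(N - N0)) zeta psi :
  adt a b e zeta psi = Acl *m a + L *m C0 *m b
    + ((C1t lam phi N0 N *m e) 0 0 + zeta) *: L + psi *: B0.
Proof.
rewrite /adot [C1t lam phi N0 N *m e]mx11_scalar mul_mx_scalar !mxE eqxx mulr1n.
by rewrite scalerDl !addrA mulmxA.
Qed.

Lemma bdotE N b (e : 'cV[R]_(N - N0)) zeta :
  bdt b e zeta = (A0 - L *m C0) *m b - ((C1t lam phi N0 N *m e) 0 0 + zeta) *: L.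
Proof.
rewrite /bdot [C1t lam phi N0 N *m e]mx11_scalar mul_mx_scalar !mxE eqxx mulr1n.
by rewrite scalerDl opprD addrA.
Qed.

Lemma zdotE N a (z : 'cV[R]_(N - N0)) psi :
  zdt a z psi = A1 qc lam N0 N *m z
    + (kphi * (K *m a) 0 0 + psi) *: B1t th2 p qt qc lam phi N0 N.
Proof.
rewrite /zdot [K *m a]mx11_scalar mul_mx_scalar !mxE eqxx mulr1n scalerA.
by rewrite scalerDl addrCA addrA.
Qed.

Lemma sqr_add2 (x y : R) : (x + y) ^+ 2 <= 2 * x ^+ 2 + 2 * y ^+ 2.
Proof. by have := sqr_ge0 (x - y); lra. Qed.

(** This controls E^T E uniformly in N: the fast modes enter [adot] only through the scalar
    [C1t *m e]. *)
Lemma Kadot_bounded : exists2 G, 0 <= G &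
  forall N a b (e : 'cV[R]_(N - N0)) zeta psi, (N0 <= N)%N ->
  (K *m adt a b e zeta psi) 0 0 ^+ 2
  <= G * (dot a a + dot b b + dot e e + zeta ^+ 2 + psi ^+ 2).
Proof.
have [MC MC0 MCP] := C1t_bounded.
pose k1 := frob (K *m Acl); pose k2 := frob (K *m (L *m C0)).
pose k3 := (K *m L) 0 0 ^+ 2; pose k4 := (K *m B0) 0 0 ^+ 2.
have [h1 h2] : 0 <= k1 /\ 0 <= k2 by split; exact: frob_ge0.
have [h3 h4] : 0 <= k3 /\ 0 <= k4 by split; exact: sqr_ge0.
exists (4 * (k1 + k2 + k3 * (2 * MC + 2) + k4)).
  by rewrite mulr_ge0// !addr_ge0// mulr_ge0// addr_ge0// mulr_ge0.
move=> N a b e zeta psi NN; rewrite adotE !mulmxDr -!scalemxAr 2!mulmxA.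
have := MCP N e NN; set s := (C1t lam phi N0 N *m e) 0 0 => sM.
rewrite [X in X ^+ 2](_ : _ = (K *m Acl *m a) 0 0 + (K *m (L *m C0) *m b) 0 0
    + (s + zeta) * (K *m L) 0 0 + psi * (K *m B0) 0 0); last first.
  by rewrite !mxE.
have e1 : (K *m Acl *m a) 0 0 ^+ 2 <= k1 * dot a a.
  by rewrite (le_trans _ (dot_mulmx_le _ _))// dotE big_ord1 expr2.
have e2 : (K *m (L *m C0) *m b) 0 0 ^+ 2 <= k2 * dot b b.
  by rewrite (le_trans _ (dot_mulmx_le _ _))// dotE big_ord1 expr2.
have e3 : ((s + zeta) * (K *m L) 0 0) ^+ 2 <= k3 * (2 * (MC * dot e e) + 2 * zeta ^+ 2).
  rewrite exprMn mulrC ler_wpM2l// (le_trans (sqr_add2 _ _))// lerD2r ler_wpM2l//.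
have e4 : (psi * (K *m B0) 0 0) ^+ 2 = k4 * psi ^+ 2 by rewrite exprMn mulrC.
move: e1 e2 e3 e4.
move: ((K *m Acl *m a) 0 0) ((K *m (L *m C0) *m b) 0 0) ((s + zeta) * (K *m L) 0 0)
  (psi * (K *m B0) 0 0) => x y w v.
have := dot_ge0 a; have := dot_ge0 b; have := dot_ge0 e.
have := sqr_ge0 zeta; have := sqr_ge0 psi.
move: (dot a a) (dot b b) (dot e e) (zeta ^+ 2) (psi ^+ 2) => da db de z2 p2.
move=> p20 z20 de0 db0 da0 e1 e2 e3 e4.
have sq4 : (x + y + w + v) ^+ 2 <= 4 * (x ^+ 2 + y ^+ 2 + w ^+ 2 + v ^+ 2).
  have := sqr_ge0 (x - y); have := sqr_ge0 (w - v).
  have := sqr_ge0 (x - w); have := sqr_ge0 (x - v).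
  have := sqr_ge0 (y - w); have := sqr_ge0 (y - v); lra.
rewrite (le_trans sq4)// -mulrA ler_wpM2l//.
rewrite (@le_trans _ _ (k1 * da + k2 * db + k3 * (2 * (MC * de) + 2 * z2) + k4 * p2))//.
  by rewrite e4; lra.
pose S := da + db + de + z2 + p2.
have [S1 S2] : da <= S /\ db <= S by rewrite /S; lra.
have [S3 S4] : p2 <= S /\ MC * de + z2 <= (MC + 1) * S by rewrite /S; split; [lra|nra].
have := ler_wpM2l h1 S1; have := ler_wpM2l h2 S2; have := ler_wpM2l h4 S3.
have := ler_wpM2l h3 S4; rewrite -/S; lra.
Qed.

(* The observer error is driven only by the fast modes, the control state by
   both, and the fast control modes by the control state: along this cascade
   the weights [mu], [eta], 1, [eps] are decreasing enough to absorb the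
   coupling terms. *)
Lemma lyapunov_design : exists Pa Pb eta eps mu beta tau c,
  [/\ posdef Pa, posdef Pb, [/\ 0 < eta, 0 < eps & 0 < mu], [/\ 0 < beta, 0 < tau & 0 < c] &
  forall N a b (z e : 'cV[R]_(N - N0)) zeta psi, (N0 <= N)%N ->
  2 * dot (Pa *m a) (adt a b e zeta psi) + 2 * delta * qf Pa a
  + eta * (2 * dot (Pb *m b) (bdt b e zeta) + 2 * delta * qf Pb b)
  + eps * (2 * dot z (zdt a z psi) + 2 * delta * dot z z)
  + mu * (2 * dot e (edt e) + 2 * delta * dot e e)
  - beta * zeta ^+ 2 - tau * psi ^+ 2
  <= - c * (dot a a + dot b b + dot e e + zeta ^+ 2 + psi ^+ 2)].
Proof.
have [MC MC0 MCP] := C1t_bounded.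
have [MB MB0 MBP] := B1t_bounded.
have [Pa [Pad [ca ca0 caP]]] := lyapunov N0_gt0 specA.
have [Pb [Pbd [cb cb0 cbP]]] := lyapunov N0_gt0 specC.
(* The decay reserve of the fast modes beyond [delta]; the first of them, of index [N0], is the
   slowest. *)
pose kap : R := lam N0 - qc - delta.
have kap0 : 0 < kap by have := lam_gap (leqnn N0); rewrite /kap; lra.
have lam_kap n : (N0 <= n)%N -> - lam n + qc <= - (delta + kap).
  move=> nN; rewrite /kap; have : lam N0 <= lam n.
    by move: nN; rewrite leq_eqVlt => /predU1P[->//|/(lam_increasing eb)/ltW].
  lra.
(* Weights for Young's inequality: each of the three cross terms of the a-block costs ca/8 |a|^2,
   and the single one of the b-block costs cb/2 |b|^2. *)
pose ta : R := ca / (8 * (frob Pa + 1)); pose tb : R := cb / (2 * (frob Pb + 1)).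
have fa0 := frob_ge0 Pa; have fb0 := frob_ge0 Pb.
have ta0 : 0 < ta by rewrite divr_gt0// mulr_gt0// ltr_wpDl.
have tb0 : 0 < tb by rewrite divr_gt0// mulr_gt0// ltr_wpDl.
have taP a : ta * dot (Pa *m a) (Pa *m a) <= ca / 8 * dot a a.
  rewrite (@le_trans _ _ (ta * (frob Pa * dot a a)))//.
    by rewrite ler_wpM2l ?(ltW ta0)// dot_mulmx_le.
  rewrite mulrA ler_wpM2r ?dot_ge0// /ta.
  rewrite (_ : _ * frob Pa = ca / 8 * (frob Pa / (frob Pa + 1))); last first.
    by field; rewrite gt_eqF// ltr_wpDl.
  rewrite ler_piMr//; first by rewrite divr_ge0// ltW.
  by rewrite ler_pdivrMr ?ltr_wpDl// mul1r lerDl.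
have tbP b : tb * dot (Pb *m b) (Pb *m b) <= cb / 2 * dot b b.
  rewrite (@le_trans _ _ (tb * (frob Pb * dot b b)))//.
    by rewrite ler_wpM2l ?(ltW tb0)// dot_mulmx_le.
  rewrite mulrA ler_wpM2r ?dot_ge0// /tb.
  rewrite (_ : _ * frob Pb = cb / 2 * (frob Pb / (frob Pb + 1))); last first.
    by field; rewrite gt_eqF// ltr_wpDl.
  rewrite ler_piMr//; first by rewrite divr_ge0// ltW.
  by rewrite ler_pdivrMr ?ltr_wpDl// mul1r lerDl.
clearbody kap ta tb.
pose f1 : R := ta^-1 * frob (L *m C0); pose lL : R := dot L L; pose bB : R := dot B0 B0.
have ita0 : 0 <= ta^-1 by rewrite invr_ge0 ltW.
have itb0 : 0 <= tb^-1 by rewrite invr_ge0 ltW.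
have lL0 : 0 <= lL by exact: dot_ge0.
have bB0 : 0 <= bB by exact: dot_ge0.
have f10 : 0 <= f1 by rewrite mulr_ge0 ?frob_ge0// invr_ge0 ltW.
pose fK := frob K; have fK0 : 0 <= fK := frob_ge0 K.
(* The gain from a to the fast control modes. Weighted by [eps] it takes one more share ca/8, which
   leaves - ca/2 |a|^2. *)
pose X : R := MB * (2 * kphi ^+ 2 * fK) / kap.
have X0 : 0 <= X.
  apply: divr_ge0; last exact: ltW.
  by apply: mulr_ge0 => //; apply: mulr_ge0 => //; apply: mulr_ge0; [|exact: sqr_ge0].
pose eps : R := ca / (8 * (X + 1)).
have eps0 : 0 < eps by rewrite divr_gt0// mulr_gt0// ltr_wpDl.
have epsX : eps * X <= ca / 8.
  rewrite /eps (_ : _ * X = ca / 8 * (X / (X + 1))); last first.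
    by field; rewrite gt_eqF// ltr_wpDl.
  rewrite ler_piMr//; first by rewrite divr_ge0// ltW.
  by rewrite ler_pdivrMr ?ltr_wpDl// mul1r lerDl.
clearbody eps.
(* After the weighting the b-block dissipates 2 (f1 + 1) |b|^2, more than the coupling f1 |b|^2 that
   it causes in the a-block. *)
pose eta : R := 4 * (f1 + 1) / cb.
have eta0 : 0 < eta by rewrite divr_gt0// mulr_gt0// ltr_wpDl.
have etacb : eta * cb = 4 * (f1 + 1) by rewrite /eta divfK// gt_eqF.
clearbody eta.
(* The total coefficient of (s + zeta)^2, where [s] is the output of e. Since s^2 <= MC |e|^2, the
   weight [mu] pays for the part in e and [beta] for the part in zeta. *)
pose W : R := ta^-1 * lL + eta * (tb^-1 * lL).
have [eta0' eps0'] := (ltW eta0, ltW eps0).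
have W0 : 0 <= W.
  by rewrite addr_ge0// !mulr_ge0.
pose mu : R := (2 * MC * W + 1) / kap.
have mu0 : 0 < mu by rewrite divr_gt0// ltr_wpDl// !mulr_ge0.
have mukap : mu * kap = 2 * MC * W + 1 by rewrite /mu divfK// gt_eqF.
clearbody mu.
pose beta : R := 2 * W + 1.
pose tau : R := ta^-1 * bB + 2 * (eps * MB / kap) + 1.
have tau1 : 0 <= ta^-1 * bB + 2 * (eps * MB / kap).
  rewrite addr_ge0//; first exact: mulr_ge0.
  by rewrite mulr_ge0// divr_ge0// ?(ltW kap0)// mulr_ge0.
pose c : R := Num.min (ca / 2) 1.
have c0 : 0 < c by rewrite lt_min ltr01 divr_gt0.
have [c1 c2] : c <= ca / 2 /\ c <= 1 by rewrite !ge_min !lexx orbT.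
exists Pa, Pb, eta, eps, mu, beta, tau, c; split=> //.
  by split=> //; rewrite ltr_wpDl// mulr_ge0.
move=> N a b z e zeta psi NN.
rewrite adotE bdotE zdotE; have := MCP N e NN.
set s := (C1t lam phi N0 N *m e) 0 0 => sM; set g := kphi * _ + psi.
have s2 : (s + zeta) ^+ 2 <= 2 * (MC * dot e e) + 2 * zeta ^+ 2.
  by rewrite (le_trans (sqr_add2 _ _))// lerD2r ler_wpM2l.
have g2 : g ^+ 2 <= 2 * (kphi ^+ 2 * (fK * dot a a)) + 2 * psi ^+ 2.
  rewrite (le_trans (sqr_add2 _ _))// lerD2r ler_wpM2l// exprMn ler_wpM2l ?sqr_ge0//.
  by rewrite (le_trans _ (dot_mulmx_le _ _))// [leRHS]dotE big_ord1 expr2.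
have I1 : 2 * dot (Pa *m a) (Acl *m a + L *m C0 *m b + (s + zeta) *: L + psi *: B0)
    + 2 * delta * qf Pa a
    <= - ca * dot a a + 3 * (ca / 8 * dot a a) + f1 * dot b b
      + ta^-1 * lL * (s + zeta) ^+ 2 + ta^-1 * bB * psi ^+ 2.
  have h1 := caP a; have h2 := taP a.
  have h3 := dot_young (Pa *m a) (L *m C0 *m b) ta0.
  have h4 := dot_young (Pa *m a) ((s + zeta) *: L) ta0.
  have h5 := dot_young (Pa *m a) (psi *: B0) ta0.
  have h6 : ta^-1 * dot (L *m C0 *m b) (L *m C0 *m b) <= f1 * dot b b.
    by rewrite /f1 -mulrA ler_wpM2l ?invr_ge0 ?(ltW ta0)// dot_mulmx_le.
  rewrite dotZl dotZr in h4; rewrite dotZl dotZr in h5.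
  rewrite dotZr in h4; rewrite dotZr in h5.
  by rewrite !dotDr !dotZr /lL /bB; lra.
have I2 : 2 * dot (Pb *m b) ((A0 - L *m C0) *m b - (s + zeta) *: L) + 2 * delta * qf Pb b
    <= - (cb / 2) * dot b b + tb^-1 * lL * (s + zeta) ^+ 2.
  have h1 := cbP b; have h2 := tbP b.
  have h4 := dot_young (Pb *m b) (- ((s + zeta) *: L)) tb0.
  rewrite dotNl !dotNr opprK dotZl !dotZr in h4.
  by rewrite dotDr dotNr dotZr /lL; lra.
have I3 : 2 * dot z (A1 qc lam N0 N *m z + g *: B1t th2 p qt qc lam phi N0 N) + 2 * delta * dot z z
    <= - kap * dot z z + kap^-1 * (g ^+ 2 * MB).
  have h1 := A1_dissipative z lam_kap.
  have h2 := dot_young z (g *: B1t th2 p qt qc lam phi N0 N) kap0.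
  have h3 : kap^-1 * (g ^+ 2 * dot (B1t th2 p qt qc lam phi N0 N) (B1t th2 p qt qc lam phi N0 N))
      <= kap^-1 * (g ^+ 2 * MB).
    by rewrite ler_wpM2l ?invr_ge0 ?(ltW kap0)// ler_wpM2l ?sqr_ge0// MBP.
  rewrite dotZl !dotZr in h2.
  by rewrite dotDr dotZr; lra.
have I4 : 2 * dot e (edt e) + 2 * delta * dot e e <= - (2 * kap) * dot e e.
  exact: A1_dissipative lam_kap.
have A0' := dot_ge0 a; have B0' := dot_ge0 b; have E0' := dot_ge0 e.
have Z0' := dot_ge0 z; have z20 := sqr_ge0 zeta; have p20 := sqr_ge0 psi.
have J2 := ler_wpM2l (ltW eta0) I2; have J3 := ler_wpM2l (ltW eps0) I3.
have J4 := ler_wpM2l (ltW mu0) I4.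
have K2 : eta * (- (cb / 2) * dot b b + tb^-1 * lL * (s + zeta) ^+ 2)
    = - 2 * (f1 + 1) * dot b b + eta * (tb^-1 * lL) * (s + zeta) ^+ 2.
  rewrite [LHS](_ : _ = - (eta * cb / 2) * dot b b + eta * (tb^-1 * lL) * (s + zeta) ^+ 2).
    by rewrite etacb; congr (_ * _ + _); field.
  by move: (dot b b) (tb^-1) => B T; ring.
have K3 : eps * (- kap * dot z z + kap^-1 * (g ^+ 2 * MB))
    <= ca / 8 * dot a a + 2 * (eps * MB / kap) * psi ^+ 2.
  have e1 : eps * (kap^-1 * (g ^+ 2 * MB)) <= eps * (kap^-1 *
      ((2 * (kphi ^+ 2 * (fK * dot a a)) + 2 * psi ^+ 2) * MB)).
    by rewrite ler_wpM2l ?(ltW eps0)// ler_wpM2l ?invr_ge0 ?(ltW kap0)// ler_wpM2r.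
  have e2 : eps * (kap^-1 * ((2 * (kphi ^+ 2 * (fK * dot a a)) + 2 * psi ^+ 2) * MB))
      = eps * X * dot a a + 2 * (eps * MB / kap) * psi ^+ 2 by rewrite /X; ring.
  have e3 := ler_wpM2r A0' epsX.
  have e4 : 0 <= eps * (kap * dot z z) by rewrite !mulr_ge0// ltW.
  by rewrite mulrDr mulNr mulrN; lra.
have K4 : mu * (- (2 * kap) * dot e e) = - 2 * (2 * MC * W + 1) * dot e e.
  rewrite [LHS](_ : _ = - 2 * (mu * kap) * dot e e); last by ring.
  by rewrite mukap.
have K5 := ler_wpM2l W0 s2.
have K6 : W * (s + zeta) ^+ 2 = ta^-1 * lL * (s + zeta) ^+ 2 + eta * (tb^-1 * lL) * (s + zeta) ^+ 2.
  by rewrite -mulrDl.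
have K7 : tau * psi ^+ 2 = ta^-1 * bB * psi ^+ 2 + 2 * (eps * MB / kap) * psi ^+ 2 + psi ^+ 2.
  by rewrite /tau mulrDl mulrDl mul1r.
have c1A := ler_wpM2r A0' c1; have c2B := ler_wpM2r B0' c2; have c2E := ler_wpM2r E0' c2.
have c2z := ler_wpM2r z20 c2; have c2p := ler_wpM2r p20 c2.
have fB0 : 0 <= f1 * dot b b by exact: mulr_ge0.
have ME0 : 0 <= MC * W * dot e e by rewrite !mulr_ge0.
have K8 : W * (2 * (MC * dot e e) + 2 * zeta ^+ 2) = 2 * (MC * W * dot e e) + 2 * (W * zeta ^+ 2).
  by ring.
have K9 : beta * zeta ^+ 2 = 2 * (W * zeta ^+ 2) + zeta ^+ 2 by rewrite /beta; ring.
have K10 : - 2 * (2 * MC * W + 1) * dot e e = - 4 * (MC * W * dot e e) - 2 * dot e e by ring.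
have K11 : - 2 * (f1 + 1) * dot b b = - 2 * (f1 * dot b b) - 2 * dot b b by ring.
rewrite K2 K11 in J2; rewrite K4 K10 in J4; rewrite K6 K8 in K5.
exact: cascade_sum I1 J2 J3 K3 J4 K5 K9 K7 c1A c2B c2E c2z c2p A0' fB0 ME0 B0' E0'.
Qed.

Definition lyap_mx m Pa Pb (eta eps mu : R) : 'M[R]_(N0 + N0 + (m + m)) :=
  block_mx (block_mx Pa 0 0 (eta *: Pb)) 0 0 (block_mx eps%:M 0 0 mu%:M).

Lemma lyap_mx_state N Pa Pb eta eps mu (a b : 'cV[R]_N0) (z e : 'cV[R]_(N - N0)) :
  lyap_mx (N - N0) Pa Pb eta eps mu *m state a b z e
  = state (Pa *m a) (eta *: (Pb *m b)) (eps *: z) (mu *: e).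
Proof.
rewrite /lyap_mx /state !mul_block_col !mul0mx !addr0 !add0r -scalemxAl.
by rewrite !mul_scalar_mx.
Qed.

Lemma dot_state m (a b c d : 'cV[R]_N0) (z e y f : 'cV[R]_m) :
  dot (col_mx (col_mx a b) (col_mx z e)) (col_mx (col_mx c d) (col_mx y f))
  = dot a c + dot b d + dot z y + dot e f.
Proof. by rewrite !dot_col !addrA. Qed.

Lemma lyap_mx_posdef N Pa Pb eta eps mu : posdef Pa -> posdef Pb ->
  0 < eta -> 0 < eps -> 0 < mu -> posdef (lyap_mx (N - N0) Pa Pb eta eps mu).
Proof.
move=> Pad Pbd eta0 eps0 mu0; split.
  rewrite /lyap_mx !tr_block_mx !trmx0 !tr_scalar_mx linearZ /=.
  by case: Pad => -> _; case: Pbd => -> _.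
have [c1 c10 c1P] := posdef_lower Pad; have [c2 c20 c2P] := posdef_lower Pbd.
pose c : R := Num.min (Num.min c1 (eta * c2)) (Num.min eps mu).
have c0 : 0 < c by rewrite !lt_min c10 eps0 mu0 mulr_gt0.
have [[le1 le2] [le3 le4]] : (c <= c1 /\ c <= eta * c2) /\ (c <= eps /\ c <= mu).
  by rewrite /c !ge_min !lexx !orbT.
move=> x x0; rewrite -/(qf _ x).
have xE : x = state (usubmx (usubmx x)) (dsubmx (usubmx x)) (usubmx (dsubmx x)) (dsubmx (dsubmx x)).
  by rewrite /state !vsubmxK.
have dx : 0 < dot x x.
  rewrite lt_neqAle dot_ge0 andbT eq_sym; apply/negP => /eqP /dot_eq0 /eqP.
  by rewrite (negbTE x0).
rewrite (lt_le_trans (mulr_gt0 c0 dx))// xE.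
move: (usubmx (usubmx x)) (dsubmx (usubmx x)) (usubmx (dsubmx x)) (dsubmx (dsubmx x)) => a b z e.
rewrite qf_dot lyap_mx_state !dot_state !dotZr -!qf_dot.
have h1 := ler_wpM2r (dot_ge0 a) le1; have h2 := ler_wpM2r (dot_ge0 b) le2.
have h3 := ler_wpM2r (dot_ge0 z) le3; have h4 := ler_wpM2r (dot_ge0 e) le4.
have h5 := c1P a; have h6 := ler_wpM2l (ltW eta0) (c2P b).
lra.
Qed.

Lemma feasible_large : 0 < kphi ->
  exists2 Dkphi : R, 0 < Dkphi < kphi & exists N1 : nat, forall N, (N1 <= N)%N ->
    (N0 + 1 <= N)%N -> feasible th2 p qt qc lam phi K L delta kphi Dkphi Mphi N.
Proof.
move=> k0; have h32 : 3 / 2 < 2 :> R by lra.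
have [Pa [Pb [eta [eps [mu [beta [tau [c]]]]]]]] := lyapunov_design.
case=> Pad Pbd [eta0 eps0 mu0] [beta0 tau0 c0] H.
have [G G0 GP] := Kadot_bounded.
have [C CP] := fine_M_phi_bounded pC2 qC sin1 cos2_sin2 p0 q0 cot1_ge0 cot2_ge0 eb.
pose fK : R := frob K; have fK0 : 0 <= fK := frob_ge0 K.
have tf0 : 0 < tau * fK + 1 by rewrite ltr_wpDl// mulr_ge0// ltW.
(* The bound kphi/2 keeps [Dk] below [kphi], the bound 1 gives Dk^2 <= Dk, and the last one makes
   tau Dk^2 |K|^2 at most c/4. None of them involves N. *)
pose Dk : R := Num.min (kphi / 2) (Num.min 1 (c / (4 * (tau * fK + 1)))).
have Dk0 : 0 < Dk by rewrite !lt_min ltr01 !divr_gt0// mulr_gt0.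
have [Dk1 [Dk2 Dk3]] : Dk <= kphi / 2 /\ (Dk <= 1 /\ Dk <= c / (4 * (tau * fK + 1))).
  by rewrite /Dk !ge_min !lexx !orbT.
have DkP : tau * Dk ^+ 2 * fK <= c / 4.
  have h1 : Dk ^+ 2 <= Dk by rewrite expr2 ler_piMr// ltW.
  have h2 : (tau * fK + 1) * Dk <= c / 4.
    rewrite mulrC -ler_pdivlMr//; apply: le_trans Dk3 _.
    by rewrite le_eqVlt; apply/orP; left; apply/eqP; field; rewrite gt_eqF.
  have h3 := ler_wpM2l (mulr_ge0 (ltW tau0) fK0) h1.
  exact: gain_margin h2 h3 Dk0.
exists Dk; first by rewrite Dk0 (le_lt_trans Dk1)// ltr_pdivrMr// ltr_pMr// ltr1n.
(* Thresholds under which the remainders of a and b fit into their shares of the margin; large N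
   reaches them. *)
pose ea : R := c / (8 * (kphi ^+ 2 * fK + 1)); pose ebb : R := c / (8 * (Mphi ^+ 2 * G + 1)).
have kf0 : 0 < kphi ^+ 2 * fK + 1 by rewrite ltr_wpDl// mulr_ge0// sqr_ge0.
have mg0 : 0 < Mphi ^+ 2 * G + 1 by rewrite ltr_wpDl// mulr_ge0// sqr_ge0.
have ea0 : 0 < ea by rewrite divr_gt0// mulr_gt0.
have eb0 : 0 < ebb by rewrite divr_gt0// mulr_gt0.
have hra := sqnorm_remainder_cvg0 eb a_fun_L2; have hrb := sqnorm_remainder_cvg0 eb b_fun_L2.
have [N1 _ N1P] : \forall N \near \oo,
    [/\ sqnorm (remainder phi N a_fun) <= ea, sqnorm (remainder phi N b_fun) <= ebb &
    4 * (qc + delta) + 2 * (beta * C) <= lam N].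
  move/cvgr0Pnorm_le : hra => /(_ _ ea0) na; move/cvgr0Pnorm_le : hrb => /(_ _ eb0) nb.
  have /cvgryPge /(_ (4 * (qc + delta) + 2 * (beta * C))) nl := lam_pinfty eb.
  near=> N; split.
  - by rewrite (le_trans (ler_norm _))//; near: N.
  - by rewrite (le_trans (ler_norm _))//; near: N.
  - by near: N.
exists N1 => N N1N N0N; have NN : (N0 <= N)%N by rewrite (leq_trans _ N0N)// leq_addr.
have [raN rbN lamN] := N1P N N1N.
have ra0 := sqnorm_ge0 (remainder phi N a_fun); have rb0 := sqnorm_ge0 (remainder phi N b_fun).
have Pd := lyap_mx_posdef N Pad Pbd eta0 eps0 mu0.
exists (lyap_mx (N - N0) Pa Pb eta eps mu), 2, beta, 1, tau; split=> //.
- split; first by apply: Theta1_sym; case: Pd.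
  move=> x; rewrite -/(qf _ x) [x]col_mx11 [usubmx x]col_mx11.
  rewrite -[usubmx (usubmx x)](vsubmxK) -[usubmx (usubmx (usubmx x))](vsubmxK).
  rewrite -[dsubmx (usubmx (usubmx x))](vsubmxK).
  move: (usubmx (usubmx (usubmx (usubmx x)))) (dsubmx (usubmx (usubmx (usubmx x)))).
  move: (usubmx (dsubmx (usubmx (usubmx x)))) (dsubmx (dsubmx (usubmx (usubmx x)))).
  move: (dsubmx (usubmx x) 0 0) (dsubmx x 0 0) => zeta psi z e a b.
  rewrite -/(state a b z e) Theta1_qf; last by case: Pd.
  rewrite qf_dot lyap_mx_state !dot_state !dotZl !dotZr -(qf_dot Pa) -(qf_dot Pb) !mulr1.
  have h1 := H N a b z e zeta psi NN; have h2 := GP N a b e zeta psi NN.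
  have h3 : (K *m a) 0 0 ^+ 2 <= fK * dot a a.
    by rewrite (le_trans _ (dot_mulmx_le _ _))// [leRHS]dotE big_ord1 expr2.
  have da0 := dot_ge0 a; have db0 := dot_ge0 b; have de0 := dot_ge0 e.
  have z20 := sqr_ge0 zeta; have p20 := sqr_ge0 psi.
  have S0 : 0 <= dot a a + dot b b + dot e e + zeta ^+ 2 + psi ^+ 2 by rewrite !addr_ge0.
  have g1 : (2 * kphi ^+ 2 * sqnorm (remainder phi N a_fun) + tau * Dk ^+ 2)
      * (K *m a) 0 0 ^+ 2 <= c / 2 * dot a a.
    have t0 : 0 <= 2 * kphi ^+ 2 * sqnorm (remainder phi N a_fun) + tau * Dk ^+ 2.
      exact: gain_ge0 (ltW tau0) ra0.
    rewrite (le_trans (ler_wpM2l t0 h3))// mulrA ler_wpM2r//.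
    have : (kphi ^+ 2 * fK + 1) * sqnorm (remainder phi N a_fun) <= c / 8.
      rewrite mulrC -ler_pdivlMr//; apply: le_trans raN _.
      by rewrite /ea le_eqVlt; apply/orP; left; apply/eqP; field; rewrite gt_eqF.
    exact: sector_margin DkP ra0.
  have g2 : 2 * sqnorm (remainder phi N a_fun) <= c / 4.
    apply: (@remainder_margin _ c (kphi ^+ 2 * fK)) => //; first by rewrite mulr_ge0// sqr_ge0.
    rewrite mulrC -ler_pdivlMr//; apply: le_trans raN _.
    by rewrite /ea le_eqVlt; apply/orP; left; apply/eqP; field; rewrite gt_eqF.
  have g3 : 2 * sqnorm (remainder phi N b_fun) * Mphi ^+ 2 * (K *m adt a b e zeta psi) 0 0 ^+ 2
      <= c / 4 * (dot a a + dot b b + dot e e + zeta ^+ 2 + psi ^+ 2).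
    have t0 : 0 <= 2 * sqnorm (remainder phi N b_fun) * Mphi ^+ 2 by rewrite mulr_ge0 ?sqr_ge0// mulr_ge0.
    rewrite (le_trans (ler_wpM2l t0 h2))// mulrA ler_wpM2r//.
    have : (Mphi ^+ 2 * G + 1) * sqnorm (remainder phi N b_fun) <= c / 8.
      rewrite mulrC -ler_pdivlMr//; apply: le_trans rbN _.
      by rewrite /ebb le_eqVlt; apply/orP; left; apply/eqP; field; rewrite gt_eqF.
    exact: slope_margin rb0.
  have g4 := ler_wpM2r p20 g2.
  have [g5 g6] : 0 <= c * dot b b /\ 0 <= c * dot e e by split; rewrite mulr_ge0// ltW.
  have [g7 g8] : 0 <= c * zeta ^+ 2 /\ 0 <= c * psi ^+ 2 by split; rewrite mulr_ge0// ltW.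
  have g9 : 0 <= c * dot a a by rewrite mulr_ge0// ltW.
  have := quadratic_sum_le0 h1 g1 g3 g4 g5 g6 g7 g8 g9.
  exact.
- by rewrite /Theta2; exact: theta2_margin (ler_wpM2l (ltW beta0) (CP N)) lamN.
Unshelve. all: by end_near. Qed.

End Feasibility.

(** * Evolution of the closed loop *)

Section DifferenceQuotients.
Context {R : realType}.
Implicit Types (f : R -> R) (t l : R).

Lemma quotient_is_derive f t l :
  (s - t)^-1 * (f s - f t) @[s --> t^'] --> l -> is_derive t (1 : R) f l.
Proof.
move=> fl.
have : h^-1 *: (f (h *: (1 : R) + t) - f t) @[h --> (0:R)^'] --> l.
  apply/cvgrPdist_lt => e e0.
  move/cvgrPdist_lt : fl => /(_ _ e0); rewrite near_withinE => near_e.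
  have {}near_e : \forall s \near t, s != t -> `|l - (s - t)^-1 * (f s - f t)| < e by [].
  rewrite (near_shift 0) subr0 in near_e.
  rewrite near_withinE; near=> h => h0.
  have : h + t != t -> `|l - (h + t - t)^-1 * (f (h + t) - f t)| < e by near: h.
  rewrite -subr_eq0 addrK => /(_ h0).
  by rewrite /GRing.scale /= mulr1.
move=> cl; apply: DeriveDef; first by apply/cvg_ex; exists l.
exact: cvg_lim cl.
Unshelve. all: by end_near. Qed.

Lemma is_derive_quotient f t l : is_derive t (1 : R) f l ->
  (s - t)^-1 * (f s - f t) @[s --> t^'] --> l.
Proof.
move=> [df <-]; move: df => /cvgrPdist_lt H; apply/cvgrPdist_lt => e e0.
have := H _ e0; rewrite near_withinE => near_e.
have {}near_e : \forall h \near (0 : R), h != 0 ->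
    `|'D_1 f t - h^-1 *: (f (h *: (1 : R) + t) - f t)| < e by [].
rewrite (near_shift t) sub0r in near_e.
rewrite near_withinE; near=> s => st.
have : s + - t != 0 ->
    `|'D_1 f t - (s - t)^-1 *: (f ((s - t) *: (1 : R) + t) - f t)| < e by near: s.
by rewrite subr_eq0 => /(_ st); rewrite /GRing.scale /= mulr1 subrK.
Unshelve. all: by end_near. Qed.

Lemma is_derive_cstM (c : R) f t l : is_derive t (1 : R) f l ->
  is_derive t (1 : R) (fun s => c * f s) (c * l).
Proof. by move=> fl; exact: (is_deriveZ c fl). Qed.

Lemma is_derive_continuous f t l : is_derive t (1 : R) f l -> f s @[s --> t] --> f t.
Proof.
by move=> [df _]; apply: differentiable_continuous; apply/derivable1_diffP.
Qed.

End DifferenceQuotients.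

Section L2Limits.
Context {R : realType}.
Local Notation mu := (@lebesgue_measure R).
Implicit Types (f g h : R -> R).

Lemma L2_cvgD (U : Type) (F : set_system U) {FF : Filter F} (f h : U -> R -> R) g k :
  L2_cvg F f g -> L2_cvg F h k -> L2_cvg F (fun u x => f u x + h u x) (fun x => g x + k x).
Proof.
move=> [Lf Lg fg] [Lh Lk hk]; split; [|exact: L2D|].
  by apply: filterS2 Lf Lh => u; exact: L2D.
have c0 : 2 * sqnorm (fun x => f u x - g x) + 2 * sqnorm (fun x => h u x - k x)
    @[u --> F] --> (0 : R).
  rewrite (_ : 0 = 2 * 0 + 2 * 0); last by ring.
  by apply: cvgD; apply: cvgMr.
apply: squeeze_cvgr (@cvg_cst _ (0 : R) _ F _) c0.
near=> u; rewrite sqnorm_ge0 /=.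
have Lfu : L2 (fun x => f u x - g x) by apply: L2B => //; near: u.
have Lhu : L2 (fun x => h u x - k x) by apply: L2B => //; near: u.
apply: le_trans (sqnormD_le Lfu Lhu); rewrite le_eqVlt; apply/orP; left; apply/eqP.
by apply: sqnorm_ext => x _; ring.
Unshelve. all: by end_near. Qed.

Lemma L2_cvgZ (U : Type) (F : set_system U) {FF : Filter F} (c : U -> R) (d : R) g :
  L2 g -> c u @[u --> F] --> d -> L2_cvg F (fun u x => c u * g x) (fun x => d * g x).
Proof.
move=> Lg cd; split; [by apply: nearW => u; exact: L2Z|exact: L2Z|].
rewrite (_ : (fun u => _) = (fun u => (c u - d) ^+ 2 * sqnorm g)); last first.
  apply/funext => u; rewrite -sqnormZ//; apply: sqnorm_ext => x _; ring.
rewrite (_ : 0 = (d - d) ^+ 2 * sqnorm g); last by rewrite subrr expr0n mul0r.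
apply: cvgMl; apply: (@cvgM _ _ F) => //; apply: cvgB => //; exact: cvg_cst.
Qed.

Lemma L2_cvg_ae (U : Type) (F : set_system U) {FF : Filter F} (f : U -> R -> R) g g' :
  L2_cvg F f g -> L2 g' -> {ae mu, forall x, I01 x -> g x = g' x} -> L2_cvg F f g'.
Proof.
move=> [Lf Lg fg] Lg' gg'; split=> //.
apply: cvg_trans fg; apply: near_eq_cvg; near=> u.
have Lfu : L2 (f u) by near: u.
rewrite !sqnormB//; congr (_ - 2 * _ + _).
  exact: inner_ae.
by rewrite /sqnorm (inner_ae Lg Lg Lg')// innerC (inner_ae Lg' Lg Lg')// innerC.
Unshelve. all: by end_near. Qed.

Lemma L2_cvg_near (U : Type) (F : set_system U) {FF : Filter F} (f h : U -> R -> R) g :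
  (\forall u \near F, forall x, f u x = h u x) -> L2_cvg F f g -> L2_cvg F h g.
Proof.
move=> fh [Lf Lg fg]; split=> //.
  by apply: filterS2 fh Lf => u /funext ->.
apply: cvg_trans fg; apply: near_eq_cvg; apply: filterS fh => u fhu.
by apply: sqnorm_ext => x _; rewrite fhu.
Qed.

Lemma L2_cvg_filter (U : Type) (F G : set_system U) (f : U -> R -> R) g :
  G `=>` F -> L2_cvg F f g -> L2_cvg G f g.
Proof. by move=> GF [Lf Lg fg]; split=> //; [exact: GF|apply: cvg_trans fg => A /GF]. Qed.

End L2Limits.

(** * Quadratic consequences of the sector and slope conditions *)

Section SectorNonlinearity.
Context {R : realType}.
Local Notation mu := (@lebesgue_measure R).
Variables (kphi Dkphi Mphi : R) (vphi : R -> R).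
Hypotheses (Dk0 : 0 < Dkphi) (Dkk : Dkphi < kphi).
Hypothesis adm : admissible kphi Dkphi Mphi vphi.

Lemma sqr_le_of_norm (x y : R) : `|x| <= `|y| -> x ^+ 2 <= y ^+ 2.
Proof.
by rewrite -(real_normK (num_real x)) -(real_normK (num_real y)) ler_sqr ?nnegrE.
Qed.

Lemma adm_is_derive x : is_derive x (1 : R) vphi (derive1 vphi x).
Proof. by apply: DeriveDef; [exact: adm_derivable adm x|rewrite derive1E]. Qed.

Lemma adm_cvg x : vphi s @[s --> x] --> vphi x.
Proof. exact: is_derive_continuous (adm_is_derive x). Qed.

Lemma adm_sector_sqr x : x != 0 -> (vphi x - kphi * x) ^+ 2 <= Dkphi ^+ 2 * x ^+ 2.
Proof.
move=> x0; have /andP[l u] := adm_sector adm x.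
rewrite -exprMn; apply: sqr_le_of_norm; rewrite normrM (gtr0_norm Dk0).
move: x0; rewrite neq_lt => /orP[x0|x0]; move: l u.
  rewrite ltr0_sg// ltr0_norm// => l u; rewrite ler_norml; lra.
rewrite gtr0_sg// gtr0_norm// => l u; rewrite ler_norml; lra.
Qed.

(** At 0 the sector inequality reads 0 <= 0 <= 0, because [Num.sg 0 = 0]; the value is recovered by
    continuity from the inequality at nonzero points. *)
Lemma adm0 : vphi 0 = 0.
Proof.
have c1 : vphi x - kphi * x @[x --> (0 : R)^'] --> vphi 0 - kphi * 0.
  apply: cvg_within_filter; apply: cvgB; first exact: adm_cvg.
  by apply: cvgMr; exact: cvg_id.
have c2 : vphi x - kphi * x @[x --> (0 : R)^'] --> (0 : R).
  apply: (@cvg0_sqr _ _ _ _ _ (fun x => x ^+ 2) (Dkphi ^+ 2)).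
    by rewrite near_withinE; apply: nearW => x x0; rewrite [leRHS]mulrC; exact: adm_sector_sqr.
  have : x ^+ 2 @[x --> (0 : R)^'] --> (0 : R) ^+ 2.
    by apply: cvg_within_filter; exact: exprn_continuous.
  by rewrite expr0n.
have := cvg_unique _ c1 c2; rewrite mulr0 subr0; exact.
Qed.

Lemma adm_sectorP x : (vphi x - kphi * x) ^+ 2 <= Dkphi ^+ 2 * x ^+ 2.
Proof.
have [->|] := eqVneq x 0; last exact: adm_sector_sqr.
by rewrite adm0 !mulr0 subrr expr0n mulr0.
Qed.

Lemma adm_growth x : vphi x ^+ 2 <= 4 * kphi ^+ 2 * x ^+ 2.
Proof.
have h := adm_sectorP x; have k0 : 0 < kphi := lt_trans Dk0 Dkk.
have s2 : (vphi x) ^+ 2 <= 2 * (vphi x - kphi * x) ^+ 2 + 2 * (kphi * x) ^+ 2.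
  by rewrite -{1}(subrK (kphi * x) (vphi x)) sqr_add2.
have : Dkphi ^+ 2 * x ^+ 2 <= kphi ^+ 2 * x ^+ 2.
  by rewrite ler_wpM2r ?sqr_ge0// ler_sqr ?nnegrE ?(ltW k0) ?(ltW Dk0)// ltW.
by rewrite exprMn in s2; lra.
Qed.

(** The essential bound becomes pointwise by continuity: a violation at [x] would persist on a ball,
    which has positive measure. *)
Lemma adm_slope x : (derive1 vphi x) ^+ 2 <= Mphi ^+ 2.
Proof.
suff : `|derive1 vphi x| <= Mphi.
  by move=> h; apply: sqr_le_of_norm; apply: le_trans h (ler_norm _).
rewrite leNgt; apply/negP => hx.
have : \forall y \near x, Mphi < `|derive1 vphi y|.
  have c : `|derive1 vphi y| @[y --> x] --> `|derive1 vphi x|.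
    by apply: cvg_norm; exact: adm_continuous adm x.
  exact: cvgr_gt c _ hx.
move=> /nbhs_ballP[e /= e0 be].
have := adm_bound adm; rewrite unlock /=.
rewrite ifT; last by rewrite -[X in mu X]set_itvNyy lebesgue_measure_itv /= ltry.
move=> /ess_supP [A [mA muA sA]].
have sub : ball x e `<=` A.
  move=> y /be hy; apply: sA => /=; rewrite lee_fin; apply/negP; rewrite -ltNge//.
have mb : measurable (ball x e : set R) by exact: measurable_ball.
have le0 : (mu (ball x e : set R) <= 0)%E.
  by have := le_measure mu (mem_set mb) (mem_set mA) sub; rewrite [X in (_ <= X)%E]muA.
have eb : mu (ball x e : set R) = (e *+ 2)%:E by exact: lebesgue_measure_ball (ltW e0).
by move: le0; rewrite eb lee_fin leNgt pmulrn_rgt0// e0.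
Qed.

End SectorNonlinearity.

(** * Lifting of the boundary input by b *)

Section Homogenization.
Context {R : realType}.
Local Notation mu := (@lebesgue_measure R).
Variables (th1 th2 : R) (p q qt : R -> R) (qc : R) (lam : nat -> R) (phi : nat -> R -> R).
Hypotheses (pC2 : C2_01 p) (qC : {within I01, continuous q}) (qtC : {within I01, continuous qt}).
Hypothesis (qtE : forall x, I01 x -> qt x = q x - qc).
Local Notation a_fun := (a_fun th2 p qt).
Local Notation b_fun := (b_fun th2).
Local Notation d := (cos th2 + 2 * sin th2).

Lemma b_fun_quot x : quot01 b_fun x (- (2 * x / d)).
Proof.
have c : - ((y + x) / d) @[y --> within I01 x^'] --> - (2 * x / d).
  rewrite (_ : 2 * x = x + x); last by ring.
  apply: cvgN; apply: cvgMl; apply: cvgD; last exact: cvg_cst.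
  by do 2 apply: cvg_within_filter; exact: cvg_id.
apply: cvg_trans c; apply: near_eq_cvg; apply/near_I01.
apply: (@filterE _ (nbhs x)) => y yx _.
rewrite /Defs.b_fun; have [->|d0] := eqVneq d 0; first by rewrite invr0 !mulr0 oppr0 subrr mul0r.
by field; rewrite subr_eq0 yx d0.
Qed.

Lemma b_fun_H2 : H2 b_fun /\ is_wderiv (D01 b_fun) (fun=> - (2 / d)).
Proof.
have Db x : I01 x -> derivable01 b_fun x /\ D01 b_fun x = - (2 * x / d).
  by move=> Ix; exact: quot01_D01 Ix (@b_fun_quot x).
have W : is_wderiv (D01 b_fun) (fun=> - (2 / d)).
  split=> [|x Ix]; first exact: L2_cst.
  rewrite (Db x Ix).2 (Db 0 I010).2 Rintegral_cst//.
  rewrite -[X in fine X]/(mu (`[0, x]%classic)) lebesgue_measure_itv /= lte_fin.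
  move: Ix; rewrite I01E => /andP[x0 _].
  move: x0; rewrite le_eqVlt => /predU1P[<-|x0]; first by rewrite ltxx /=; ring.
  by rewrite x0 /=; ring.
split=> //; split; last by exists (fun=> - (2 / d)).
by move=> x Ix; case: (Db x Ix).
Qed.

Lemma b_fun0 : b_fun 0 = 0.
Proof. by rewrite /Defs.b_fun expr0n mul0r oppr0. Qed.

(* [a] is minus the image of [b] under the spatial operator. *)
Lemma pde_homogenized w v : domA th1 th2 w ->
  {ae mu, forall x, I01 x ->
     wD (fun y => p y * D01 (fun s => w s - b_fun s * v) y) x - qt x * (w x - b_fun x * v)
     = - opA p q w x + qc * w x + v * a_fun x}.
Proof.
move=> [Hw _ _]; have [Hb bD] := b_fun_H2; have [pp _] := C2_wderiv pC2.
have [Hv Dv] := H2Z (- v) Hb; have [Hz Dz] := H2D Hw Hv.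
have zE : (fun s => w s - b_fun s * v) = (fun s => w s + - v * b_fun s).
  by apply/funext => s; ring.
rewrite zE; have W1 := flux_wderiv pC2 Hz; have W2 := flux_wderiv pC2 Hw.
have W3 := is_wderivD W2 (is_wderivZ (- v) (is_wderivM pp bD)).
have {}W3 := is_wderiv_ext (f2 := fun x => p x * D01 (fun s => w s + - v * b_fun s) x)
  _ (fun x _ => erefl) W3.
have := wderiv_unique W1 (W3 _); have H : forall x, I01 x ->
    p x * D01 w x + - v * (p x * D01 b_fun x) = p x * D01 (fun s => w s + - v * b_fun s) x.
  by move=> x Ix; rewrite Dz// Dv//; ring.
move=> /(_ H); apply: (@filterS _ _ (ae_filter_ringOfSetsType mu)) => x + Ix => /(_ Ix) ->.
have Dbx : D01 b_fun x = - (2 * x / d) by have [] := quot01_D01 Ix (@b_fun_quot x).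
by rewrite /opA /Defs.a_fun Dbx (qtE Ix) /Defs.b_fun; ring.
Qed.

End Homogenization.

Section ClosedLoopTrajectory.
Context {R : realType}.
Local Notation mu := (@lebesgue_measure R).
Variables (th1 th2 : R) (p q qt : R -> R) (qc : R) (lam : nat -> R) (phi : nat -> R -> R).
Hypotheses (pC2 : C2_01 p) (qC : {within I01, continuous q}) (qtC : {within I01, continuous qt}).
Hypotheses (sin1 : sin th1 != 0) (cos2_sin2 : sin th2 = 0 -> cos th2 != 0).
Hypothesis (qtE : forall x, I01 x -> qt x = q x - qc).
Hypothesis eb : eigenbasis th1 th2 p q lam phi.
Local Notation a_fun := (a_fun th2 p qt).
Local Notation b_fun := (b_fun th2).
Variables (N0 N : nat) (K : 'rV[R]_N0) (L : 'cV[R]_N0) (NN : (N0 <= N)%N).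
Variables (kphi Dkphi Mphi : R) (vphi : R -> R).
Hypotheses (adm : admissible kphi Dkphi Mphi vphi).
Variables (T : \bar R) (z : R -> R -> R) (zh : nat -> R -> R).
Hypothesis sol : classical_solution th1 th2 p qt q qc lam phi K L N vphi T z zh.
Local Notation w := (homogenized th2 K vphi z zh).
Local Notation u := (control K zh).
Local Notation v t := (vphi (u t)).

Lemma inside_upto t : inside T t -> upto T t.
Proof. by move=> [t0 tT]; split=> //; exact: ltW. Qed.

Lemma inside_near t : inside T t -> \forall s \near t, inside T s.
Proof.
move=> [t0 tT]; have n0 : \forall s \near t, 0 < s by exact: (cvgr_gt t cvg_id).
have nT : \forall s \near t, (s%:E < T)%E.
  move: tT; case: (T) => [r|_|//].
    rewrite lte_fin => tr; have : \forall s \near t, s < r by exact: (cvgr_lt t cvg_id _ tr).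
    by apply: filterS => s; rewrite lte_fin.
  by apply: (@filterE _ (nbhs t)) => s; exact: ltry.
by apply: filterS2 n0 nT.
Qed.

Lemma zh_is_derive n t : (n < N)%N -> inside T t -> is_derive t (1 : R) (zh n) (derive1 (zh n) t).
Proof.
move=> nN It; have [D _] := sol_zh_C1 sol nN.
by apply: DeriveDef; [exact: D|rewrite derive1E].
Qed.

Lemma control_is_derive t : inside T t ->
  is_derive t (1 : R) u (\sum_(k < N0) K 0 k * derive1 (zh k) t).
Proof.
move=> It; rewrite (_ : u = \sum_(k < N0) (fun s => K 0 k * zh k s)); last first.
  by apply/funext => s; rewrite fct_sumE.
apply: is_derive_sum => k; apply: is_derive_cstM.
by apply: zh_is_derive => //; exact: leq_trans NN.
Qed.

Definition vdot t : R := derive1 vphi (u t) * (\sum_(k < N0) K 0 k * derive1 (zh k) t).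

Lemma v_is_derive t : inside T t -> is_derive t (1 : R) (vphi \o u) (vdot t).
Proof.
move=> It; have := control_is_derive It; have := adm_is_derive adm (u t) => h1 h2.
exact: is_derive1_comp.
Qed.

Lemma w0E t : w t 0 = z t 0.
Proof. by rewrite /homogenized b_fun0 mul0r addr0. Qed.

Definition wdot t : R -> R :=
  fun x => - opA p q (w t) x + qc * w t x + v t * a_fun x + vdot t * b_fun x.

Lemma wdot_L2 t : inside T t -> L2 (wdot t).
Proof.
move=> /inside_upto /(sol_w_domA sol) Dw.
have La := @a_fun_L2 R th2 p qt pC2 qtC; have Lb := @b_fun_L2 R th2.
apply: L2D; last exact: L2Z.
apply: L2D; last exact: L2Z.
by apply: L2D; [apply/L2N/(domA_opA_L2 pC2 qC)/Dw|apply/L2Z/(domA_L2 Dw)].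
Qed.

(** The plant equation differentiates z and the chain rule differentiates b v; by [pde_homogenized]
    the sum agrees with [wdot] almost everywhere. *)
Lemma homogenized_derivative t : inside T t -> L2_derivative w t (wdot t).
Proof.
move=> It; have Dw := sol_w_domA sol (inside_upto It).
have Lb := @b_fun_L2 R th2.
have [_ Lg _] := sol_pde sol It.
pose g x := wD (fun y => p y * D01 (z t) y) x - qt x * z t x + vdot t * b_fun x.
have H : L2_derivative w t g.
  apply: L2_cvg_near (L2_cvgD (sol_pde sol It) (L2_cvgZ Lb (is_derive_quotient (v_is_derive It)))).
  apply: nearW => s x; rewrite /homogenized /=; ring.
apply: L2_cvg_ae H (wdot_L2 It) _.
have := pde_homogenized pC2 qtE (v t) Dw.
have zE : (fun s => w t s - b_fun s * v t) = z t.
  by apply/funext => s; rewrite /homogenized addrK.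
rewrite zE; apply: (@filterS _ _ (ae_filter_ringOfSetsType mu)) => x H1 Ix.
have := H1 Ix; have := congr1 (fun f => f x) zE => /= -> h1.
by rewrite /g h1.
Qed.

Lemma fc_w_is_derive n t : inside T t ->
  is_derive t (1 : R) (fun s => fc phi (w s) n) (fc phi (wdot t) n).
Proof.
move=> It; apply: quotient_is_derive.
have Lp : L2 (phi n) := domA_L2 (phi_domA eb n).
have Dw s : inside T s -> L2 (w s) by move=> /inside_upto/(sol_w_domA sol)/domA_L2.
apply: cvg_trans (L2_cvg_inner (homogenized_derivative It) Lp).
apply: near_eq_cvg; rewrite near_withinE.
near=> s => _; have Is : inside T s by near: s; exact: inside_near.
by rewrite innerZl ?innerBl//; [exact: Dw|exact: Dw|apply: L2B; exact: Dw].
Unshelve. all: by end_near. Qed.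

(** By symmetry, <A w(s), w(s)> - <A w(t), w(t)> = <A w(s) + A w(t), w(s) - w(t)>. The difference
    quotient thus needs only the continuity of A w and the L^2 derivative of w, never a derivative
    of A w. *)
Lemma form_w_is_derive t : inside T t ->
  is_derive t (1 : R) (fun s => form p q (w s)) (2 * inner (opA p q (w t)) (wdot t)).
Proof.
move=> It; apply: quotient_is_derive.
have D s : inside T s -> domA th1 th2 (w s) by move=> /inside_upto/(sol_w_domA sol).
have LA s : inside T s -> L2 (opA p q (w s)) by move=> /D/(domA_opA_L2 pC2 qC).
have Lw s : inside T s -> L2 (w s) by move=> /D/domA_L2.
have cA : L2_cvg t^' (fun s => opA p q (w s)) (opA p q (w t)).
  apply: L2_cvg_filter (sol_Aw_C0 sol It) => A At.
  have {}At : \forall s \near t, inside T s -> A s by exact: At.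
  suff : \forall s \near t, s != t -> A s by [].
  by apply: filterS2 (inside_near It) At => s Is /(_ Is) As _.
(* The factor 1 puts the constant summand into the shape required by [L2_cvgZ]. *)
have cA2 : L2_cvg t^' (fun s x => opA p q (w s) x + 1 * opA p q (w t) x)
    (fun x => opA p q (w t) x + 1 * opA p q (w t) x).
  by apply: L2_cvgD cA _; apply: L2_cvgZ; [exact: LA|exact: cvg_cst].
rewrite (_ : 2 * _ = inner (fun x => opA p q (w t) x + 1 * opA p q (w t) x) (wdot t)); last first.
  rewrite -innerZl; [|exact: LA|exact: wdot_L2].
  by apply: inner_ext => // x _; ring.
apply: cvg_trans (L2_cvg_innerM cA2 (homogenized_derivative It)).
apply: near_eq_cvg; rewrite near_withinE.
near=> s => _; have Is : inside T s by near: s; exact: inside_near.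
rewrite innerZr; [|by apply: L2B; exact: Lw|by apply: L2D; [exact: LA|apply/L2Z/LA]].
congr (_ * _); rewrite innerBr; [|exact: Lw|exact: Lw|by apply: L2D; [exact: LA|apply/L2Z/LA]].
have LA1 := LA s Is; have LA2 := L2Z 1 (LA t It).
rewrite (innerDl LA1 LA2 (Lw s Is)) (innerDl LA1 LA2 (Lw t It)).
rewrite (innerZl 1 (LA t It) (Lw s Is)) (innerZl 1 (LA t It) (Lw t It)).
rewrite (opA_sym pC2 qC sin1 cos2_sin2 (D _ Is) (D _ It)) /form; ring.
Unshelve. all: by end_near. Qed.

End ClosedLoopTrajectory.

Section ColumnCurves.
Context {R : realType}.
Implicit Types (t : R).

Definition is_derive_col n (x : R -> 'cV[R]_n) t (d : 'cV[R]_n) :=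
  forall i, is_derive t (1 : R) (fun s => x s i 0) (d i 0).

Lemma is_derive_col_mx m n (x : R -> 'cV[R]_m) (y : R -> 'cV[R]_n) t d e :
  is_derive_col x t d -> is_derive_col y t e ->
  is_derive_col (fun s => col_mx (x s) (y s)) t (col_mx d e).
Proof.
move=> xd ye i; case: (split_ordP i) => j ->.
  by rewrite col_mxEu; under eq_fun do rewrite col_mxEu; exact: xd.
by rewrite col_mxEd; under eq_fun do rewrite col_mxEd; exact: ye.
Qed.

Lemma qf_is_derive n (P : 'M[R]_n) (x : R -> 'cV[R]_n) t d : P^T = P ->
  is_derive_col x t d -> is_derive t (1 : R) (fun s => qf P (x s)) (2 * dot (P *m x t) d).
Proof.
move=> PT xd.
have qfE s : qf P (x s) = \sum_i \sum_j P i j * (x s i 0 * x s j 0).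
  rewrite qf_dot dotE; apply: eq_bigr => i _; rewrite mxE mulr_sumr.
  by apply: eq_bigr => j _; ring.
rewrite (_ : (fun s => qf P (x s)) = \sum_i \sum_j (fun s => P i j * (x s i 0 * x s j 0))); last first.
  apply/funext => s; rewrite qfE fct_sumE; apply: eq_bigr => i _.
  by rewrite fct_sumE.
rewrite (_ : 2 * _ = \sum_i \sum_j P i j * (x t i 0 * d j 0 + x t j 0 * d i 0)).
  apply: is_derive_sum => i; apply: is_derive_sum => j; apply: is_derive_cstM.
  exact: is_deriveM (xd i) (xd j).
rewrite (_ : 2 * _ = dot (P *m x t) d + dot d (P *m x t)); last by rewrite [dot d _]dotC; ring.
rewrite [dot (P *m x t) d]dot_mulmxl PT !dotE -big_split; apply: eq_bigr => i _.
rewrite /= !mxE !mulr_sumr -big_split; apply: eq_bigr => j _ /=; ring.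
Qed.

Lemma cvg_sumf (I : Type) (r : seq I) (F : set_system R) {FF : Filter F} (f : I -> R -> R) (l : I -> R) :
  (forall i, f i s @[s --> F] --> l i) ->
  \sum_(i <- r) f i s @[s --> F] --> \sum_(i <- r) l i.
Proof.
move=> fl; elim: r => [|i r IH].
  by rewrite big_nil; under eq_fun do rewrite big_nil; exact: cvg_cst.
by rewrite big_cons; under eq_fun do rewrite big_cons; exact: cvgD.
Qed.

Lemma qf_cvg n (P : 'M[R]_n) (F : set_system R) {FF : Filter F} (x : R -> 'cV[R]_n) (y : 'cV[R]_n) :
  (forall i, x s i 0 @[s --> F] --> y i 0) -> qf P (x s) @[s --> F] --> qf P y.
Proof.
move=> xy.
have qfE z : qf P z = \sum_i \sum_j P i j * (z i 0 * z j 0).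
  rewrite qf_dot dotE; apply: eq_bigr => i _; rewrite mxE mulr_sumr.
  by apply: eq_bigr => j _; ring.
rewrite qfE; under eq_fun do rewrite qfE.
apply: cvg_sumf => i; apply: cvg_sumf => j; apply: cvgMr.
exact: cvgM.
Qed.

Lemma col_mx_cvg m n (F : set_system R) {FF : Filter F} (x : R -> 'cV[R]_m) (y : R -> 'cV[R]_n)
    (a : 'cV[R]_m) (b : 'cV[R]_n) :
  (forall i, x s i 0 @[s --> F] --> a i 0) -> (forall i, y s i 0 @[s --> F] --> b i 0) ->
  forall i, col_mx (x s) (y s) i 0 @[s --> F] --> col_mx a b i 0.
Proof.
move=> xa yb i; case: (split_ordP i) => j ->.
  by rewrite col_mxEu; under eq_fun do rewrite col_mxEu; exact: xa.
by rewrite col_mxEd; under eq_fun do rewrite col_mxEd; exact: yb.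
Qed.

Lemma sum_is_derive (m n : nat) (f : nat -> R -> R) (df : nat -> R) t :
  (forall k, (m <= k < n)%N -> is_derive t (1 : R) (f k) (df k)) ->
  is_derive t (1 : R) (fun s => \sum_(m <= k < n) f k s) (\sum_(m <= k < n) df k).
Proof.
move=> H; have e (g : nat -> R) : \sum_(m <= k < n) g k = \sum_(i < n - m) g (i + m)%N.
  by rewrite -{1}[m]add0n big_addn big_mkord.
rewrite e; under eq_fun do rewrite e.
rewrite (_ : (fun s => _) = \sum_(i < n - m) f (i + m)%N); last first.
  by apply/funext => s; rewrite fct_sumE.
apply: is_derive_sum => i; apply: H; rewrite leq_addl /=.
by rewrite addnC -ltn_subRL.
Qed.

End ColumnCurves.

Section TailTerm.
Context {R : realFieldType}.

(* Young's inequality with weight [al], once for each of the inputs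
   [k * s * a], [r * a] and [vd * b]. *)
Lemma tail_term (al l lN x qc k s r vd a b : R) : 3 / 2 < al -> 0 < l -> lN <= l ->
  2 * (l * x * (- l * x + qc * x + (k * s + r) * a + vd * b))
  <= 2 * (- (1 - 3 / (2 * al)) * lN + qc) * (l * x ^+ 2)
     + (al * (k ^+ 2 * s ^+ 2 + r ^+ 2) * a ^+ 2 + al * vd ^+ 2 * b ^+ 2).
Proof.
move=> al32 l0 lNl; have al0 : 0 < al by lra.
have young y : 2 * (l * x * y) <= l ^+ 2 * x ^+ 2 / al + al * y ^+ 2.
  rewrite -subr_ge0 (_ : _ - _ = al * (l * x / al - y) ^+ 2); last first.
    by field; rewrite gt_eqF.
  by rewrite mulr_ge0 ?sqr_ge0// ltW.
have h1 := young (k * s * a); have h2 := young (r * a); have h3 := young (vd * b).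
have c0 : 0 <= 1 - 3 / (2 * al).
  by rewrite subr_ge0 ler_pdivrMr ?mulr_gt0//; lra.
have h4 : (1 - 3 / (2 * al)) * (lN * (l * x ^+ 2)) <= (1 - 3 / (2 * al)) * (l * (l * x ^+ 2)).
  by rewrite ler_wpM2l// ler_wpM2r// mulr_ge0 ?sqr_ge0// ltW.
have e : 3 * (l ^+ 2 * x ^+ 2 / al) = 2 * (3 / (2 * al) * (l * (l * x ^+ 2))).
  by field; rewrite gt_eqF.
lra.
Qed.

(** An S-procedure: the trace, sector and slope bounds enter with the multipliers [be], [ta] and
    [al * ga * rb], and the inequality on Theta_2 is multiplied by the tail [h]. *)
Lemma decay_sum (al be ga ta de k Dk M c lN qc Mp D Q dh h u2 z2 p2 vd2 kd2 ra rb : R) :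
  2 * D + 2 * de * Q + (al * ga * k ^+ 2 * ra + ta * Dk ^+ 2) * u2 - be * z2
    + (al * ga * ra - ta) * p2 + al * ga * rb * M ^+ 2 * kd2 <= 0 ->
  dh <= 2 * (- c * lN + qc) * h + (al * (k ^+ 2 * u2 + p2) * ra + al * vd2 * rb) ->
  2 * ga * (- c * lN + qc + de) + be * Mp <= 0 ->
  z2 <= Mp * h -> p2 <= Dk ^+ 2 * u2 -> vd2 <= M ^+ 2 * kd2 -> 0 <= h -> 0 <= rb ->
  0 < ga -> 0 < be -> 0 < ta -> 0 < al ->
  2 * D + ga * dh <= - (2 * de) * (Q + ga * h).
Proof.
move=> hQ hT hc hz hp hv h0 rb0 ga0 be0 ta0 al0.
have e1 := ler_wpM2l (ltW ga0) hT; have e2 := ler_wpM2l (ltW be0) hz.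
have e3 := ler_wpM2l (ltW ta0) hp.
have e4 := ler_wpM2l (mulr_ge0 (mulr_ge0 (ltW al0) (ltW ga0)) rb0) hv.
have e5 := ler_wpM2r h0 hc.
lra.
Qed.

End TailTerm.

Section NormArithmetic.
Context {R : realFieldType}.

Lemma lyap_lower_arith (H Hw v2 h S F SQ Z E al b1 hb kv cf2 : R) :
  H <= 2 * Hw + hb * v2 -> 2 * Hw <= cf2 * F -> hb * v2 <= hb * (kv * Z) ->
  al * S <= al * (b1 * SQ) -> 0 <= hb * kv * E ->
  F = h + S -> SQ = Z + E -> al = cf2 + 1 -> 0 <= E ->
  H + F + Z <= al * h + (al * b1 + (hb * kv + 1)) * SQ.
Proof. by move=> + + + + + FE SE aE; rewrite {}FE {}SE {}aE; lra. Qed.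

Lemma two_weights (x y a b s t : R) : x = a * t -> y <= b * s -> 0 <= a * s -> 0 <= b * t ->
  x + y <= (a + b) * (s + t).
Proof. lra. Qed.

Lemma lyap_upper_arith (Q al Z E Hw Hz sb v2 ga' h cf be hb kv : R) :
  Q <= al * Z + al * E -> al * E <= al * (3 * (Hw + sb * v2 + Z)) ->
  ga' * h <= ga' * (cf * Hw) -> (3 * al + ga' * cf) * Hw <= (3 * al + ga' * cf) * (2 * Hz + hb * v2) ->
  al * sb * v2 <= al * sb * (kv * Z) ->
  (3 * al + ga' * cf) * hb * v2 <= (3 * al + ga' * cf) * hb * (kv * Z) ->
  0 <= (al * (4 + 3 * (sb * kv)) + (3 * al + ga' * cf) * (hb * kv)) * Hz ->
  0 <= (3 * al + ga' * cf) * Z ->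
  Q + ga' * h <= (2 * (3 * al + ga' * cf)
    + (al * (4 + 3 * (sb * kv)) + (3 * al + ga' * cf) * (hb * kv))) * (Hz + Z).
Proof. lra. Qed.

End NormArithmetic.

(** * Decay of the Lyapunov functional along trajectories *)

Section LyapunovFunctional.
Context {R : realType}.
Local Notation mu := (@lebesgue_measure R).
Variables (th1 th2 : R) (p q qt : R -> R) (qc : R) (lam : nat -> R) (phi : nat -> R -> R).
Hypotheses (pC2 : C2_01 p) (qC : {within I01, continuous q}) (qtC : {within I01, continuous qt}).
Hypotheses (sin1 : sin th1 != 0) (cos2_sin2 : sin th2 = 0 -> cos th2 != 0).
Hypotheses (p0 : forall x, I01 x -> 0 < p x) (q0 : forall x, I01 x -> 0 < q x).
Hypotheses (cot1_ge0 : 0 <= cot1 th1) (cot2_ge0 : 0 <= cot2 th2).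
Hypothesis (qtE : forall x, I01 x -> qt x = q x - qc).
Hypothesis eb : eigenbasis th1 th2 p q lam phi.
Let lam0 n : 0 < lam n := lam_gt0 eb n.
Local Notation a_fun := (a_fun th2 p qt).
Local Notation b_fun := (b_fun th2).
Local Notation b_ := (b_ th2 phi).
Local Notation beta_ := (beta_ th2 p qt qc lam phi).
Variables (N0 N : nat) (K : 'rV[R]_N0) (L : 'cV[R]_N0) (NN : (N0 <= N)%N).
Variables (kphi Dkphi Mphi : R).
Hypotheses (Dk0 : 0 < Dkphi) (Dkk : Dkphi < kphi).
Variables (P : 'M[R]_(N0 + N0 + (N - N0 + (N - N0)))) (gamma : R).
Hypotheses (Pd : posdef P) (gamma0 : 0 < gamma).

Definition obs_err (w : R -> R) (v : R) (zh : nat -> R) n : R := fc phi w n - b_ n * v - zh n.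

Definition low (c : nat -> R) : 'cV[R]_N0 := \col_(i < N0) c i.
Definition high (c : nat -> R) : 'cV[R]_(N - N0) := \col_(i < N - N0) c (N0 + i)%N.

(** Dividing zhat_n by lambda_n turns beta_n into the entry of [B1t]; multiplying e_n by the square
    root of lambda_n turns phi_n(0) into the entry of [C1t]. *)
Definition lstate w v zh :=
  state (low zh) (low (obs_err w v zh)) (high (fun n => zh n / lam n))
    (high (fun n => Num.sqrt (lam n) * obs_err w v zh n)).

Definition lyap w v zh : R := qf P (lstate w v zh) + gamma * @htail _ p q lam phi N w.

Definition trace_rem w : R := w 0 - \sum_(0 <= n < N) fc phi w n * phi n 0.

Lemma low_gain zh : (K *m low zh) 0 0 = \sum_(k < N0) K 0 k * zh k.
Proof. by rewrite mxE; apply: eq_bigr => i _; rewrite mxE. Qed.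

Lemma sum_split_low (c : nat -> R) :
  \sum_(0 <= n < N) c n = \sum_(i < N0) c i + \sum_(i < N - N0) c (N0 + i)%N.
Proof.
rewrite (big_cat_nat (n := N0))//= big_mkord; congr (_ + _).
rewrite -{1}[N0]add0n big_addn big_mkord.
by apply: eq_bigr => i _; rewrite addnC.
Qed.

Lemma output_err w v zh :
  (C0 phi N0 *m low (obs_err w v zh)) 0 0
  + (C1t lam phi N0 N *m high (fun n => Num.sqrt (lam n) * obs_err w v zh n)) 0 0
  = \sum_(0 <= n < N) obs_err w v zh n * phi n 0.
Proof.
rewrite sum_split_low !mxE; congr (_ + _); apply: eq_bigr => i _; rewrite !mxE; first by rewrite mulrC.
have s0 : Num.sqrt (lam (N0 + i)%N) != 0 by rewrite gt_eqF// sqrtr_gt0.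
by move: (phi _ _) (obs_err _ _ _ _) (Num.sqrt _) s0 => x y r r0; field.
Qed.

(** Each coefficient of w is zhat_n + b_n v + e_n, so the estimated output misses the measured one
    by the observer errors and the tail trace. *)
Lemma observer_residual w v (zh : nat -> R) :
  \sum_(k < N) (zh k + b_ k * v) * phi k 0 - w 0
  = - (trace_rem w + \sum_(0 <= n < N) obs_err w v zh n * phi n 0).
Proof.
rewrite -(big_mkord xpredT (fun k => (zh k + b_ k * v) * phi k 0)) /trace_rem.
rewrite -addrA -sumrN -big_split /= opprD; rewrite addrC; congr (_ + _).
rewrite -sumrN; apply: eq_bigr => n _; rewrite /obs_err; ring.
Qed.

Local Notation A0 := (A0 qc lam N0).
Local Notation B0 := (B0 th2 p qt qc lam phi N0).
Local Notation adt := (adot th2 p qt qc lam phi K L kphi).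
Local Notation bdt := (bdot qc lam phi L).
Local Notation zdt := (zdot th2 p qt qc lam phi K kphi).
Local Notation edt := (edot qc lam).

Lemma diag_low (c : nat -> R) i : (A0 *m low c) i 0 = (- lam i + qc) * c i.
Proof. by rewrite /Defs.A0 mul_diag_mx !mxE. Qed.

Lemma adot_low w v (zh : nat -> R) psi i : v = kphi * (K *m low zh) 0 0 + psi ->
  adt (low zh) (low (obs_err w v zh)) (high (fun n => Num.sqrt (lam n) * obs_err w v zh n))
    (trace_rem w) psi i 0
  = (- lam i + qc) * zh i + beta_ i * v
    - L i 0 * (\sum_(k < N) (zh k + b_ k * v) * phi k 0 - w 0).
Proof.
move=> vE; rewrite observer_residual -output_err adotE mulmxDl -scalemxAl -(mulmxA B0) -(mulmxA L).
rewrite [K *m _]mx11_scalar [C0 phi N0 *m _]mx11_scalar.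
move: vE; set ka := (K *m _) 0 0; set cb := (C0 _ _ *m _) 0 0; set ce := (C1t _ _ _ _ *m _) 0 0.
rewrite !mul_mx_scalar => vE.
have := diag_low zh i; set Aa := A0 *m _; clearbody Aa => Aai; rewrite !mxE eqxx mulr1n Aai.
by move: vE; move: (beta_ i) => bi ->; ring.
Qed.

Lemma bdot_low w v (zh : nat -> R) i :
  bdt (low (obs_err w v zh)) (high (fun n => Num.sqrt (lam n) * obs_err w v zh n))
    (trace_rem w) i 0
  = (- lam i + qc) * obs_err w v zh i
    + L i 0 * (\sum_(k < N) (zh k + b_ k * v) * phi k 0 - w 0).
Proof.
rewrite observer_residual -output_err bdotE mulmxBl -(mulmxA L) [C0 phi N0 *m _]mx11_scalar.
set cb := (C0 _ _ *m _) 0 0; set ce := (C1t _ _ _ _ *m _) 0 0; rewrite mul_mx_scalar.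
have := diag_low (obs_err w v zh) i; set Aa := A0 *m _; clearbody Aa => Aai; rewrite !mxE eqxx mulr1n Aai; ring.
Qed.

Lemma zdot_high v zh psi i : v = kphi * (K *m low zh) 0 0 + psi ->
  zdt (low zh) (high (fun n => zh n / lam n)) psi i 0
  = (lam (N0 + i)%N)^-1 * ((- lam (N0 + i)%N + qc) * zh (N0 + i)%N + beta_ (N0 + i)%N * v).
Proof.
move=> vE; rewrite zdotE -vE /A1 mxE mul_diag_mx !mxE; ring.
Qed.

Lemma edot_high (c : nat -> R) i :
  edt (high (fun n => Num.sqrt (lam n) * c n)) i 0
  = Num.sqrt (lam (N0 + i)%N) * ((- lam (N0 + i)%N + qc) * c (N0 + i)%N).
Proof. by rewrite /edot /A1 mul_diag_mx !mxE; ring. Qed.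

Section AlongTrajectory.
Variables (vphi : R -> R).
Hypotheses (adm : admissible kphi Dkphi Mphi vphi).
Variables (T : \bar R) (z : R -> R -> R) (zh : nat -> R -> R).
Hypothesis sol : classical_solution th1 th2 p qt q qc lam phi K L N vphi T z zh.
Local Notation w := (homogenized th2 K vphi z zh).
Local Notation u := (control K zh).
Local Notation v t := (vphi (u t)).
Local Notation zt t := (fun n => zh n t).
Local Notation psi t := (v t - kphi * u t).
Local Notation wd := (wdot th2 p q qt qc K vphi z zh).
Local Notation vd := (vdot K vphi zh).

Lemma control_low t : u t = (K *m low (zt t)) 0 0.
Proof. by rewrite low_gain. Qed.

Lemma fc_wdot n t : inside T t ->
  fc phi (wd t) n = - lam n * fc phi (w t) n + qc * fc phi (w t) n
    + v t * a_ th2 p qt phi n + vd t * b_ n.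
Proof.
move=> It; have Dw := sol_w_domA sol (inside_upto It).
have Lw := domA_L2 Dw; have LA := domA_opA_L2 pC2 qC Dw.
have La := @a_fun_L2 R th2 p qt pC2 qtC; have Lb := @b_fun_L2 R th2.
have Lp : L2 (phi n) := domA_L2 (phi_domA eb n).
have LNA := L2N LA; have Lqw := L2Z qc Lw; have Lva := L2Z (v t) La; have Lvb := L2Z (vd t) Lb.
rewrite /wdot /fc (innerDl (L2D (L2D LNA Lqw) Lva) Lvb Lp) (innerDl (L2D LNA Lqw) Lva Lp).
rewrite (innerDl LNA Lqw Lp) (innerNl LA Lp) (innerZl _ Lw Lp) (innerZl _ La Lp) (innerZl _ Lb Lp).
by rewrite -!/(fc phi _ _) (fc_opA pC2 qC sin1 cos2_sin2 eb)// mulNr.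
Qed.

Lemma obs_err_is_derive n t dz : inside T t -> is_derive t (1 : R) (zh n) dz ->
  is_derive t (1 : R) (fun s => obs_err (w s) (v s) (zt s) n)
    (fc phi (wd t) n - b_ n * vd t - dz).
Proof.
move=> It dzP; rewrite /obs_err.
have h1 := fc_w_is_derive pC2 qC qtC qtE eb NN adm sol n It.
have h2 := is_derive_cstM (b_ n) (v_is_derive NN adm sol It).
exact: is_deriveB (is_deriveB h1 h2) dzP.
Qed.

Lemma lstate_is_derive t : inside T t ->
  is_derive_col (fun s => lstate (w s) (v s) (zt s)) t
    (state (adt (low (zt t)) (low (obs_err (w t) (v t) (zt t)))
             (high (fun n => Num.sqrt (lam n) * obs_err (w t) (v t) (zt t) n))
             (trace_rem (w t)) (psi t))
       (bdt (low (obs_err (w t) (v t) (zt t)))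
          (high (fun n => Num.sqrt (lam n) * obs_err (w t) (v t) (zt t) n)) (trace_rem (w t)))
       (zdt (low (zt t)) (high (fun n => zh n t / lam n)) (psi t))
       (edt (high (fun n => Num.sqrt (lam n) * obs_err (w t) (v t) (zt t) n)))).
Proof.
move=> It; have vE : v t = kphi * (K *m low (zt t)) 0 0 + psi t by rewrite -control_low; ring.
have w0 := w0E th2 K vphi z zh t.
apply: is_derive_col_mx; apply: is_derive_col_mx => i.
- rewrite (adot_low _ _ vE); under eq_fun do rewrite mxE.
  by rewrite w0; exact: sol_obs_lo sol i t It.
(* In the error equation the derivative of b_n v cancels the term b_n v' of the equation for w_n,
   and a_n v combines with b_n v into beta_n v, which the observer reproduces. *)
- rewrite bdot_low; under eq_fun do rewrite mxE.
  have := obs_err_is_derive It (sol_obs_lo sol i It); rewrite fc_wdot// w0.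
  set S := \sum_(k < N) _ - _; congr (is_derive _ _ _ _).
  rewrite /obs_err /Defs.beta_; ring.
- rewrite (zdot_high _ vE); under eq_fun do rewrite mxE mulrC.
  apply: is_derive_cstM; apply: sol_obs_hi sol _ _ _ It.
  by rewrite leq_addr -ltn_subRL ltn_ord.
- rewrite edot_high; under eq_fun do rewrite mxE.
  apply: is_derive_cstM.
  have hn : (N0 <= N0 + i < N)%N by rewrite leq_addr -ltn_subRL ltn_ord.
  have := obs_err_is_derive It (sol_obs_hi sol hn It); rewrite fc_wdot//.
  congr (is_derive _ _ _ _); rewrite /obs_err /Defs.beta_; ring.
Qed.

Lemma htail_is_derive t : inside T t ->
  is_derive t (1 : R) (fun s => @htail _ p q lam phi N (w s))
    (2 * inner (opA p q (w t)) (wd t)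
     - \sum_(0 <= n < N) lam n * (2 * (fc phi (w t) n * fc phi (wd t) n))).
Proof.
move=> It; have h1 := form_w_is_derive pC2 qC qtC sin1 cos2_sin2 qtE NN adm sol It.
apply: (is_deriveB h1); apply: sum_is_derive => n _; apply: is_derive_cstM.
have h := fc_w_is_derive pC2 qC qtC qtE eb NN adm sol n It.
under eq_fun do rewrite expr2.
rewrite (_ : 2 * _ = fc phi (w t) n * fc phi (wd t) n + fc phi (w t) n * fc phi (wd t) n); last by ring.
exact: (is_deriveM h h).
Qed.

Local Notation ra := (sqnorm (remainder phi N a_fun)).
Local Notation rb := (sqnorm (remainder phi N b_fun)).

(** By Parseval the derivative of the tail is a series over n >= N; [tail_term] bounds it term by
    term, with [lam N <= lam n], and both sides pass to the limit. *)
Lemma htail_derive_le alpha t : inside T t -> 3 / 2 < alpha ->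
  2 * inner (opA p q (w t)) (wd t)
     - \sum_(0 <= n < N) lam n * (2 * (fc phi (w t) n * fc phi (wd t) n))
  <= 2 * (- (1 - 3 / (2 * alpha)) * lam N + qc) * @htail _ p q lam phi N (w t)
     + (alpha * (kphi ^+ 2 * u t ^+ 2 + psi t ^+ 2) * ra + alpha * vd t ^+ 2 * rb).
Proof.
move=> It al; have Dw := sol_w_domA sol (inside_upto It).
have LA := domA_opA_L2 pC2 qC Dw.
have Lwd := wdot_L2 pC2 qC qtC sol It.
have La := @a_fun_L2 R th2 p qt pC2 qtC; have Lb := @b_fun_L2 R th2.
have lhs : \sum_(N <= n < m) lam n * (2 * (fc phi (w t) n * fc phi (wd t) n)) @[m --> \oo] -->
    2 * inner (opA p q (w t)) (wd t)
     - \sum_(0 <= n < N) lam n * (2 * (fc phi (w t) n * fc phi (wd t) n)).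
  have h := parseval eb LA Lwd.
  have h2 : 2 * (\sum_(0 <= n < m) fc phi (opA p q (w t)) n * fc phi (wd t) n)
      - \sum_(0 <= n < N) lam n * (2 * (fc phi (w t) n * fc phi (wd t) n)) @[m --> \oo] -->
      2 * inner (opA p q (w t)) (wd t)
      - \sum_(0 <= n < N) lam n * (2 * (fc phi (w t) n * fc phi (wd t) n)).
    by apply: cvgB; [apply: cvgMr; exact: h|exact: cvg_cst].
  apply: cvg_trans h2; apply: near_eq_cvg; apply: (eventually_nat_ge (N := N)) => m Nm.
  rewrite -(sumB_prefix _ Nm); congr (_ - _); rewrite mulr_sumr; apply: eq_bigr => n _.
  by rewrite (fc_opA pC2 qC sin1 cos2_sin2 eb)//; ring.
have rhs : 2 * (- (1 - 3 / (2 * alpha)) * lam N + qc) * (\sum_(N <= n < m) lam n * fc phi (w t) n ^+ 2)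
     + (alpha * (kphi ^+ 2 * u t ^+ 2 + psi t ^+ 2) * (\sum_(N <= n < m) fc phi a_fun n ^+ 2)
     + alpha * vd t ^+ 2 * (\sum_(N <= n < m) fc phi b_fun n ^+ 2)) @[m --> \oo] -->
     2 * (- (1 - 3 / (2 * alpha)) * lam N + qc) * @htail _ p q lam phi N (w t)
     + (alpha * (kphi ^+ 2 * u t ^+ 2 + psi t ^+ 2) * ra + alpha * vd t ^+ 2 * rb).
  apply: cvgD.
    by apply: cvgMr; exact: (htail_cvg pC2 qC sin1 cos2_sin2 eb).
  by apply: cvgD; apply: cvgMr; exact: (remainder_sum eb).
apply: ler_cvg_to lhs rhs _; apply: nearW => m.
rewrite [X in _ <= X + _]mulr_sumr [X in _ <= _ + (X + _)]mulr_sumr [X in _ <= _ + (_ + X)]mulr_sumr.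
rewrite -!big_split /=; apply: ler_sum_nat => n /andP[Nn _].
have lN : lam N <= lam n.
  by move: Nn; rewrite leq_eqVlt => /predU1P[->//|/(lam_increasing eb)/ltW].
have := tail_term (fc phi (w t) n) qc kphi (u t) (psi t) (vd t) (a_ th2 p qt phi n) (b_ n) al (lam0 n) lN.
rewrite fc_wdot// /a_ /Defs.b_ -!/(fc phi _ _) (_ : kphi * u t + psi t = v t); last by ring.
apply: le_trans; rewrite le_eqVlt; apply/orP; left; apply/eqP; ring.
Qed.

(** The origin of [E_mx]: the control is K applied to the first block, so its derivative is K
    applied to [adot]. *)
Lemma vdot_low t : inside T t ->
  vd t = derive1 vphi (u t) * (K *m adt (low (zt t)) (low (obs_err (w t) (v t) (zt t)))
             (high (fun n => Num.sqrt (lam n) * obs_err (w t) (v t) (zt t) n))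
             (trace_rem (w t)) (psi t)) 0 0.
Proof.
move=> It; congr (_ * _); rewrite mxE; apply: eq_bigr => k _; congr (_ * _).
have vE : v t = kphi * (K *m low (zt t)) 0 0 + psi t by rewrite -control_low; ring.
rewrite (adot_low _ _ vE) (w0E th2 K vphi z zh t) derive1E.
by have [_ ->] := sol_obs_lo sol k It.
Qed.

Lemma lyap_decay (delta alpha beta tau : R) t : inside T t ->
  3 / 2 < alpha -> 0 < beta -> 0 < tau ->
  negsemidef (Theta1 th2 p qt qc lam phi K L delta kphi Dkphi Mphi P alpha beta gamma tau) ->
  Theta2 qc lam phi N delta alpha beta gamma <= 0 ->
  exists2 l, is_derive t (1 : R) (fun s => lyap (w s) (v s) (zt s)) l &
    l <= - (2 * delta) * lyap (w t) (v t) (zt t).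
Proof.
move=> It al be ta [_ Th1] Th2; have h1 := qf_is_derive (proj1 Pd) (lstate_is_derive It).
have h2 := is_derive_cstM gamma (htail_is_derive It).
eexists; first exact: (is_deriveD h1 h2).
have Dw := sol_w_domA sol (inside_upto It).
have := Th1 (col_mx (col_mx (lstate (w t) (v t) (zt t)) (trace_rem (w t))%:M) (psi t)%:M).
rewrite -/(qf _ _) Theta1_qf; last exact: (proj1 Pd).
rewrite -control_low => Q.
have kd2 : vd t ^+ 2 <= Mphi ^+ 2 * (K *m adt (low (zt t)) (low (obs_err (w t) (v t) (zt t)))
             (high (fun n => Num.sqrt (lam n) * obs_err (w t) (v t) (zt t) n))
             (trace_rem (w t)) (psi t)) 0 0 ^+ 2.
  rewrite (vdot_low It) exprMn ler_wpM2r ?sqr_ge0//.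
  exact: adm_slope adm _.
have z2 := trace_tail pC2 qC sin1 cos2_sin2 p0 q0 cot1_ge0 cot2_ge0 eb N Dw.
have h0 := @htail_ge0 _ _ _ _ _ _ _ pC2 qC sin1 cos2_sin2 eb N _ Dw.
have p2 := adm_sectorP Dk0 adm (u t).
have HT := htail_derive_le It al.
exact: decay_sum Q HT Th2 z2 p2 kd2 h0 (sqnorm_ge0 _) gamma0 be ta (lt_trans _ al).
Qed.

Lemma zh_cvg n t : (n < N)%N -> upto T t -> zh n s @[s --> within (upto T) (nbhs t)] --> zh n t.
Proof. by move=> nN Ut; have /subspace_continuousP := sol_zh_C0 sol nN; exact. Qed.

Lemma v_cvg t : upto T t -> v s @[s --> within (upto T) (nbhs t)] --> v t.
Proof.
move=> Ut; apply: continuous_cvg; first exact: (adm_cvg adm).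
rewrite /control; apply: cvg_sumf => k; apply: cvgMr.
by apply: zh_cvg => //; exact: leq_trans NN.
Qed.

Lemma fc_w_cvg n t : upto T t -> fc phi (w s) n @[s --> within (upto T) (nbhs t)] --> fc phi (w t) n.
Proof.
move=> Ut; have Lp : L2 (phi n) := domA_L2 (phi_domA eb n).
by apply: L2_cvg_inner => //; exact: sol_w_C0 sol _ Ut.
Qed.

Lemma form_w_cvg t : upto T t ->
  form p q (w s) @[s --> within (upto T) (nbhs t)] --> form p q (w t).
Proof.
move=> Ut; have E s : upto T s -> sqnorm (Ahalf lam phi (w s)) = form p q (w s).
  move=> /(sol_w_domA sol) D.
  exact: (sqnorm_Ahalf pC2 qC sin1 cos2_sin2 p0 q0 cot1_ge0 cot2_ge0 eb).
rewrite -E//; apply: cvg_trans (L2_cvg_sqnorm (sol_Ahalf_C0 sol Ut)).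
by apply: near_eq_cvg; rewrite near_withinE; apply: (@filterE _ (nbhs t)) => s /E.
Qed.

Lemma lyap_cvg t : upto T t -> lyap (w s) (v s) (zt s) @[s --> within (upto T) (nbhs t)]
  --> lyap (w t) (v t) (zt t).
Proof.
move=> Ut.
have ce n : (n < N)%N -> obs_err (w s) (v s) (zt s) n @[s --> within (upto T) (nbhs t)]
    --> obs_err (w t) (v t) (zt t) n.
  move=> nN; apply: cvgB; last exact: zh_cvg.
  by apply: cvgB; [exact: fc_w_cvg|apply: cvgMr; exact: v_cvg].
have hi (i : 'I_(N - N0)) : (N0 + i < N)%N by rewrite -ltn_subRL ltn_ord.
have lo (i : 'I_N0) : (i < N)%N by exact: leq_trans NN.
apply: cvgD.
  apply: qf_cvg; apply: col_mx_cvg; apply: col_mx_cvg => i; rewrite mxE; under eq_fun do rewrite mxE.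
  - exact: zh_cvg.
  - exact: ce.
  - by apply: cvgMl; exact: zh_cvg.
  - by apply: cvgMr; exact: ce.
apply: cvgMr; apply: cvgB; first exact: form_w_cvg.
apply: cvg_sumf => n; apply: cvgMr; under eq_fun do rewrite expr2.
by rewrite expr2; apply: cvgM; exact: fc_w_cvg.
Qed.

(** The product of V with exp(2 delta t) has nonpositive derivative for positive times and is
    continuous up to 0 by [lyap_cvg], hence it is nonincreasing. *)
Lemma lyap_exp_decay (delta alpha beta tau : R) t : upto T t ->
  3 / 2 < alpha -> 0 < beta -> 0 < tau ->
  negsemidef (Theta1 th2 p qt qc lam phi K L delta kphi Dkphi Mphi P alpha beta gamma tau) ->
  Theta2 qc lam phi N delta alpha beta gamma <= 0 ->
  lyap (w t) (v t) (zt t) <= expR (- 2 * delta * t) * lyap (w 0) (v 0) (zt 0).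
Proof.
move=> [t0 tT] al be ta Th1 Th2.
pose g s := expR (2 * delta * s) * lyap (w s) (v s) (zt s).
have ins s : s \in `]0, t[ -> inside T s.
  rewrite in_itv /= => /andP[s0 st]; split=> //.
  by rewrite (lt_trans _ tT)// lte_fin.
have up s : s \in `[0, t] -> upto T s.
  rewrite in_itv /= => /andP[s0 st]; split=> //.
  by rewrite (le_lt_trans _ tT)// lee_fin.
have dg s : inside T s -> exists2 l, is_derive s (1 : R) g l & l <= 0.
  move=> Is; have [l lP ll] := lyap_decay Is al be ta Th1 Th2.
  have e : is_derive s (1 : R) (fun r => expR (2 * delta * r)) (expR (2 * delta * s) * (2 * delta)).
    have h1 : is_derive s (1 : R) (fun r : R => 2 * delta * r) (2 * delta).
      by have := is_derive_cstM (2 * delta) (is_derive_id s (1 : R)); rewrite mulr1.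
    exact: (is_derive1_comp (is_derive_expR _) h1).
  eexists; first exact: (is_deriveM e lP).
  rewrite [leLHS](_ : _ = expR (2 * delta * s) * (l + 2 * delta * lyap (w s) (v s) (zt s))).
    by apply: mulr_ge0_le0; [exact: expR_ge0|lra].
  by rewrite /GRing.scale /=; ring.
have : g t <= g 0.
  apply: (ler0_derive1_le_cc (a := 0) (b := t)); last exact: t0.
  - by move=> s /ins /dg [l [D _]].
  - by move=> s /ins /dg [l lP l0]; rewrite derive1E derive_val.
  - apply: (@continuous_subspaceW _ _ _ (upto T)); first by move=> s /= /up.
    apply/subspace_continuousP => s Us; apply: cvgM; last exact: lyap_cvg.
    apply: cvg_within_filter; apply: continuous_cvg; first exact: continuous_expR.
    by apply: cvgMr; exact: cvg_id.
  - by rewrite in_itv /= lexx andbT.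
  - by rewrite in_itv /= lexx.
rewrite /g mulr0 expR0 mul1r => h.
rewrite (_ : - 2 * delta * t = - (2 * delta * t)); last by ring.
by rewrite expRN ler_pdivlMl ?expR_gt0.
Qed.

End AlongTrajectory.

(** * Equivalence of the functional with the norm of the claim *)

Lemma H1sqnormD_le (f g f' g' : R -> R) : is_wderiv f f' -> is_wderiv g g' ->
  H1sqnorm (fun x => f x + g x) <= 2 * H1sqnorm f + 2 * H1sqnorm g.
Proof.
move=> ff gg; rewrite (H1sqnorm_wderiv ff) (H1sqnorm_wderiv gg) (H1sqnorm_wderiv (is_wderivD ff gg)).
have := sqnormD_le (wderiv_L2 ff) (wderiv_L2 gg).
by case: (ff) (gg) => L1 _ [L2' _]; have := sqnormD_le L1 L2'; lra.
Qed.

Lemma H1sqnormZ (c : R) (f f' : R -> R) : is_wderiv f f' -> H1sqnorm (fun x => c * f x) = c ^+ 2 * H1sqnorm f.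
Proof.
move=> ff; rewrite (H1sqnorm_wderiv ff) (H1sqnorm_wderiv (is_wderivZ c ff)).
by case: (ff) => L1 _; rewrite !sqnormZ// ?mulrDr//; exact: wderiv_L2 ff.
Qed.

Lemma dot_lstate w v zh : dot (lstate w v zh) (lstate w v zh)
  = \sum_(i < N0) (zh i ^+ 2 + obs_err w v zh i ^+ 2)
    + \sum_(i < N - N0) ((zh (N0 + i)%N / lam (N0 + i)%N) ^+ 2
        + lam (N0 + i)%N * obs_err w v zh (N0 + i)%N ^+ 2).
Proof.
rewrite /lstate /state dot_state !big_split /= -!addrA; congr (_ + (_ + (_ + _)));
  rewrite dotE; apply: eq_bigr => i _; rewrite !mxE -expr2//.
by rewrite exprMn sqr_sqrtr// ltW.
Qed.

Lemma lam_le m n : (m <= n)%N -> lam m <= lam n.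
Proof. by rewrite leq_eqVlt => /predU1P[->//|/(lam_increasing eb)/ltW]. Qed.

Local Notation sq w v zh :=
  (\sum_(0 <= n < N) (zh n ^+ 2 + obs_err w v zh n ^+ 2)).

Lemma lstate_lower : exists2 c, 0 < c & forall w v zh,
  c * sq w v zh <= dot (lstate w v zh) (lstate w v zh).
Proof.
(* The three entries serve the unscaled slow modes, the division by lambda_n and the multiplication
   of e_n^2 by lambda_n. The constant may depend on N, which is fixed here. *)
pose c : R := Num.min 1 (Num.min ((lam N)^-1 ^+ 2) (lam 0)).
have c0 : 0 < c by rewrite !lt_min ltr01 lam0 exprn_gt0// invr_gt0.
have [c1 c2 c3] : [/\ c <= 1, c <= (lam N)^-1 ^+ 2 & c <= lam 0].
  by rewrite /c !ge_min !lexx !orbT.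
exists c => // w v zh; rewrite dot_lstate sum_split_low mulrDr !mulr_sumr.
apply: lerD; apply: ler_sum => i _.
  by rewrite ler_piMl// addr_ge0// sqr_ge0.
have l0 := lam0 (N0 + i)%N.
have iN : (N0 + i <= N)%N by rewrite ltnW// -ltn_subRL ltn_ord.
rewrite mulrDr; apply: lerD.
  rewrite expr_div_n mulrC ler_wpM2l ?sqr_ge0// (le_trans c2)// exprVn lef_pV2 ?posrE ?exprn_gt0//.
  by rewrite ler_sqr ?nnegrE ?(ltW l0) ?(ltW (lam0 _))// lam_le.
by rewrite ler_wpM2r ?sqr_ge0// (le_trans c3)// lam_le.
Qed.

Lemma lstate_upper : exists2 c, 0 < c & forall w v zh,
  dot (lstate w v zh) (lstate w v zh) <= c * sq w v zh.
Proof.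
pose c : R := 1 + (lam 0)^-1 ^+ 2 + lam N.
have i0 : 0 < (lam 0)^-1 ^+ 2 by rewrite exprn_gt0// invr_gt0.
have lN := lam0 N.
have [c1 c2 c3] : [/\ 1 <= c, (lam 0)^-1 ^+ 2 <= c & lam N <= c] by rewrite /c; split; lra.
have c0 : 0 < c by exact: lt_le_trans c1.
exists c => // w v zh; rewrite dot_lstate sum_split_low mulrDr !mulr_sumr.
apply: lerD; apply: ler_sum => i _.
  by rewrite ler_peMl// addr_ge0// sqr_ge0.
have l0 := lam0 (N0 + i)%N.
have iN : (N0 + i <= N)%N by rewrite ltnW// -ltn_subRL ltn_ord.
rewrite mulrDr; apply: lerD.
  rewrite expr_div_n mulrC ler_wpM2r ?sqr_ge0// (le_trans _ c2)// exprVn lef_pV2 ?posrE ?exprn_gt0//.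
  by rewrite ler_sqr ?nnegrE ?(ltW l0) ?(ltW (lam0 _))// lam_le.
by rewrite ler_wpM2r ?sqr_ge0// (le_trans _ c3)// lam_le.
Qed.

(** All that the norm equivalence retains of the nonlinearity, as supplied by [adm_growth]; the
    constants are therefore uniform in it. *)
Local Notation saturated v zh := (v ^+ 2 <= 4 * kphi ^+ 2 * (K *m low zh) 0 0 ^+ 2).

Lemma input_bounded : exists2 c, 0 <= c & forall v zh, saturated v zh ->
  v ^+ 2 <= c * \sum_(0 <= n < N) zh n ^+ 2.
Proof.
exists (4 * kphi ^+ 2 * frob K) => [|v zh vz].
  by rewrite mulr_ge0 ?frob_ge0// mulr_ge0// sqr_ge0.
apply: le_trans vz _; rewrite -[leRHS]mulrA ler_wpM2l//; first by rewrite mulr_ge0// sqr_ge0.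
have h := dot_mulmx_le K (low zh); rewrite {1}dotE big_ord1 -expr2 in h.
apply: le_trans h _; rewrite ler_wpM2l ?frob_ge0// dotE sum_split_low.
under eq_bigr do rewrite !mxE -expr2.
by rewrite lerDl sumr_ge0// => i _; exact: sqr_ge0.
Qed.

Lemma sqr_add3 (x y t : R) : (x + y + t) ^+ 2 <= 3 * (x ^+ 2 + y ^+ 2 + t ^+ 2).
Proof.
by have := sqr_ge0 (x - y); have := sqr_ge0 (x - t); have := sqr_ge0 (y - t); lra.
Qed.

Local Notation zfun w v := (fun x : R => w x - b_fun x * v).

Lemma H1sqnorm_w_z : exists2 c, 0 <= c & forall w v, domA th1 th2 w ->
  H1sqnorm (zfun w v) <= 2 * H1sqnorm w + c * v ^+ 2 /\
  H1sqnorm w <= 2 * H1sqnorm (zfun w v) + c * v ^+ 2.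
Proof.
have bW := H2_wderiv (b_fun_H2 th2).1.
have Hb0 : 0 <= H1sqnorm b_fun by rewrite (H1sqnorm_wderiv bW) addr_ge0// sqnorm_ge0.
exists (2 * H1sqnorm b_fun); first by rewrite mulr_ge0.
move=> w v [Hw _ _]; have wW := H2_wderiv Hw.
have zE : zfun w v = (fun x => w x + - v * b_fun x) by apply/funext => x; ring.
have zW := is_wderivD wW (is_wderivZ (- v) bW); rewrite zE; split.
  by have := H1sqnormD_le wW (is_wderivZ (- v) bW); rewrite (H1sqnormZ _ bW) sqrrN; lra.
have := H1sqnormD_le zW (is_wderivZ v bW); rewrite (H1sqnormZ _ bW).
rewrite (_ : (fun x => w x + - v * b_fun x + v * b_fun x) = w); first by lra.
by apply/funext => x; ring.
Qed.

Lemma sqnorm_le_H1 (f : R -> R) : H2 f -> sqnorm f <= H1sqnorm f.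
Proof. by move=> /H2_wderiv W; rewrite (H1sqnorm_wderiv W) lerDl sqnorm_ge0. Qed.

Lemma b_sum_le : \sum_(0 <= n < N) b_ n ^+ 2 <= sqnorm b_fun.
Proof. exact: (bessel eb N (@b_fun_L2 R th2)). Qed.

(** Besides the norm of z, the form of w is kept on the left: it is the quantity whose boundedness
    contradicts blow-up. *)
Lemma lyap_lower : exists2 c, 0 < c & forall w v zh, domA th1 th2 w -> saturated v zh ->
  c * (H1sqnorm (zfun w v) + form p q w + \sum_(0 <= n < N) zh n ^+ 2) <= lyap w v zh.
Proof.
have [cp cp0 cpP] := posdef_lower Pd; have [cl cl0 clP] := lstate_lower.
have [kv kv0 kvP] := input_bounded; have [hb hb0 hbP] := H1sqnorm_w_z.
have [cf cf0 cfP] := form_coercive pC2 qC sin1 cos2_sin2 p0 q0 cot1_ge0 cot2_ge0.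
pose sb : R := sqnorm b_fun; have sb0 : 0 <= sb := sqnorm_ge0 _.
have lN := lam0 N.
(* The part 2/cf pays for 2 |w|^2 in H^1 by coercivity, the part 1 for the form itself. In [be] the
   first summand covers the first N modes of the form, the second the input and zhat. *)
pose al : R := 2 / cf + 1; have al0 : 0 < al by rewrite ltr_wpDl// divr_ge0// ltW.
pose be : R := al * (3 * lam N * (1 + sb * kv)) + (hb * kv + 1).
have be0 : 0 < be.
  rewrite ltr_wpDl//; last by rewrite ltr_wpDl// mulr_ge0.
  by rewrite !mulr_ge0 ?(ltW al0) ?(ltW lN)// addr_ge0// mulr_ge0.
pose M : R := al / gamma + be / (cp * cl).
have M0 : 0 < M by rewrite addr_gt0// divr_gt0// mulr_gt0.
exists M^-1 => [|w v zh Dw vz]; first by rewrite invr_gt0.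
have h0 := @htail_ge0 _ _ _ _ _ _ _ pC2 qC sin1 cos2_sin2 eb N _ Dw.
rewrite ler_pdivrMl//.
have Z0 : 0 <= \sum_(0 <= n < N) zh n ^+ 2 by rewrite sumr_ge0// => n _; exact: sqr_ge0.
have E0 : 0 <= \sum_(0 <= n < N) obs_err w v zh n ^+ 2 by rewrite sumr_ge0// => n _; exact: sqr_ge0.
have v2 := kvP v zh vz; have [hz _] := hbP w v Dw; have fw := cfP w Dw.
have low_modes : \sum_(0 <= n < N) lam n * fc phi w n ^+ 2
    <= 3 * lam N * (1 + sb * kv) * sq w v zh.
  have h : \sum_(0 <= n < N) lam n * fc phi w n ^+ 2 <= \sum_(0 <= n < N)
      (3 * lam N * (obs_err w v zh n ^+ 2 + zh n ^+ 2) + 3 * lam N * (v ^+ 2 * b_ n ^+ 2)).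
    apply: ler_sum_nat => n /andP[_ nN].
    rewrite (@le_trans _ _ (lam N * fc phi w n ^+ 2))//.
      by rewrite ler_wpM2r ?sqr_ge0// lam_le// ltnW.
    have := sqr_add3 (obs_err w v zh n) (zh n) (b_ n * v).
    rewrite [X in X ^+ 2 <= _](_ : _ = fc phi w n); last by rewrite /obs_err; ring.
    move=> /(ler_wpM2l (ltW lN)) => h; apply: le_trans h _.
    by rewrite exprMn le_eqVlt; apply/orP; left; apply/eqP; ring.
  apply: le_trans h _; rewrite big_split /= -!mulr_sumr.
  have bs := b_sum_le; rewrite -/sb in bs.
  have h1 := ler_wpM2l (sqr_ge0 v) bs; have h2 := ler_wpM2r sb0 v2.
  have h3 : 0 <= sb * kv * \sum_(0 <= n < N) obs_err w v zh n ^+ 2 by rewrite !mulr_ge0.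
  rewrite -mulrDr -[leRHS]mulrA ler_wpM2l//; first by rewrite mulr_ge0// ltW.
  by rewrite !big_split /=; lra.
have fE : form p q w = @htail _ p q lam phi N w + \sum_(0 <= n < N) lam n * fc phi w n ^+ 2.
  by rewrite /htail subrK.
have sqE : sq w v zh = \sum_(0 <= n < N) zh n ^+ 2 + \sum_(0 <= n < N) obs_err w v zh n ^+ 2.
  by rewrite big_split.
have q1 : cp * cl * sq w v zh <= qf P (lstate w v zh).
  apply: le_trans (cpP _); rewrite -mulrA ler_wpM2l ?(ltW cp0)//.
have S0 : 0 <= sq w v zh by rewrite sqE addr_ge0.
have bound : H1sqnorm (zfun w v) + form p q w + \sum_(0 <= n < N) zh n ^+ 2
    <= al * @htail _ p q lam phi N w + be * sq w v zh.
  have g1 : 2 * H1sqnorm w <= 2 / cf * form p q w.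
    by rewrite mulrAC ler_pdivlMr// -mulrA ler_wpM2l// mulrC.
  have g2 := ler_wpM2l hb0 v2.
  have g3 := ler_wpM2l (ltW al0) low_modes.
  have g4 : 0 <= hb * kv * \sum_(0 <= n < N) obs_err w v zh n ^+ 2 by rewrite !mulr_ge0.
  exact: lyap_lower_arith hz g1 g2 g3 g4 fE sqE erefl E0.
apply: le_trans bound _.
have q2 : sq w v zh <= qf P (lstate w v zh) / (cp * cl).
  by rewrite ler_pdivlMr ?mulr_gt0// mulrC.
have qp0 : 0 <= qf P (lstate w v zh) by apply: le_trans q1; rewrite mulr_ge0// mulr_ge0// ltW.
have r1 : be * sq w v zh <= be / (cp * cl) * qf P (lstate w v zh).
  by rewrite -mulrA [_^-1 * _]mulrC ler_wpM2l// ltW.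
have r2 : al * @htail _ p q lam phi N w = al / gamma * (gamma * @htail _ p q lam phi N w).
  by field; rewrite gt_eqF.
have r3 : 0 <= al / gamma * qf P (lstate w v zh) by rewrite mulr_ge0// divr_ge0// ltW.
have r4 : 0 <= be / (cp * cl) * (gamma * @htail _ p q lam phi N w).
  have h1 : 0 <= be / (cp * cl) by exact: divr_ge0 (ltW be0) (mulr_ge0 (ltW cp0) (ltW cl0)).
  exact: mulr_ge0 h1 (mulr_ge0 (ltW gamma0) h0).
exact: two_weights r2 r1 r3 r4.
Qed.

Lemma lyap_upper : exists2 C, 0 < C & forall w v zh, domA th1 th2 w -> saturated v zh ->
  lyap w v zh <= C * (H1sqnorm (zfun w v) + \sum_(0 <= n < N) zh n ^+ 2).
Proof.
have [cl cl0 clP] := lstate_upper.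
have [kv kv0 kvP] := input_bounded; have [hb hb0 hbP] := H1sqnorm_w_z.
have [cf cf0 cfP] := form_bounded pC2 qC sin1 cos2_sin2 p0 cot1_ge0 cot2_ge0.
pose sb : R := sqnorm b_fun; have sb0 : 0 <= sb := sqnorm_ge0 _.
pose fp : R := 1 + frob P; have fp0 : 0 < fp by rewrite ltr_pwDl// frob_ge0.
pose al : R := fp * cl; have al0 : 0 < al by rewrite mulr_gt0.
(* The total coefficient of the H^1 norm of w, from the observer errors and from the tail, before w
   is replaced by z. *)
pose be : R := 3 * al + gamma * cf.
have be0 : 0 < be by rewrite addr_gt0// mulr_gt0.
pose ga : R := al * (4 + 3 * (sb * kv)) + be * (hb * kv).
have ga0 : 0 <= ga by rewrite addr_ge0// mulr_ge0 ?(ltW al0) ?(ltW be0)// ?addr_ge0// !mulr_ge0.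
exists (2 * be + ga) => [|w v zh Dw vz]; first by rewrite ltr_pwDl// mulr_gt0.
have [Hw _ _] := Dw.
have Z0 : 0 <= \sum_(0 <= n < N) zh n ^+ 2 by rewrite sumr_ge0// => n _; exact: sqr_ge0.
have v2 := kvP v zh vz; have [_ hz] := hbP w v Dw; have fw := cfP w Dw.
have Lw := sqnorm_le_H1 Hw.
have q1 : qf P (lstate w v zh) <= al * sq w v zh.
  apply: (@le_trans _ _ (fp * dot (lstate w v zh) (lstate w v zh))).
    have h := dot_young (lstate w v zh) (P *m lstate w v zh) (@ltr01 R).
    have h2 := dot_mulmx_le P (lstate w v zh); have h3 := dot_ge0 (lstate w v zh).
    have h4 := dot_ge0 (P *m lstate w v zh).
    rewrite invr1 !mul1r -qf_dot in h; rewrite /fp mulrDl mul1r.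
    have h5 : 0 <= frob P * dot (lstate w v zh) (lstate w v zh) by exact: le_trans h2.
    lra.
  by rewrite /al -mulrA ler_wpM2l ?(ltW fp0).
have err : \sum_(0 <= n < N) obs_err w v zh n ^+ 2
    <= 3 * (H1sqnorm w + sb * (v ^+ 2) + \sum_(0 <= n < N) zh n ^+ 2).
  have h : \sum_(0 <= n < N) obs_err w v zh n ^+ 2 <= \sum_(0 <= n < N)
      3 * (fc phi w n ^+ 2 + v ^+ 2 * b_ n ^+ 2 + zh n ^+ 2).
    apply: ler_sum => n _; have := sqr_add3 (fc phi w n) (- (b_ n * v)) (- zh n).
    by rewrite !sqrrN exprMn [b_ n ^+ 2 * _]mulrC.
  apply: le_trans h _; rewrite -mulr_sumr ler_wpM2l// !big_split /= lerD2r; apply: lerD.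
    by apply: le_trans (bessel eb N (domA_L2 Dw)) Lw.
  by rewrite -mulr_sumr mulrC ler_wpM2r ?sqr_ge0// b_sum_le.
have ht : @htail _ p q lam phi N w <= cf * H1sqnorm w.
  apply: le_trans fw; rewrite /htail -/(form p q w) gerBl sumr_ge0// => n _.
  by rewrite mulr_ge0 ?sqr_ge0// ltW.
have Hz0 : 0 <= H1sqnorm (zfun w v) by rewrite addr_ge0// sqnorm_ge0.
move: q1; rewrite big_split /= mulrDr => q1.
have g1 := ler_wpM2l (ltW al0) err; have g2 := ler_wpM2l (ltW gamma0) ht.
have g3 := ler_wpM2l (ltW be0) hz.
have g4 := ler_wpM2l (mulr_ge0 (ltW al0) sb0) v2.
have g5 := ler_wpM2l (mulr_ge0 (ltW be0) hb0) v2.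
have g6 : 0 <= ga * H1sqnorm (zfun w v) by rewrite mulr_ge0.
have g7 : 0 <= be * \sum_(0 <= n < N) zh n ^+ 2 by rewrite mulr_ge0// ltW.
exact: lyap_upper_arith q1 g1 g2 g3 g4 g5 g6 g7.
Qed.

End LyapunovFunctional.

Theorem theorem3 (R : realType) (th1 th2 : R) (p qt q : R -> R) (qc delta : R)
    (lam : nat -> R) (phi : nat -> R -> R)
    (N0 : nat) (K : 'rV[R]_N0) (L : 'cV[R]_N0) (kphi Mphi : R) :
  0 < th1 <= pi / 2 -> 0 <= th2 <= pi / 2 ->
  C2_01 p -> (forall x, I01 x -> 0 < p x) ->
  {within I01, continuous qt} ->
  0 < kphi -> 0 < Mphi ->
  {within I01, continuous q} ->
  (forall x, I01 x -> qt x = q x - qc) -> (forall x, I01 x -> 0 < q x) ->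
  eigenbasis th1 th2 p q lam phi ->
  0 < delta -> (1 <= N0)%N ->
  (forall n, (N0 <= n)%N -> - lam n + qc < - delta) ->
  spectrum_lt (A0 qc lam N0 + kphi *: (B0 th2 p qt qc lam phi N0 *m K))
    (- delta) ->
  spectrum_lt (A0 qc lam N0 - L *m C0 phi N0) (- delta) ->
  (forall (Dkphi : R) (N : nat), 0 < Dkphi < kphi -> (N0 + 1 <= N)%N ->
     (M_phi lam phi N < +oo)%E /\
     (feasible th2 p qt qc lam phi K L delta kphi Dkphi Mphi N ->
      exists2 M : R, 0 < M &
        forall vphi : R -> R, admissible kphi Dkphi Mphi vphi ->
        forall (z0 : R -> R) (zh0 : nat -> R),
          H2 z0 ->
          cos th1 * z0 0 - sin th1 * D01 z0 0 = 0 ->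
          cos th2 * z0 1 + sin th2 * D01 z0 1
            = vphi (\sum_(k < N0) K 0 k * zh0 k) ->
        forall (T : \bar R) (z : R -> R -> R) (zh : nat -> R -> R),
          trajectory th1 th2 p qt q qc lam phi K L N vphi z0 zh0 T z zh ->
          T = +oo%E /\
          forall t : R, 0 <= t ->
            H1sqnorm (z t) + \sum_(n < N) zh n t ^+ 2
            <= M * expR (- 2 * delta * t)
               * (H1sqnorm z0 + \sum_(n < N) zh0 n ^+ 2))) /\
  (exists2 Dkphi : R, 0 < Dkphi < kphi &
     exists N1 : nat, forall N : nat, (N1 <= N)%N -> (N0 + 1 <= N)%N ->
       feasible th2 p qt qc lam phi K L delta kphi Dkphi Mphi N).
Proof.
move=> /andP[th10 th11] /andP[th20 th21] pC2 p0 qtC k0 M0 qC qtE q0 eb de0 N00 gap specA specC.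
have pi0 := pi_gt0 R.
have sin1p : 0 < sin th1 by apply: sin_gt0_pi; rewrite th10 /=; lra.
have sin1 : sin th1 != 0 by rewrite gt_eqF.
have cos1 : 0 <= cos th1 by apply: cos_ge0_pihalf; rewrite th11 andbT; lra.
have cos2 : 0 <= cos th2 by apply: cos_ge0_pihalf; rewrite th21 andbT; lra.
have sin2 : 0 <= sin th2 by apply: sin_ge0_pi; rewrite th20 /=; lra.
have cs2 : sin th2 = 0 -> cos th2 != 0.
  move=> s0; apply/eqP => c0; have := cos2Dsin2 th2.
  by rewrite s0 c0 expr0n addr0 => /esym/eqP; rewrite oner_eq0.
have cot1_ge0 : 0 <= cot1 th1 by rewrite divr_ge0// ltW.
have cot2_ge0 : 0 <= cot2 th2 by rewrite divr_ge0.
split; last first.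
  exact (feasible_large pC2 qC qtC sin1 cs2 p0 q0 cot1_ge0 cot2_ge0 eb Mphi N00 gap specA specC k0).
move=> Dk N /andP[Dk0 Dkk] N0N; split.
  exact: (M_phi_lty pC2 qC sin1 cs2 p0 q0 cot1_ge0 cot2_ge0 eb).
have NN : (N0 <= N)%N by rewrite (leq_trans _ N0N)// leq_addr.
case=> P [alpha [beta [gamma [tau [Pd al [be ga ta] Th1 Th2]]]]].
have [c c0 lowP] := lyap_lower pC2 qC sin1 cs2 p0 q0 cot1_ge0 cot2_ge0 eb K NN kphi Pd ga.
have [C C0 upP] := lyap_upper pC2 qC sin1 cs2 p0 cot1_ge0 cot2_ge0 eb K NN kphi P ga.
(* Both constants are obtained before the nonlinearity and the initial data are introduced. *)
exists (C / c); first by rewrite divr_gt0.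
move=> vphi adm z0 zh0 Hz0 _ _ T z zh tr.
have sol := traj_solution tr; have U0 : upto T 0 by split=> //; exact: traj_T_gt0 tr.
pose w := homogenized th2 K vphi z zh; pose v t := vphi (control K zh t).
have zE t : (fun x => w t x - b_fun th2 x * v t) = z t.
  by apply/funext => x; rewrite /w /homogenized addrK.
have sat t : v t ^+ 2 <= 4 * kphi ^+ 2 * (K *m low N0 (zh^~ t)) 0 0 ^+ 2.
  by rewrite -control_low; exact: adm_growth Dk0 Dkk adm _.
have init : H1sqnorm (z 0) = H1sqnorm z0.
  (* [z 0] and [z0] agree on [0,1] only, so their norms are compared through a common weak
     derivative. *)
  have W0 := H2_wderiv Hz0; rewrite (H1sqnorm_wderiv W0).
  have W := is_wderiv_ext (fun x Ix => esym (traj_init_z tr Ix)) (fun x _ => erefl) W0.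
  by rewrite (H1sqnorm_wderiv W); congr (_ + _); apply: sqnorm_ext => x Ix; exact (traj_init_z tr Ix).
have main t : upto T t -> H1sqnorm (z t) + form p q (w t) + \sum_(n < N) zh n t ^+ 2
    <= C / c * expR (- 2 * delta * t) * (H1sqnorm z0 + \sum_(n < N) zh0 n ^+ 2).
  move=> Ut; have Dt := sol_w_domA sol Ut; have D0 := sol_w_domA sol U0.
  have l1 := lowP _ _ _ Dt (sat t); have u1 := upP _ _ _ D0 (sat 0).
  have dec := lyap_exp_decay pC2 qC qtC sin1 cs2 p0 q0 cot1_ge0 cot2_ge0 qtE eb NN Dk0 Pd ga adm sol Ut al be ta Th1 Th2.
  rewrite -/(w _) -/(v _) zE (big_mkord xpredT (fun n => zh n t ^+ 2)) in l1.
  rewrite -/(w _) -/(v _) zE init (big_mkord xpredT (fun n => zh n 0 ^+ 2)) in u1.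
  rewrite (eq_bigr (fun n : 'I_N => zh0 n ^+ 2)) in u1; last first.
    by move=> n _; rewrite (traj_init_zh tr).
  rewrite -(ler_pM2l c0) (le_trans l1)// (le_trans dec)//.
  rewrite [leRHS](_ : _ = expR (- 2 * delta * t) * (C * (H1sqnorm z0 + \sum_(n < N) zh0 n ^+ 2))).
    by rewrite ler_wpM2l ?expR_ge0.
  by field; rewrite gt_eqF.
have form0 t : upto T t -> 0 <= form p q (w t).
  move=> /(sol_w_domA sol) D; have := @htail_ge0 _ _ _ _ _ _ _ pC2 qC sin1 cs2 eb 0 _ D.
  by rewrite /htail big_geq// subr0.
have Ty : T = +oo%E.
  apply/eqP; rewrite -leye_eq leNgt; apply/negP => Tlt; apply: (traj_blowup tr Tlt).
  (* On a finite lifetime [main], with the exponential bounded by 1, bounds the form and the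
     observer state, against the blow-up alternative. *)
  exists (C / c * (H1sqnorm z0 + \sum_(n < N) zh0 n ^+ 2)) => t Ut.
  have D := sol_w_domA sol Ut.
  rewrite (sqnorm_Ahalf pC2 qC sin1 cs2 p0 q0 cot1_ge0 cot2_ge0 eb D).
  have h := main t Ut; have Hz : 0 <= H1sqnorm (z t) by rewrite addr_ge0// sqnorm_ge0.
  have B0 : 0 <= C / c * (H1sqnorm z0 + \sum_(n < N) zh0 n ^+ 2).
    rewrite mulr_ge0//; first by rewrite divr_ge0// ltW.
    by rewrite addr_ge0 ?addr_ge0 ?sqnorm_ge0// sumr_ge0// => n _; exact: sqr_ge0.
  have e1 : expR (- 2 * delta * t) <= 1.
    rewrite -[leRHS]expR0 ler_expR; have [t0 _] := Ut.
    by have := mulr_ge0 (ltW de0) t0; lra.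
  have := ler_wpM2l B0 e1; rewrite mulr1 => e2.
  rewrite mulrAC in h; rewrite -/(w t); lra.
split=> // t t0; have Ut : upto T t by split=> //; rewrite Ty ltry.
apply: le_trans (main t Ut); rewrite lerD2r lerDl; exact: form0.
Qed.
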